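(* Let $\chi_1:\mathbb N\to\mathbb N_0$ and $\chi_2:\mathbb N\to\mathbb N_0$ be two maps with finite supports $M=\mathrm{supp}(\chi_1)$ and $N=\mathrm{supp}(\chi_2)$. Define a map $\chi_3:\mathbb N\to\mathbb N_0$ by $$\Bigl(\prod_{m\in M}\Phi_m^{\chi_1(m)}\Bigr)\otimes\Bigl(\prod_{n\in N}\Phi_n^{\chi_2(n)}\Bigr)=\prod_{l\in\mathbb N}\Phi_l^{\chi_3(l)};$$ it has finite support. Let $P\supset\mathcal P(M)\cup\mathcal P(N)$ be a finite set of prime numbers, and let $(\succ_p^M)_{p\in P}$ and $(\succ_p^N)_{p\in P}$ be two tuples of excellent orders such that $\chi_1$ is compatible with $(\succ_p^M)_{p\in P}$ and $\chi_2$ is compatible with $(\succ_p^N)_{p\in P}$. Write $\succ_p^L:=\succ_p^M\otimes\succ_p^N$ for $p\in P$. Then: (a) $\chi_3$ is compatible with the tuple $(\succ_p^L)_{p\in P}$ of excellent orders. (b) Let $(M_1^{(st)},\dots,M_{l_{\chi_1}}^{(st)})$, $(N_1^{(st)},\dots,N_{l_{\chi_2}}^{(st)})$ and $(L_1^{(st)},\dots,L_{l_{\chi_3}}^{(st)})$ be the standard coverings of $\chi_1$, $\chi_2$ and $\chi_3$. Then $$\Bigl(\bigoplus_{i=1}^{l_{\chi_1}}\mathrm{Or}(M_i^{(st)})\Bigr)\otimes\Bigl(\bigoplus_{j=1}^{l_{\chi_2}}\mathrm{Or}(N_j^{(st)})\Bigr)\cong\bigoplus_{k=1}^{l_{\chi_3}}\mathrm{Or}(L_k^{(st)}),$$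 so the tensor product of sums of Orlik blocks on the left hand side admits a standard decomposition into Orlik blocks.
   Context: $\mathbb N=\{1,2,\dots\}$, $\mathbb N_0=\mathbb N\cup\{0\}$, $\mathbb Z_{[a,b]}=\mathbb Z\cap[a,b]$; $\Phi_m$ is the $m$-th cyclotomic polynomial; $v_p(m)$ is the exponent of the prime $p$ in $m$; $\pi_p(m):=m\cdot p^{-v_p(m)}$. $\mathcal P(M)$ is the set of primes dividing some element of $M$. For monic polynomials $f=\prod_{j}(t-\lambda_j)$ and $g=\prod_i(t-\kappa_i)$ whose zeros are roots of unity, $f\otimes g:=\prod_j\prod_i(t-\lambda_j\kappa_i)$. Orlik blocks: for a finite non-empty set $M\subset\mathbb N$, $\mathrm{Or}(M):=(\mathbb Z[t]/p_M\mathbb Z[t],\text{ multiplication by }t)$ with $p_M:=\prod_{m\in M}\Phi_m$. More generally, an Orlik block is a pair $(H,h)$ of a free $\mathbb Z$-module $H$ of finite rank $n\ge1$ and an automorphism $h$ of finite order such that $H=\bigoplus_{j=0}^{n-1}\mathbb Z h^j(a_0)$ for some $a_0\in H$; a decomposition $H=\bigoplus_{i=1}^kH^{(i)}$ into $h$-invariant Orlik blocks is standard if the characteristic polynomials satisfy $p_{H^{(k)},h}\mid\dots\mid p_{H^{(1)},h}$. Sums and tensor products (over $\mathbb Z$) carry the direct sum, respectively tensor product, of the automorphisms, and $\cong$ means isomorphism of $\mathbb Z$-modules compatible with the automorphisms. Standard covering: for $\chi:\mathbb N\to\mathbb N_0$ with finite support put $l_\chi:=\max(\chi(m)\mid m\in\mathbb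 N)$; the standard covering of $\chi$ is the tuple $(M_1^{(st)},\dots,M_{l_\chi}^{(st)})$ with $M_j^{(st)}=\{m\in\mathbb N\mid\chi(m)\geq j\}$ (the empty tuple if $\chi=0$). Excellent orders: an excellent order $\succ$ on $\mathbb Z_{[0,s(\succ)]}$ (with $s(\succ)\in\mathbb N_0$) is a strict total order determined by the set $S(\succ):=\{k\in\mathbb Z_{[0,s(\succ)]}\mid k\succ 0\}$ as follows: $\succ$ equals $>$ on $S(\succ)\cup\{0\}$ and $\succ$ equals $<$ on $\mathbb Z_{[0,s(\succ)]}-S(\succ)$. The tensor product $\succ_1\otimes\succ_2$ is the excellent order with $s(\succ_1\otimes\succ_2)=\max(s(\succ_1),s(\succ_2))$ and $S(\succ_1\otimes\succ_2)=(S(\succ_1)\cup S(\succ_2))-(S(\succ_1)\cap S(\succ_2))$. Compatibility: for a tuple $(\succ_p)_{p\in P}$ of excellent orders ($P$ a finite set of primes) let $V:=\{\prod_{p\in P}p^{k_p}\mid k_p\in\mathbb Z_{[0,s(\succ_p)]}\}$ and $E_V:=\bigcup_{p\in P}\{(m_a,m_b)\in V\times V\mid\pi_p(m_a)=\pi_p(m_b),\ v_p(m_a)\succ_pv_p(m_b)\}$. A map $\chi:\mathbb N\to\mathbb N_0$ with finite support is compatible with $(\succ_p)_{p\in P}$ (where $P\supset\mathcal P(\mathrm{supp}(\chi))$) if $\mathrm{supp}(\chi)\subset V$ and $\chi(m_a)\geq\chi(m_b)$ for every $(m_a,m_b)\in E_V$. *)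

(* Defs.v *)
From HB Require Import structures.
From mathcomp Require Import all_boot all_order all_algebra all_field.
From mathcomp Require Import finmap freeg.
From mathcomp Require Import boolp.

Set Implicit Arguments.
Unset Strict Implicit.
Unset Printing Implicit Defensive.

Import Order.TTheory GRing.Theory Num.Theory.
Import ring_quotient.Quotient.
Local Open Scope ring_scope.
Local Open Scope quotient_scope.

(** * Z-modules with an endomorphism *)

(* A pair (H, h). That h is an automorphism is not part of the structure:
   isomorphism of pairs does not depend on it, and the definition of Orlik
   blocks below asks for it. *)
Record zmodEnd := ZmodEnd {
  zcar :> zmodType;
  zact : {additive zcar -> zcar}
}.

Definition zmodEnd_iso (X Y : zmodEnd) : Prop :=
  exists f : {additive X -> Y},
    bijective f /\ forall x, f (zact X x) = zact Y (f x).

(** ** Finite direct sums *)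

Definition zzero : zmodEnd := @ZmodEnd 'rV[int]_0 \0.

Section DirectSum.
Variables X Y : zmodEnd.

Definition zsum_act (u : X * Y) : X * Y := (zact X u.1, zact Y u.2).

Fact zsum_act_is_zmod_morphism : zmod_morphism zsum_act.
Proof. by move=> [x y] [x' y']; rewrite /zsum_act /= !raddfB. Qed.

HB.instance Definition _ :=
  GRing.isZmodMorphism.Build (X * Y)%type (X * Y)%type zsum_act
    zsum_act_is_zmod_morphism.

Definition zsum : zmodEnd := @ZmodEnd (X * Y)%type zsum_act.

End DirectSum.

Definition zbigsum (s : seq zmodEnd) : zmodEnd := foldr zsum zzero s.

(** ** Tensor products over Z *)

Section TensorProduct.
Variables A B : zmodType.

(* The subgroup of the free abelian group on A x B that is generated by the
   bilinearity relations. *)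
Inductive tens_rel : {freeg (A * B)%type / int} -> Prop :=
| TensRel0 : tens_rel 0
| TensRelB x y : tens_rel x -> tens_rel y -> tens_rel (x - y)
| TensRelDl a a' b :
    tens_rel (<< (a + a', b) >> - << (a, b) >> - << (a', b) >>)
| TensRelDr a b b' :
    tens_rel (<< (a, b + b') >> - << (a, b) >> - << (a, b') >>).

Definition tens_ker : {pred {freeg (A * B)%type / int}} :=
  fun x => `[< tens_rel x >].

Fact tens_ker_zmod_closed : zmod_closed tens_ker.
Proof.
split=> [|x y]; first exact/asboolP/TensRel0.
by move=> /asboolP xR /asboolP yR; apply/asboolP/TensRelB.
Qed.

HB.instance Definition _ :=
  GRing.isZmodClosed.Build {freeg (A * B)%type / int} tens_ker
    tens_ker_zmod_closed.

Definition tens : zmodType := {quot tens_ker}.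

Definition tpure (a : A) (b : B) : tens := \pi_({quot tens_ker}) << (a, b) >>.

End TensorProduct.

Section TensorMap.
Variables (A B C D : zmodType).
Variables (f : {additive A -> C}) (g : {additive B -> D}).

Definition tens_map_pre : {freeg (A * B)%type / int} ->
    {freeg (C * D)%type / int} :=
  fglift (fun u : A * B => << (f u.1, g u.2) >>).

Definition tens_map (x : tens A B) : tens C D :=
  \pi_({quot (@tens_ker C D)}) (tens_map_pre (repr x)).

Lemma tens_map_preU a b : tens_map_pre << (a, b) >> = << (f a, g b) >>.
Proof. by rewrite /tens_map_pre liftU scale1r. Qed.

Fact tens_map_pre_is_zmod_morphism : zmod_morphism tens_map_pre.
Proof. exact: lift_is_additive. Qed.

HB.instance Definition _ :=
  GRing.isZmodMorphism.Build {freeg (A * B)%type / int}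
    {freeg (C * D)%type / int} tens_map_pre tens_map_pre_is_zmod_morphism.

Lemma tens_map_pre_rel x : tens_rel x -> tens_rel (tens_map_pre x).
Proof.
elim=> {x} [|x y _ IHx _ IHy|a a' b|a b b'].
- by rewrite raddf0; exact: TensRel0.
- by rewrite raddfB; exact: TensRelB.
- by rewrite !raddfB /= !tens_map_preU raddfD; exact: TensRelDl.
- by rewrite !raddfB /= !tens_map_preU raddfD; exact: TensRelDr.
Qed.

Lemma tens_map_pi x :
  tens_map (\pi_({quot (@tens_ker A B)}) x)
    = \pi_({quot (@tens_ker C D)}) (tens_map_pre x).
Proof.
apply/eqP; rewrite -idealrBE -raddfB; apply/asboolP/tens_map_pre_rel/asboolP.
by have /eqP := reprK (\pi_({quot (@tens_ker A B)}) x); rewrite -idealrBE.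
Qed.

Lemma tens_map_tpure a b : tens_map (tpure a b) = tpure (f a) (g b).
Proof. by rewrite /tpure tens_map_pi tens_map_preU. Qed.

Fact tens_map_is_zmod_morphism : zmod_morphism tens_map.
Proof.
move=> x y; rewrite -[x]reprK -[y]reprK.
by rewrite -pi_is_additive !tens_map_pi raddfB pi_is_additive.
Qed.

HB.instance Definition _ :=
  GRing.isZmodMorphism.Build (tens A B) (tens C D) tens_map
    tens_map_is_zmod_morphism.

End TensorMap.

Definition ztens (X Y : zmodEnd) : zmodEnd :=
  @ZmodEnd (tens X Y) (tens_map (zact X) (zact Y)).

(** * Orlik blocks *)

Definition zbasis (X : zmodEnd) (n : nat) (e : 'I_n -> X) : Prop :=
  forall x : X, exists! c : {ffun 'I_n -> int}, x = \sum_i e i *~ c i.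

(* p is the characteristic polynomial of h on H, read off from the matrix of h
   with respect to some Z-basis of H. *)
Definition is_char_poly (X : zmodEnd) (p : {poly int}) : Prop :=
  exists (n : nat) (e : 'I_n -> X) (A : 'M[int]_n),
    [/\ zbasis e,
        forall j, zact X (e j) = \sum_i e i *~ A i j
      & p = char_poly A].

Definition orlik_block (X : zmodEnd) : Prop :=
  [/\ bijective (zact X),
      exists2 N : nat, (0 < N)%N & forall x, iter N (zact X) x = x
    & exists2 n : nat, (0 < n)%N &
        exists a0 : X, zbasis (fun j : 'I_n => iter j (zact X) a0)].

Section Restriction.
Variables (X : zmodEnd) (S : zmodClosed X).

Record subz : predArgType := SubZ { subz_val : X; _ : subz_val \in S }.

HB.instance Definition _ := [isSub for subz_val].
HB.instance Definition _ := [Choice of subz by <:].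
HB.instance Definition _ := [SubChoice_isSubZmodule of subz by <:].

Hypothesis hS : forall x, x \in S -> zact X x \in S.

Definition subz_act (u : subz) : subz := SubZ (hS (valP u)).

Fact subz_act_is_zmod_morphism : zmod_morphism subz_act.
Proof. by move=> u v; apply: val_inj; rewrite /= !raddfB. Qed.

HB.instance Definition _ :=
  GRing.isZmodMorphism.Build subz subz subz_act subz_act_is_zmod_morphism.

Definition zrestr : zmodEnd := @ZmodEnd subz subz_act.

End Restriction.

(* The family (S i)_{i < k} is indexed from 0.  The case k = 0 is the empty
   decomposition of H = 0. *)
Definition standard_decomposition (X : zmodEnd) (k : nat)
    (S : 'I_k -> zmodClosed X) : Prop :=
  exists hS : forall i x, x \in S i -> zact X x \in S i,
    [/\ forall x : X, exists! y : {ffun 'I_k -> X},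
          (forall i, y i \in S i) /\ x = \sum_i y i,
        forall i, orlik_block (zrestr (hS i))
      & forall (i j : 'I_k) (p q : {poly int}), j = i.+1 :> nat ->
          is_char_poly (zrestr (hS i)) p -> is_char_poly (zrestr (hS j)) q ->
          exists r : {poly int}, p = r * q].

Definition has_standard_decomposition (X : zmodEnd) : Prop :=
  exists (k : nat) (S : 'I_k -> zmodClosed X), standard_decomposition S.

Definition cyclo_prod (M : {fset nat}) : {poly int} := \prod_(m <- M) 'Phi_m.

Section OrlikBlockOf.
Variable M : {fset nat}.

(* For M non-empty with 0 \notin M the modulus is monic of positive degree, so
   that {poly %/ _} is the genuine quotient of Z[t] and 'qX the class of t. *)
Definition Or_act (x : {poly %/ cyclo_prod M}) : {poly %/ cyclo_prod M} :=
  qpolyX (cyclo_prod M) * x.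

Fact Or_act_is_zmod_morphism : zmod_morphism Or_act.
Proof. by move=> x y; rewrite /Or_act mulrBr. Qed.

HB.instance Definition _ :=
  GRing.isZmodMorphism.Build {poly %/ cyclo_prod M} {poly %/ cyclo_prod M}
    Or_act Or_act_is_zmod_morphism.

Definition Or : zmodEnd := @ZmodEnd {poly %/ cyclo_prod M} Or_act.

End OrlikBlockOf.

(** * Multiplicity functions and standard coverings *)

(* Functions N -> N_0 with finite support, where N = {1, 2, ...}, are the
   finitely supported functions on nat whose support omits 0. *)
Notation mult_fun := {fsfun nat -> nat with 0%N}.

Definition pos_supp (chi : mult_fun) : Prop := 0%N \notin finsupp chi.

Definition mult_max (chi : mult_fun) : nat := \max_(m <- finsupp chi) chi m.

(* For j >= 1 this is {m | chi m >= j}. *)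
Definition std_cover_set (chi : mult_fun) (j : nat) : {fset nat} :=
  [fset m in finsupp chi | (j <= chi m)%N]%fset.

Definition std_cover (chi : mult_fun) : seq {fset nat} :=
  [seq std_cover_set chi j | j <- iota 1 (mult_max chi)].

Definition mult_poly (chi : mult_fun) : {poly int} :=
  \prod_(m <- finsupp chi) 'Phi_m ^+ chi m.

(* The zeros of p in algC, with multiplicity. *)
Definition croots (p : {poly algC}) : seq algC :=
  sval (closed_field_poly_normal p).

Definition poly_otimes (f g : {poly algC}) : {poly algC} :=
  \prod_(x <- croots f) \prod_(y <- croots g) ('X - (x * y)%:P).

Definition mult_otimes (chi1 chi2 chi3 : mult_fun) : Prop :=
  poly_otimes (map_poly intr (mult_poly chi1)) (map_poly intr (mult_poly chi2))
    = map_poly intr (mult_poly chi3).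

(** * Excellent orders *)

(* An excellent order on [0, s], as a relation on nat that holds only inside
   [0, s]; exc_gt k l is "k is larger than l". *)
Record excOrder := ExcOrder {
  exc_s : nat;
  exc_gt : rel nat;
  exc_dom : forall k l, exc_gt k l -> (k <= exc_s)%N && (l <= exc_s)%N;
  exc_irr : irreflexive exc_gt;
  exc_trans : transitive exc_gt;
  exc_total : forall k l, (k <= exc_s)%N -> (l <= exc_s)%N -> k != l ->
    exc_gt k l || exc_gt l k;
  exc_up : forall k l, (k == 0)%N || exc_gt k 0 -> (l == 0)%N || exc_gt l 0 ->
    exc_gt k l = (k > l)%N;
  exc_down : forall k l, (k <= exc_s)%N -> (l <= exc_s)%N ->
    ~~ exc_gt k 0 -> ~~ exc_gt l 0 -> exc_gt k l = (k < l)%N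
}.

Definition exc_S (o : excOrder) : pred nat := fun k => exc_gt o k 0.

Section ExcOfSet.
Variables (s : nat) (S : pred nat).
Hypotheses (S0 : ~~ S 0%N) (Ss : forall k, S k -> (k <= s)%N).

Definition exc_gt_of : rel nat := fun k l =>
  [&& (k <= s)%N, (l <= s)%N
    & if S k then ~~ S l || (k > l)%N else ~~ S l && (k < l)%N].

Lemma exc_gt_of0 k : exc_gt_of k 0 = S k.
Proof.
rewrite /exc_gt_of (negbTE S0) ltn0 leq0n andbF.
by case: (boolP (S k)) => [/Ss ->|_]; rewrite ?andbF.
Qed.

Fact exc_of_dom k l : exc_gt_of k l -> (k <= s)%N && (l <= s)%N.
Proof. by case/and3P=> ks ls _; rewrite ks. Qed.

Fact exc_of_irr : irreflexive exc_gt_of.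
Proof. by move=> k; rewrite /exc_gt_of ltnn; case: (S k); rewrite /= !andbF. Qed.

Fact exc_of_trans : transitive exc_gt_of.
Proof.
move=> l k m /and3P[ks _ kl] /and3P[_ ms lm].
rewrite /exc_gt_of ks ms /=; move: kl lm.
case: (S k); case: (S l); case: (S m) => //= kl lm.
  exact: ltn_trans lm kl.
exact: ltn_trans kl lm.
Qed.

Fact exc_of_total k l : (k <= s)%N -> (l <= s)%N -> k != l ->
  exc_gt_of k l || exc_gt_of l k.
Proof.
rewrite /exc_gt_of neq_ltn => -> -> /=.
by case: (S k); case: (S l) => //=; rewrite 1?orbC.
Qed.

Fact exc_of_up k l : (k == 0)%N || exc_gt_of k 0 ->
  (l == 0)%N || exc_gt_of l 0 -> exc_gt_of k l = (k > l)%N.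
Proof.
rewrite !exc_gt_of0 => /orP[/eqP->|Sk] /orP[/eqP->|Sl].
- by rewrite exc_of_irr.
- by rewrite /exc_gt_of (negbTE S0) Sl /= andbF.
- by rewrite exc_gt_of0 Sk lt0n; apply/esym; apply: contraTneq Sk => ->.
- by rewrite /exc_gt_of Sk Sl (Ss Sk) (Ss Sl).
Qed.

Fact exc_of_down k l : (k <= s)%N -> (l <= s)%N ->
  ~~ exc_gt_of k 0 -> ~~ exc_gt_of l 0 -> exc_gt_of k l = (k < l)%N.
Proof.
by move=> ks ls; rewrite !exc_gt_of0 /exc_gt_of ks ls => /negbTE-> /negbTE->.
Qed.

Definition exc_of : excOrder :=
  ExcOrder exc_of_dom exc_of_irr exc_of_trans exc_of_total exc_of_up
    exc_of_down.

End ExcOfSet.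

Section ExcTensor.
Variables o1 o2 : excOrder.

Definition exc_tens_S : pred nat := fun k => exc_S o1 k (+) exc_S o2 k.

Fact exc_tens_S0 : ~~ exc_tens_S 0.
Proof. by rewrite /exc_tens_S /exc_S !exc_irr. Qed.

Fact exc_tens_Ss k : exc_tens_S k -> (k <= maxn (exc_s o1) (exc_s o2))%N.
Proof.
rewrite /exc_tens_S /exc_S leq_max.
case: (boolP (exc_gt o1 k 0)) => [/exc_dom/andP[-> _] //|_ /=].
by move=> /exc_dom/andP[-> _]; rewrite orbT.
Qed.

Definition exc_tens : excOrder := exc_of exc_tens_S0 exc_tens_Ss.

Lemma exc_tens_sE : exc_s exc_tens = maxn (exc_s o1) (exc_s o2).
Proof. by []. Qed.

Lemma exc_tens_SE k : exc_S exc_tens k = exc_S o1 k (+) exc_S o2 k.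
Proof. exact: (exc_gt_of0 exc_tens_S0 exc_tens_Ss). Qed.

End ExcTensor.

(** * Compatibility *)

(* A tuple of excellent orders indexed by the finite set P of primes is given
   by a function on nat, of which only the values on P are used. *)
Section Compatibility.
Variables (P : {fset nat}) (o : nat -> excOrder).

Definition inV (m : nat) : Prop :=
  exists2 k : nat -> nat, (forall p, p \in P -> (k p <= exc_s (o p))%N)
    & m = (\prod_(p <- P) p ^ k p)%N.

Definition pi_part (p m : nat) : nat := (m %/ p ^ logn p m)%N.

Definition edgeV (ma mb : nat) : Prop :=
  [/\ inV ma, inV mb
    & exists2 p, p \in P & pi_part p ma = pi_part p mb /\
        exc_gt (o p) (logn p ma) (logn p mb)].

Definition covers_primes (chi : mult_fun) : Prop :=
  forall m p, m \in finsupp chi -> prime p -> (p %| m)%N -> p \in P.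

Definition compatible (chi : mult_fun) : Prop :=
  [/\ covers_primes chi,
      forall m, m \in finsupp chi -> inV m
    & forall ma mb, edgeV ma mb -> (chi mb <= chi ma)%N].

End Compatibility.

(* Main.v *)
Require Import Defs.
From HB Require Import structures.
From mathcomp Require Import all_boot all_order all_fingroup all_algebra
  all_field.
From mathcomp Require Import finmap freeg.
From mathcomp Require Import boolp.

From mathcomp Require Import zify ring.
Set Implicit Arguments.
Unset Strict Implicit.
Unset Printing Implicit Defensive.

Import Order.TTheory GRing.Theory Num.Theory.
Local Open Scope ring_scope.
Local Open Scope quotient_scope.

(** The idea.  Let f and g be the multiplicities chi1 and chi2, seen as
    functions on the group Z / N of N-th roots of unity, where N is a common
    multiple of the orders involved; the multiplicity chi3 is their convolution
    X.  Fix a prime power p^r and an element d of order p^r, and let K be the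
    subgroup of the elements whose order has p-part smaller than p^r.
    Compatibility with an excellent order says exactly that f, compared with its
    translate by d, is a d-invariant function plus a function h of constant sign
    supported on K, the sign depending on whether r lies in S.  If g is similarly
    an invariant function plus h', then X is an invariant function plus h * h'.
    Signs multiply, whence part (a), with the symmetric difference of the sets S
    (mono_conv_le, tensor_compatible).  The masses of h and h' multiply as well,
    and as K and K + d are disjoint this becomes an identity between the
    correlations of f, g and X with their translates by d
    (correlation_identity).

    For a single pair of blocks, H = Or(A) (x) Or(B) = Z[x, y] / (p_A(x), p_B(y))
    and t = x y.  The fibre of the multiplication of roots over a root t0 has
    X(t0) elements, told apart by x.  Let L_k be the set of orders at which
    X > k.  Claim: the elements t^j x^k with j < deg p_(L_k) form a Z-basis of H.
    Evaluation at the pairs of roots turns the monomials x^i y^j and the elements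
    t^j x^k into two matrices that Newton interpolation makes triangular, so that
    the squares of their determinants are, up to sign, products of differences of
    N-th roots of unity (det_mon_mx, det_orb_mx).  Up to units each difference is
    1 - zeta^d, which is itself a unit unless the order of d is a power of a
    prime; for those d, the correlation identity says that 1 - zeta^d occurs
    equally often on the two sides (cnt_identity).  Hence the base change has
    determinant 1 or -1 (base_change_unit).  It follows that the powers of x
    generate H over Z[t] in triangular form, and since
    L_0 contains L_1, and so on, the generator x^k can be corrected by lower ones
    so that p_(L_k)(t) kills it: H is the sum of the blocks Or(L_k)
    (tensor_presented).

    Sums of blocks are handled by distributivity.  The many blocks obtained are
    sorted by Or(A) + Or(B) = Or(A u B) + Or(A n B), which needs the products of
    cyclotomic polynomials over A - B and over B - A to be comaximal in Z[t]
    (block_merge).  This holds because Phi_m and Phi_n are comaximal unless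
    m / n or n / m is a power of a prime, and in that case compatibility does not
    let m and n lie one in each difference (aligned_comax).  Sorting does not
    change multiplicities and ends in a nested family, which is the standard
    covering (blocks_std_cover).  Finally the nested blocks, transported to the
    tensor product, form a standard decomposition; the characteristic polynomial
    of a cyclic summand is the generator of its annihilator, by the theorem of
    Cayley and Hamilton (cyclic_char_poly). *)

(** * Z[t]-module structure and presentations by cyclic summands *)

(** The structure of a Z[t]-module on H, where t acts as h. *)
Definition pact (X : zmodEnd) (q : {poly int}) (x : X) : X :=
  \sum_(i < size q) iter i (zact X) x *~ q`_i.

Section PolyAction.
Variable X : zmodEnd.
Implicit Types (q r : {poly int}) (x y : X).

Lemma pact_widen n q x : (size q <= n)%N ->
  pact q x = \sum_(i < n) iter i (zact X) x *~ q`_i.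
Proof.
move=> le_qn; rewrite /pact.
rewrite (big_ord_widen _ (fun i => iter i (zact X) x *~ q`_i) le_qn).
rewrite big_mkcond /=.
apply: eq_bigr => i _; case: ltnP => // /(nth_default 0) ->.
by rewrite mulr0z.
Qed.

Lemma iter_zact_is_zmod_morphism i : zmod_morphism (iter i (zact X)).
Proof. by elim: i => [|i IHi] x y //=; rewrite IHi raddfB. Qed.

HB.instance Definition _ i :=
  GRing.isZmodMorphism.Build X X (iter i (zact X))
    (iter_zact_is_zmod_morphism i).

Lemma pact_is_zmod_morphism q : zmod_morphism (@pact X q).
Proof.
move=> x y; rewrite /pact -sumrB; apply: eq_bigr => i _.
by rewrite raddfB mulrzBl.
Qed.

HB.instance Definition _ q :=
  GRing.isZmodMorphism.Build X X (@pact X q) (pact_is_zmod_morphism q).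

Lemma pactDl q r x : pact (q + r) x = pact q x + pact r x.
Proof.
pose n := maxn (size q) (size r).
rewrite !(@pact_widen n) ?leq_maxl ?leq_maxr ?size_polyD //.
by rewrite -big_split; apply: eq_bigr => i _; rewrite coefD mulrzDr.
Qed.

Lemma pact0l x : pact 0 x = 0.
Proof. by rewrite /pact size_poly0 big_ord0. Qed.

Lemma pactNl q x : pact (- q) x = - pact q x.
Proof. by apply/eqP; rewrite -addr_eq0 -pactDl addNr pact0l. Qed.

Lemma pactBl q r x : pact (q - r) x = pact q x - pact r x.
Proof. by rewrite pactDl pactNl. Qed.

Lemma pact_suml I (s : seq I) (P : pred I) (F : I -> {poly int}) x :
  pact (\sum_(i <- s | P i) F i) x = \sum_(i <- s | P i) pact (F i) x.
Proof.
by apply: (big_morph (fun q => pact q x)) => [q r|]; rewrite ?pactDl ?pact0l.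
Qed.

Lemma pactC c x : pact c%:P x = x *~ c.
Proof.
rewrite (@pact_widen 1) ?size_polyC ?leq_b1 // big_ord1 coefC eqxx.
by [].
Qed.

Lemma pact1 x : pact 1 x = x.
Proof. by rewrite -polyC1 pactC mulr1z. Qed.

Lemma pactMX q x : pact (q * 'X) x = zact X (pact q x).
Proof.
have le : (size (q * 'X)%R <= (size q).+1)%N.
  have [->|q0] := eqVneq q 0; first by rewrite mul0r size_poly0.
  by rewrite size_mulX.
rewrite (pact_widen _ le) big_ord_recl coefMX eqxx mulr0z add0r raddf_sum.
by apply: eq_bigr => i _; rewrite coefMX /= raddfMz.
Qed.

Lemma pactM q r x : pact (q * r) x = pact q (pact r x).
Proof.
elim/poly_ind: q => [|q c IHq]; first by rewrite mul0r !pact0l.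
rewrite mulrDl !pactDl -mulrAC !pactMX IHq; congr (_ + _).
rewrite pactC mul_polyC /pact.
case: (eqVneq c 0) => [->|c0]; first by rewrite scale0r size_poly0 big_ord0
  mulr0z.
rewrite size_scale // mulrz_suml; apply: eq_bigr => i _.
by rewrite coefZ mulrC mulrzA.
Qed.

Lemma pactXn n x : pact 'X^n x = iter n (zact X) x.
Proof.
elim: n => [|n IHn]; first by rewrite expr0 pact1.
by rewrite exprSr pactMX IHn.
Qed.

End PolyAction.

Lemma pact_morph (X Y : zmodEnd) (f : {additive X -> Y}) :
  (forall x, f (zact X x) = zact Y (f x)) ->
  forall q x, f (pact q x) = pact q (f x).
Proof.
move=> fh q x; rewrite raddf_sum; apply: eq_bigr => i _.
rewrite raddfMz; congr (_ *~ _).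
by elim: (i : nat) => //= j <-.
Qed.

Lemma pact_zsum (X Y : zmodEnd) q (x : X) (y : Y) :
  pact q ((x, y) : zsum X Y) = (pact q x, pact q y).
Proof.
elim/poly_ind: q => [|q c IHq]; first by rewrite !pact0l.
rewrite !pactDl !pactMX IHq !pactC; congr (_, _) => /=.
  by congr (_ + _); rewrite (raddfMz (@fst X Y)).
by congr (_ + _); rewrite (raddfMz (@snd X Y)).
Qed.

Lemma zmodEnd_iso_refl X : zmodEnd_iso X X.
Proof. by exists idfun; split=> //; exists id. Qed.

Lemma zmodEnd_iso_sym X Y : zmodEnd_iso X Y -> zmodEnd_iso Y X.
Proof.
move=> [f [[g fK gK] fh]].
have gB : zmod_morphism g.
  by move=> x y; apply: (can_inj fK); rewrite raddfB !gK.
pose gm := GRing.isZmodMorphism.Build Y X g gB.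
pose G : {additive Y -> X} := HB.pack g gm.
exists G; split; first by exists f.
by move=> x; apply: (can_inj fK); rewrite /= fh !gK.
Qed.

Lemma zmodEnd_iso_trans X Y Z :
  zmodEnd_iso X Y -> zmodEnd_iso Y Z -> zmodEnd_iso X Z.
Proof.
move=> [f [bf fh]] [g [bg gh]]; exists (g \o f); split; first exact: bij_comp.
by move=> x; rewrite /= fh gh.
Qed.

Lemma zsum_iso X X' Y Y' : zmodEnd_iso X X' -> zmodEnd_iso Y Y' ->
  zmodEnd_iso (zsum X Y) (zsum X' Y').
Proof.
move=> [f [[f' fK f'K] fh]] [g [[g' gK g'K] gh]].
pose F (u : zsum X Y) : zsum X' Y' := (f u.1, g u.2).
have FB : zmod_morphism F by move=> [x y] [x' y']; rewrite /F /= !raddfB.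
pose Fm := GRing.isZmodMorphism.Build (zsum X Y) (zsum X' Y') F FB.
pose FF : {additive zsum X Y -> zsum X' Y'} := HB.pack F Fm.
exists FF; split; last by move=> [x y]; rewrite /= /F /zsum_act /= fh gh.
exists (fun u : zsum X' Y' => (f' u.1, g' u.2)) => [[x y]|[x y]].
  by rewrite /= fK gK.
by rewrite /= /F /= f'K g'K.
Qed.

(** A decomposition of (H, h) into cyclic Z[t]-modules Z[t] / (p), for p in ps, by
    generators and relations.  Besides the characteristic polynomials of Orlik
    blocks, p = 1 is admitted, with a zero summand. *)
Definition presents (X : zmodEnd) (ps : seq {poly int}) (a : nat -> X) : Prop :=
  (forall x, exists q : nat -> {poly int},
      x = \sum_(k < size ps) pact (q k) (a k)) /\
  (forall q : nat -> {poly int},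
      \sum_(k < size ps) pact (q k) (a k) = 0 <->
      forall k, (k < size ps)%N -> exists r, q k = r * ps`_k).

Definition presented X ps := exists a, @presents X ps a.

(** The additive map between modules with the same presentation that carries
   generators to generators: well defined and injective because both sides have
   the same relations. *)
Lemma presented_iso X Y ps :
  presented X ps -> presented Y ps -> zmodEnd_iso X Y.
Proof.
move=> [a [ga ra]] [b [gb rb]].
have [Q QE] := choice ga; have [R RE] := choice gb.
pose f x : Y := \sum_(k < size ps) pact (Q x k) (b k).
pose g y : X := \sum_(k < size ps) pact (R y k) (a k).
have sumB (Z : zmodEnd) (c : nat -> Z) (q r : nat -> {poly int}) :
    \sum_(k < size ps) pact (q k) (c k) - \sum_(k < size ps) pact (r k) (c k)
      = \sum_(k < size ps) pact (q k - r k) (c k).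
  by rewrite -sumrB; apply: eq_bigr => k _; rewrite pactBl.
have tr (q r : nat -> {poly int}) :
    \sum_(k < size ps) pact (q k) (a k) = \sum_(k < size ps) pact (r k) (a k)
    <-> \sum_(k < size ps) pact (q k) (b k) = \sum_(k < size ps) pact (r k) (b
      k).
  split=> /eqP; rewrite -subr_eq0 sumB => /eqP;
    [rewrite (ra (fun k => q k - r k)) => /(rb (fun k => q k - r k))
    |rewrite (rb (fun k => q k - r k)) => /(ra (fun k => q k - r k))];
    by rewrite -sumB => /eqP; rewrite subr_eq0 => /eqP.
have fE x (q : nat -> {poly int}) : x = \sum_(k < size ps) pact (q k) (a k) ->
    f x = \sum_(k < size ps) pact (q k) (b k).
  move=> E; rewrite /f; have := proj1 (tr (Q x) q); apply; rewrite -QE.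
  exact: E.
have gE y (q : nat -> {poly int}) : y = \sum_(k < size ps) pact (q k) (b k) ->
    g y = \sum_(k < size ps) pact (q k) (a k).
  move=> E; rewrite /g; have := proj2 (tr (R y) q); apply; rewrite -RE.
  exact: E.
have fB : zmod_morphism f.
  move=> x y; rewrite (fE (x - y) (fun k => Q x k - Q y k)) /f ?sumB //.
  by rewrite {1}(QE x) {1}(QE y) sumB.
pose fm := GRing.isZmodMorphism.Build X Y f fB.
pose F : {additive X -> Y} := HB.pack f fm.
exists F; split.
  exists g => [x|y] /=.
    by rewrite (gE _ (Q x)) // -QE.
  by rewrite (fE _ (R y)) // -RE.
move=> x; rewrite /= (fE (zact X x) (fun k => Q x k * 'X)).
  rewrite raddf_sum; apply: eq_bigr => k _; exact: pactMX.
by rewrite {1}(QE x) raddf_sum; apply: eq_bigr => k _; rewrite pactMX.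
Qed.

Lemma presented_of_iso X Y ps : zmodEnd_iso X Y -> presented X ps ->
  presented Y ps.
Proof.
move=> [f [[g fK gK] fh]] [a [ga ra]]; exists (f \o a).
have fS (q : nat -> {poly int}) : f (\sum_(k < size ps) pact (q k) (a k))
    = \sum_(k < size ps) pact (q k) (f (a k)).
  by rewrite raddf_sum; apply: eq_bigr => k _; rewrite (pact_morph fh).
split=> [y|q] /=.
  by have [q E] := ga (g y); exists q; rewrite -fS -E gK.
rewrite -fS -ra; split=> [/(congr1 g)|->]; last by rewrite raddf0.
by rewrite fK => ->; apply: (can_inj fK); rewrite gK raddf0.
Qed.

Lemma presented_zzero : presented zzero [::].
Proof.
exists (fun=> 0); split=> [x|q]; last by rewrite big_ord0.
by exists (fun=> 0); rewrite big_ord0; exact: thinmx0.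
Qed.

Lemma presented_zsum X Y p ps : presented X [:: p] -> presented Y ps ->
  presented (zsum X Y) (p :: ps).
Proof.
move=> [a [ga ra]] [b [gb rb]].
pose c k : zsum X Y := if k is j.+1 then (0, b j) else (a 0%N, 0).
have cS (q : nat -> {poly int}) : \sum_(k < size (p :: ps)) pact (q k) (c k)
    = (pact (q 0%N) (a 0%N), \sum_(k < size ps) pact (q k.+1) (b k)).
  rewrite big_ord_recl /= pact_zsum raddf0.
  under eq_bigr => k _ do rewrite pact_zsum raddf0.
  apply/eqP; rewrite xpair_eqE (raddf_sum (@fst X Y)) (raddf_sum (@snd X Y)) /=.
  by rewrite big1 // addr0 add0r !eqxx.
exists c; split=> [[x y]|q].
  have [q] := ga x; rewrite big_ord1 => ->; have [r ->] := gb y.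
  exists (fun k => if k is j.+1 then r j else q 0%N); apply/esym.
  exact: (cS (fun k => if k is j.+1 then r j else q 0%N)).
rewrite cS; split.
  case=> E1 /(rb (q \o S)) E2 [|k] /= kn; last exact: E2.
  by apply: (proj1 (ra q)) 0%N isT; rewrite big_ord1.
move=> E; rewrite (_ : pact _ _ = 0).
  by rewrite (_ : \sum_(_ < _) _ = 0) //; apply/(rb (q \o S)) => k; apply:
    (E k.+1).
have := proj2 (ra q); rewrite big_ord1; apply=> -[|//] _; exact: (E 0%N).
Qed.

(** * Comaximality of cyclotomic polynomials *)

Definition comax (p q : {poly int}) := exists u v, u * p + v * q = 1.

Lemma comax_sym p q : comax p q -> comax q p.
Proof. by move=> [u [v E]]; exists v, u; rewrite addrC. Qed.

Lemma comaxM p q r : comax p r -> comax q r -> comax (p * q) r.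
Proof.
move=> [u [v E]] [u' [v' E']].
exists (u * u'), (u * p * v' + v * (u' * q) + v * v' * r).
by rewrite -[RHS]mulr1 -{1}E -E'; ring.
Qed.

Lemma comax1 r : comax 1 r.
Proof. by exists 1, 0; rewrite mulr1 mul0r addr0. Qed.

Lemma comax_prod (I : eqType) (s : seq I) (F : I -> {poly int}) r :
  (forall i, i \in s -> comax (F i) r) -> comax (\prod_(i <- s) F i) r.
Proof.
move=> cF; rewrite big_seq; apply: (big_ind (fun p => comax p r)) => //;
  first exact: comax1.
by move=> p q; apply: comaxM.
Qed.

Lemma Xn_sub1_neq0 n : (0 < n)%N -> 'X^n - 1 != 0 :> {poly int}.
Proof. by move=> n0; rewrite monic_neq0 // monicXnsubC. Qed.

Lemma Xn_sub1_mul m k :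
  'X^(m * k) - 1 = ('X^m - 1) * \sum_(i < k) 'X^(m * i) :> {poly int}.
Proof.
rewrite exprM subrX1; congr (_ * _); apply: eq_bigr => i _.
by rewrite exprM.
Qed.

Lemma Cyclotomic_dvd_Xn_sub1 n : (0 < n)%N ->
  exists s, 'X^n - 1 = 'Phi_n * s :> {poly int}.
Proof.
move=> n0; rewrite -prod_Cyclotomic // (big_rem n) -?dvdn_divisors //=.
by eexists.
Qed.

(** The factors Phi_e of t^m - 1 with e dividing d make up t^d - 1, and Phi_m is
    one of the others. *)
Lemma Xn_sub1_proper d m : (0 < m)%N -> (d %| m)%N -> d != m ->
  exists s, 'X^m - 1 = ('X^d - 1) * ('Phi_m * s) :> {poly int}.
Proof.
move=> m0 dm ndm; have d0 : (0 < d)%N := dvdn_gt0 m0 dm.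
rewrite -prod_Cyclotomic // -(prod_Cyclotomic d0).
rewrite (bigID (fun e => (e %| d)%N)) /= -big_filter.
rewrite (perm_big (divisors d)) /=; last first.
  apply: uniq_perm; rewrite ?filter_uniq ?divisors_uniq // => e.
  rewrite mem_filter -!dvdn_divisors //.
  by apply: andb_idr => /dvdn_trans; apply.
rewrite -[X in _ * X]big_filter [X in _ * X](big_rem m) /=; first by eexists.
rewrite mem_filter -dvdn_divisors // dvdnn andbT.
by apply: contra ndm => md; rewrite eqn_dvd dm.
Qed.

(** The ideal of Z[t] generated by t^m - 1 and t^n - 1 contains
    t^gcd(m, n) - 1; factoring the latter out leaves Phi_m and Phi_n on the two
    sides as soon as neither of m and n divides the other. *)
Lemma Cyclotomic_comax_ndvd m n : (0 < m)%N -> (0 < n)%N ->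
  ~~ (m %| n)%N -> ~~ (n %| m)%N -> comax 'Phi_m 'Phi_n.
Proof.
move=> m0 n0 nmn nnm; set d := gcdn m n.
have d0 : (0 < d)%N by rewrite gcdn_gt0 m0.
have [s Es] : exists s, 'X^m - 1 = ('X^d - 1) * ('Phi_m * s) :> {poly int}.
  apply: Xn_sub1_proper => //; rewrite ?dvdn_gcdl //.
  by apply: contra nmn => /eqP <-; exact: dvdn_gcdr.
have [s' Es'] : exists s, 'X^n - 1 = ('X^d - 1) * ('Phi_n * s) :> {poly int}.
  apply: Xn_sub1_proper => //; rewrite ?dvdn_gcdr //.
  by apply: contra nnm => /eqP <-; exact: dvdn_gcdl.
case: (egcdnP n m0) => a b Eab _.
pose u : {poly int} := \sum_(i < a) 'X^(m * i).
pose v : {poly int} := 'X^d * \sum_(i < b) 'X^(n * i).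
have E : ('X^m - 1) * u - ('X^n - 1) * v = 'X^d - 1.
  rewrite /u /v -Xn_sub1_mul mulrCA -Xn_sub1_mul mulnC Eab.
  rewrite -/d [(n * b)%N]mulnC exprD; ring.
exists (s * u), (- s' * v).
apply: (mulfI (Xn_sub1_neq0 d0)); rewrite mulr1 -[RHS]E Es Es'; ring.
Qed.

(** If m = n a b with a, b > 1 coprime, then modulo t^n - 1 the multiples
    (t^m - 1) / (t^(m/a) - 1) and (t^m - 1) / (t^(m/b) - 1) of Phi_m become the
    coprime integers a and b. *)
Lemma Cyclotomic_comax_dvd m n : (0 < m)%N -> (n %| m)%N ->
  (forall p k, prime p -> m != (n * p ^ k)%N) -> comax 'Phi_m 'Phi_n.
Proof.
move=> m0 nm npp; have n0 : (0 < n)%N := dvdn_gt0 m0 nm.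
set k := (m %/ n)%N; have Ek : m = (n * k)%N by rewrite mulnC divnK.
have k0 : (0 < k)%N by move: m0; rewrite Ek muln_gt0 => /andP[].
have k1 : (1 < k)%N.
  rewrite ltn_neqAle k0 andbT eq_sym; apply/eqP => k1.
  by have := npp 2%N 0%N isT; rewrite Ek k1 eqxx.
set p := pdiv k; have pp : prime p := pdiv_prime k1.
set a := (k`_p)%N; set b := (k`_p^')%N.
have Eab : k = (a * b)%N by rewrite /a /b partnC.
have cab : coprime a b by apply: coprime_partC.
have key x y : k = (x * y)%N -> (x != 1)%N ->
    exists s w, x%:R = 'Phi_m * s - 'Phi_n * w :> {poly int}.
  move=> Exy x1; have Em : m = (n * y * x)%N by rewrite -mulnA (mulnC y) -Exy.
  have [s Es] : exists s, 'X^m - 1 = ('X^(n * y) - 1) * ('Phi_m * s)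
      :> {poly int}.
    apply: Xn_sub1_proper => //; first by rewrite Em dvdn_mulr.
    apply: contra x1 => /eqP E; move: m0 Em; rewrite -E => m0 Em.
    by rewrite -(eqn_pmul2l m0) -Em muln1.
  have [w Ew] := Cyclotomic_dvd_Xn_sub1 n0.
  have ny0 : (0 < n * y)%N by move: m0; rewrite Em muln_gt0 => /andP[].
  have Es2 : \sum_(i < x) 'X^(n * y * i) = 'Phi_m * s :> {poly int}.
    by apply: (mulfI (Xn_sub1_neq0 ny0)); rewrite -Es -Xn_sub1_mul -Em.
  exists s, (w * \sum_(i < x) \sum_(j < y * i) 'X^(n * j)).
  rewrite mulrA -Ew mulr_sumr -Es2.
  under [X in _ - X]eq_bigr => i _ do rewrite -Xn_sub1_mul mulnA.
  by rewrite sumrB opprB addrC subrK sumr_const card_ord.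
have a1 : (a != 1)%N.
  by rewrite /a p_part_eq1 pi_pdiv negbK.
have b1 : (b != 1)%N.
  apply: contraTneq (npp p (logn p k) pp) => b1; rewrite negbK.
  by rewrite -p_part -/a {1}Ek {1}Eab b1 muln1.
have [s [w Ea]] := key _ _ Eab a1.
have [s' [w' Eb]] := key _ _ (etrans Eab (mulnC a b)) b1.
have a0 : (0 < a)%N by rewrite part_gt0.
case: (egcdnP b a0) => x y Exy _; rewrite (eqP cab) in Exy.
exists (x%:R * s - y%:R * s'), (y%:R * w' - x%:R * w).
have : (x * a)%:R - (y * b)%:R = 1 :> {poly int}.
  by rewrite Exy natrD addrC addKr.
by apply: etrans; rewrite !natrM Ea Eb; ring.
Qed.

Lemma Cyclotomic_comax m n : (0 < m)%N -> (0 < n)%N ->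
  (forall p k, prime p -> m != (n * p ^ k)%N) ->
  (forall p k, prime p -> n != (m * p ^ k)%N) -> comax 'Phi_m 'Phi_n.
Proof.
move=> m0 n0 Hm Hn.
have [nm|nnm] := boolP (n %| m)%N; first exact: Cyclotomic_comax_dvd.
have [mn|nmn] := boolP (m %| n)%N; last exact: Cyclotomic_comax_ndvd.
exact/comax_sym/Cyclotomic_comax_dvd.
Qed.

(** * Presentations of Orlik blocks *)

Lemma cyclo_prod_monic M : cyclo_prod M \is monic.
Proof. by apply: monic_prod => m _; exact: Cyclotomic_monic. Qed.

Lemma cyclo_prod0 : cyclo_prod fset0 = 1.
Proof. by rewrite /cyclo_prod big_seq_fset0. Qed.

Lemma size_cyclo_prod_gt1 (M : {fset nat}) :
  M != fset0 -> 0%N \notin M -> (1 < size (cyclo_prod M))%N.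
Proof.
move=> /fset0Pn[m mM] M0; have m0 : (0 < m)%N.
  by rewrite lt0n; apply: contraNneq M0 => <-.
rewrite /cyclo_prod (big_rem m) //= size_monicM ?Cyclotomic_monic //;
  last first.
  by apply: monic_neq0; apply: monic_prod => i _; exact: Cyclotomic_monic.
rewrite size_Cyclotomic addSn /= -add1n leq_add ?totient_gt0 //.
rewrite size_poly_gt0; apply: monic_neq0; apply: monic_prod => i _.
exact: Cyclotomic_monic.
Qed.

Lemma mk_monic_cyclo_prod (M : {fset nat}) : M != fset0 -> 0%N \notin M ->
  mk_monic (cyclo_prod M) = cyclo_prod M.
Proof.
by move=> M0 M1; rewrite /mk_monic size_cyclo_prod_gt1 // cyclo_prod_monic.
Qed.

Lemma pact_Or M (q : {poly int}) (x : Or M) :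
  pact q x = (in_qpoly (cyclo_prod M) q * (x : {poly %/ cyclo_prod M})).
Proof.
elim/poly_ind: q => [|q c IHq]; first by rewrite pact0l rmorph0 mul0r.
rewrite pactDl pactMX IHq rmorphD rmorphM /= mulrDl; congr (_ + _).
  by rewrite /Or_act mulrA (mulrC (qpolyX _)).
rewrite pactC (_ : c%:P = c%:~R) ?rmorph_int ?mulrzl //.
by rewrite -[c in LHS]intz rmorph_int.
Qed.

Lemma in_qpolyK p (x : {poly %/ p}) : in_qpoly p (x : {poly int}) = x.
Proof. by apply: val_inj; exact: in_qpoly_small (size_mk_monic x). Qed.

Lemma presented_Or (M : {fset nat}) : M != fset0 -> 0%N \notin M ->
  presented (Or M) [:: cyclo_prod M].
Proof.
move=> M0 M1; exists (fun=> (1 : {poly %/ cyclo_prod M})).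
split=> [x|q].
  exists (fun=> (x : {poly %/ cyclo_prod M})).
  by rewrite big_ord1 pact_Or mulr1 in_qpolyK.
rewrite big_ord1 pact_Or mulr1; split.
  move=> /(congr1 val) /= + [|//] _; rewrite mk_monic_cyclo_prod // => E.
  apply/(Pdiv.RingMonic.rdvdpP (cyclo_prod_monic M)).
  exact/Pdiv.CommonRing.rmodp_eq0P.
move=> /(_ 0%N isT)[r /= ->]; apply: val_inj; rewrite /= mk_monic_cyclo_prod //.
exact: Pdiv.RingMonic.rmodp_mull (cyclo_prod_monic M) _.
Qed.

(** The empty set is set apart because {poly %/ 1} is Z[t] / (t), not 0. *)
Definition block (M : {fset nat}) : zmodEnd :=
  if M == fset0 then zzero else Or M.

Lemma presented_block (M : {fset nat}) : 0%N \notin M ->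
  presented (block M) [:: cyclo_prod M].
Proof.
rewrite /block; case: eqP => [-> _|/eqP ? ?]; last exact: presented_Or.
exists (fun=> 0); split=> [x|q].
  by exists (fun=> 0); rewrite big_ord1 raddf0; exact: thinmx0.
rewrite big_ord1 raddf0 cyclo_prod0; split=> // _ [|//] _.
by exists (q 0%N); rewrite mulr1.
Qed.

(** Two cyclic modules Z[t]/(d a) and Z[t]/(d b) with u a + v b = 1: the new
    generators are e1 + e2, with annihilator d a b, and u a e1 - v b e2, with
    annihilator d; the base change has determinant - (u a + v b). *)
Lemma presented_merge X d a b : comax a b ->
  presented X [:: d * a; d * b] -> presented X [:: d * a * b; d].
Proof.
move=> [u [v E]] [e [ge re]].
have {}ge x : exists q1 q2, x = pact q1 (e 0%N) + pact q2 (e 1%N).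
  have [q ->] := ge x; exists (q 0%N), (q 1%N).
  by rewrite big_ord_recl big_ord1.
have {}re q1 q2 : pact q1 (e 0%N) + pact q2 (e 1%N) = 0 <->
    (exists r, q1 = r * (d * a)) /\ (exists r, q2 = r * (d * b)).
  have := re (fun k => if k is 0%N then q1 else q2).
  rewrite big_ord_recl big_ord1 /= => ->; split=> [H|[H1 H2] [|[|]] //].
  by split; [apply: (H 0%N) | apply: (H 1%N)].
pose f k : X := if k is 0%N then e 0%N + e 1%N
                else pact (u * a) (e 0%N) - pact (v * b) (e 1%N).
have fE q r : pact q (f 0%N) + pact r (f 1%N)
    = pact (q + r * (u * a)) (e 0%N) + pact (q - r * (v * b)) (e 1%N).
  rewrite /f /= pactDl pactBl raddfB raddfD /= -!pactM.
  by rewrite addrACA.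
exists f; split=> [x|q].
  have [q1 [q2 ->]] := ge x.
  exists (fun k => if k is 0%N then q1 * (v * b) + q2 * (u * a) else q1 - q2).
  rewrite big_ord_recl big_ord1 fE.
  by congr (pact _ _ + pact _ _); rewrite -[LHS]mulr1 -E; ring.
rewrite big_ord_recl big_ord1 fE re; split.
  move=> [[s1 E1] [s2 E2]] [|[|//]] _ /=.
    exists (v * s1 + u * s2).
    transitivity (v * b * (q 0%N + q 1%N * (u * a))
      + u * a * (q 0%N - q 1%N * (v * b))); last by rewrite E1 E2; ring.
    by rewrite -[LHS]mulr1 -E; ring.
  exists (a * s1 - b * s2).
  transitivity ((q 0%N + q 1%N * (u * a)) - (q 0%N - q 1%N * (v * b))).
    by rewrite -[LHS]mulr1 -E; ring.
  by rewrite E1 E2; ring.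
move=> H; have /= [s1 ->] := H 0%N isT; have /= [s2 ->] := H 1%N isT.
by split; [exists (s1 * b + s2 * u) | exists (s1 * a - s2 * v)]; ring.
Qed.

(** Here d, a and b are the products over the intersection of A and B and over
    the two differences. *)
Lemma block_merge (A B : {fset nat}) : 0%N \notin A -> 0%N \notin B ->
  comax (cyclo_prod (A `\` B)%fset) (cyclo_prod (B `\` A)%fset) ->
  zmodEnd_iso (zsum (block A) (block B))
    (zsum (block (A `|` B)%fset) (block (A `&` B)%fset)).
Proof.
move=> A0 B0 AB; set d := cyclo_prod (A `&` B)%fset.
have cpU (s : seq nat) (C : {fset nat}) : perm_eq C s ->
  cyclo_prod C = \prod_(m <- s) 'Phi_m by move=> ps; exact: perm_big.
have EA : cyclo_prod A = d * cyclo_prod (A `\` B)%fset.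
  rewrite (cpU ((A `&` B)%fset ++ (A `\` B)%fset)) ?big_cat //.
  apply: uniq_perm; rewrite ?cat_uniq ?fset_uniq ?andbT //=.
    apply/hasPn => m; rewrite !inE => /andP[/negbTE mB _]; by rewrite mB andbF.
  by move=> m; rewrite mem_cat !inE; case: (m \in A); case: (m \in B).
have EB : cyclo_prod B = d * cyclo_prod (B `\` A)%fset.
  rewrite (cpU ((A `&` B)%fset ++ (B `\` A)%fset)) ?big_cat //.
  apply: uniq_perm; rewrite ?cat_uniq ?fset_uniq ?andbT //=.
    by apply/hasPn => m; rewrite !inE => /andP[/negbTE ->].
  by move=> m; rewrite mem_cat !inE; case: (m \in A); case: (m \in B).
have EU : cyclo_prod (A `|` B)%fset
    = d * cyclo_prod (A `\` B)%fset * cyclo_prod (B `\` A)%fset.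
  rewrite (cpU (A ++ (B `\` A)%fset)) ?big_cat -?EA //.
  apply: uniq_perm; rewrite ?cat_uniq ?fset_uniq ?andbT //=.
    by apply/hasPn => m; rewrite !inE => /andP[/negbTE ->].
  by move=> m; rewrite mem_cat !inE; case: (m \in A); case: (m \in B).
apply: (@presented_iso _ _ [:: cyclo_prod (A `|` B)%fset; d]).
  rewrite EU; apply: presented_merge => //; rewrite -EA -EB.
  by apply: presented_zsum; exact: presented_block.
by apply: presented_zsum; apply: presented_block;
  rewrite !inE (negbTE A0) (negbTE B0).
Qed.

(** * Tensor products: universal property and distributivity *)

Section TensorLift.
Variables (A B : zmodType).

Lemma pi_tens_eq (x y : {freeg (A * B)%type / int}) :
  tens_rel (x - y) -> \pi_(tens A B) x = \pi_(tens A B) y.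
Proof.
by move=> xy; apply/eqP; rewrite -ring_quotient.Quotient.idealrBE;
  apply/asboolP.
Qed.

Lemma tpureDl (a a' : A) (b : B) :
  tpure (a + a') b = tpure a b + tpure a' b.
Proof.
rewrite /tpure -(raddfD (\pi_(tens A B))); apply: pi_tens_eq.
by rewrite opprD addrA; exact: TensRelDl.
Qed.

Lemma tpureDr (a : A) (b b' : B) :
  tpure a (b + b') = tpure a b + tpure a b'.
Proof.
rewrite /tpure -(raddfD (\pi_(tens A B))); apply: pi_tens_eq.
by rewrite opprD addrA; exact: TensRelDr.
Qed.

Lemma tpureBl (a a' : A) (b : B) :
  tpure (a - a') b = tpure a b - tpure a' b.
Proof. by apply: (addIr (tpure a' b)); rewrite -tpureDl !subrK. Qed.

Lemma tpureBr (a : A) (b b' : B) :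
  tpure a (b - b') = tpure a b - tpure a b'.
Proof. by apply: (addIr (tpure a b')); rewrite -tpureDr !subrK. Qed.

Lemma tens_ind (P : tens A B -> Prop) :
  P 0 -> (forall x y, P x -> P y -> P (x - y)) ->
  (forall a b, P (tpure a b)) -> forall x, P x.
Proof.
move=> P0 PB Ppure x; rewrite -[x]reprK; move: (generic_quotient.repr x) =>
  {x} y.
have PN z : P z -> P (- z) by move=> Pz; rewrite -sub0r; exact: PB.
have PD z w : P z -> P w -> P (z + w).
  by move=> Pz Pw; rewrite -[w]opprK; apply: PB => //; exact: PN.
have Pn z n : P z -> P (z *+ n).
  by move=> Pz; elim: n => [|n IHn] //; rewrite mulrS; exact: PD.
rewrite -[y]freeg_sumE raddf_sum; apply: (big_ind P) => // [[a b]] _.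
rewrite -[coeff _ _]intz -freegU_mulz raddfMz.
case: (coeff _ _) => n; first exact: Pn (Ppure a b).
by rewrite NegzE mulrNz; apply: PN; exact: Pn (Ppure a b).
Qed.

Section Lift.
Variables (Z : zmodType) (beta : A -> B -> Z).
Hypothesis betaDl : forall a a' b, beta (a + a') b = beta a b + beta a' b.
Hypothesis betaDr : forall a b b', beta a (b + b') = beta a b + beta a b'.

Definition tlift_pre : {freeg (A * B)%type / int} -> Z :=
  fglift (fun u : A * B => beta u.1 u.2 : zmodule Z).

Lemma tlift_preU a b : tlift_pre << (a, b) >> = beta a b.
Proof. by rewrite /tlift_pre liftU scale1r. Qed.

Lemma tlift_preB x y : tlift_pre (x - y) = tlift_pre x - tlift_pre y.
Proof.
exact: (@lift_is_additive int _ (zmodule Z) (fun u : A * B => beta u.1 u.2)).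
Qed.

Lemma tlift_pre_rel x : tens_rel x -> tlift_pre x = 0.
Proof.
elim=> {x} [|x y _ IHx _ IHy|a a' b|a b b'].
- by have := tlift_preB 0 0; rewrite !subrr.
- by rewrite tlift_preB IHx IHy subrr.
- by rewrite !tlift_preB !tlift_preU betaDl addrAC addrK subrr.
- by rewrite !tlift_preB !tlift_preU betaDr addrAC addrK subrr.
Qed.

Definition tlift (x : tens A B) : Z := tlift_pre (generic_quotient.repr x).

Lemma tlift_pi x : tlift (\pi_(tens A B) x) = tlift_pre x.
Proof.
apply/eqP; rewrite -subr_eq0 -tlift_preB; apply/eqP/tlift_pre_rel/asboolP.
have /eqP := reprK (\pi_(tens A B) x).
by rewrite -ring_quotient.Quotient.idealrBE.
Qed.

Lemma tlift_tpure a b : tlift (tpure a b) = beta a b.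
Proof. by rewrite /tpure tlift_pi tlift_preU. Qed.

Fact tlift_is_zmod_morphism : zmod_morphism tlift.
Proof.
move=> x y; rewrite -[x]reprK -[y]reprK.
by rewrite -(raddfB (\pi_(tens A B))) !tlift_pi tlift_preB.
Qed.

HB.instance Definition _ :=
  GRing.isZmodMorphism.Build (tens A B) Z tlift tlift_is_zmod_morphism.

(** The additive extension of beta to the free group kills the bilinearity
    relations. *)
Lemma tens_lift : exists f : {additive tens A B -> Z},
  forall a b, f (tpure a b) = beta a b.
Proof. by exists tlift => a b; exact: tlift_tpure. Qed.

End Lift.

(** Pure tensors generate the tensor product, hence maps out of it are compared,
    in what follows, on pure tensors only. *)
Lemma tens_map_ext (Z : zmodType) (f g : {additive tens A B -> Z}) :
  (forall a b, f (tpure a b) = g (tpure a b)) -> f =1 g.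
Proof.
move=> fg; apply: tens_ind => [|x y Ex Ey|] //; first by rewrite !raddf0.
by rewrite !raddfB Ex Ey.
Qed.

End TensorLift.

Lemma zact_tpure (X Y : zmodEnd) (x : X) (y : Y) :
  zact (ztens X Y) (tpure x y) = tpure (zact X x) (zact Y y).
Proof. exact: tens_map_tpure. Qed.

Lemma ztens_comm (X Y : zmodEnd) : zmodEnd_iso (ztens X Y) (ztens Y X).
Proof.
have tl (A B : zmodType) : exists f : {additive tens A B -> tens B A},
    forall a b, f (tpure a b) = tpure b a.
  by apply: tens_lift => *; rewrite ?tpureDl ?tpureDr.
have [f fE] := tl X Y; have [g gE] := tl Y X.
exists f; split.
  exists g; first by apply: (@tens_map_ext _ _ _ (g \o f) idfun) => x y;
    rewrite /= fE gE.
  by apply: (@tens_map_ext _ _ _ (f \o g) idfun) => y x; rewrite /= gE fE.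
apply: (@tens_map_ext _ _ _ (f \o zact (ztens X Y)) (zact (ztens Y X) \o f)).
by move=> x y; rewrite /= zact_tpure !fE zact_tpure.
Qed.

Lemma ztens_zzerol (Y : zmodEnd) : zmodEnd_iso (ztens zzero Y) zzero.
Proof.
have z0 (x : zzero) : x = 0 by exact: thinmx0.
have t0 : forall x : ztens zzero Y, x = 0.
  apply: tens_ind => // [x y -> ->|a b]; first by rewrite subrr.
  by rewrite (z0 a) -(subrr 0) tpureBl subrr.
exists \0; split; last by move=> x; rewrite raddf0.
by exists (fun=> 0) => x; [rewrite [RHS]t0 | rewrite [RHS]z0].
Qed.

Lemma ztens_zsuml (X Y Z : zmodEnd) :
  zmodEnd_iso (ztens (zsum X Y) Z) (zsum (ztens X Z) (ztens Y Z)).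
Proof.
have [f fE] : exists f : {additive tens (zsum X Y) Z ->
  zsum (ztens X Z) (ztens Y Z)},
    forall u c, f (tpure u c) = (tpure u.1 c, tpure u.2 c).
  apply: tens_lift => [[a b] [a' b'] c|[a b] c c'] /=.
    by rewrite !tpureDl.
  by rewrite !tpureDr.
have [g1 g1E] : exists g : {additive tens X Z -> tens (zsum X Y) Z},
    forall a c, g (tpure a c) = tpure (a, 0) c.
  apply: tens_lift => [a a' c|a c c']; last by rewrite tpureDr.
  by rewrite -tpureDl /GRing.add /= /add_pair /= addr0.
have [g2 g2E] : exists g : {additive tens Y Z -> tens (zsum X Y) Z},
    forall b c, g (tpure b c) = tpure (0, b) c.
  apply: tens_lift => [a a' c|a c c']; last by rewrite tpureDr.
  by rewrite -tpureDl /GRing.add /= /add_pair /= addr0.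
pose g := ((g1 \o fst) \+ (g2 \o snd))%R.
exists f; split.
  exists g.
    apply: (@tens_map_ext _ _ _ (g \o f) idfun) => [[a b] c] /=.
    rewrite /g /= fE /= g1E g2E -tpureDl /GRing.add /= /add_pair /=.
    by rewrite addr0 add0r.
  move=> [x y]; rewrite /g /= raddfD.
  have E1 : f \o g1 =1 (fun x => (x, 0)).
    elim/tens_ind => [|u v|a c] /=; first by rewrite !raddf0.
      by rewrite !raddfB => -> ->; rewrite /GRing.add /= /add_pair /= subrr.
    by rewrite g1E fE /= -(subrr 0) tpureBl subrr.
  have E2 : f \o g2 =1 (fun x => (0, x)).
    elim/tens_ind => [|u v|a c] /=; first by rewrite !raddf0.
      by rewrite !raddfB => -> ->; rewrite /GRing.add /= /add_pair /= subrr.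
    by rewrite g2E fE /= -(subrr 0) tpureBl subrr.
  rewrite [f (g1 x)]E1 [f (g2 y)]E2 /GRing.add /= /add_pair /=.
  by rewrite addr0 add0r.
apply: (@tens_map_ext _ _ _ (f \o zact (ztens (zsum X Y) Z))
  (zact (zsum (ztens X Z) (ztens Y Z)) \o f)) => [[a b] c] /=.
by rewrite tens_map_tpure !fE /= /zsum_act /= !tens_map_tpure.
Qed.

Lemma zsum0 (X : zmodEnd) : zmodEnd_iso (zsum zzero X) X.
Proof.
exists snd; split=> //.
exists (fun x => (0, x)) => [[z x]|x] //=.
by congr (_, _); apply/esym/thinmx0.
Qed.

Lemma zsum_assoc (A B C : zmodEnd) :
  zmodEnd_iso (zsum (zsum A B) C) (zsum A (zsum B C)).
Proof.
pose F (u : zsum (zsum A B) C) : zsum A (zsum B C) := (u.1.1, (u.1.2, u.2)).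
have FB : zmod_morphism F by [].
pose Fm := GRing.isZmodMorphism.Build _ _ F FB.
pose FF : {additive zsum (zsum A B) C -> zsum A (zsum B C)} := HB.pack F Fm.
exists FF; split=> //.
by exists (fun u : zsum A (zsum B C) => ((u.1, u.2.1), u.2.2)) =>
  [[[a b] c]|[a [b c]]].
Qed.

Lemma zbigsum_cat s1 s2 :
  zmodEnd_iso (zsum (zbigsum s1) (zbigsum s2)) (zbigsum (s1 ++ s2)).
Proof.
elim: s1 => [|X s1 IHs] /=; first exact: zsum0.
apply: zmodEnd_iso_trans (zsum_assoc _ _ _) _.
by apply: zsum_iso => //; exact: zmodEnd_iso_refl.
Qed.

(** Both arguments reduce to the left one by commutativity. *)
Lemma ztens_zbigsum s1 s2 :
  zmodEnd_iso (ztens (zbigsum s1) (zbigsum s2))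
    (zbigsum [seq ztens X Y | X <- s1, Y <- s2]).
Proof.
have one X : zmodEnd_iso (ztens (zbigsum s2) X)
    (zbigsum [seq ztens X Y | Y <- s2]).
  elim: s2 => [|Y s2 IHs] /=; first exact: ztens_zzerol.
  apply: zmodEnd_iso_trans (ztens_zsuml _ _ _) _.
  by apply: zsum_iso => //; exact: ztens_comm.
elim: s1 => [|X s1 IHs]; first exact: ztens_zzerol.
rewrite allpairs_cons; apply: zmodEnd_iso_trans (ztens_zsuml _ _ _) _.
apply: zmodEnd_iso_trans (zbigsum_cat _ _).
apply: zsum_iso => //.
by apply: zmodEnd_iso_trans (ztens_comm _ _) _; exact: one.
Qed.

(** * Determinants indexed by finite types *)

(** With rows and columns indexed by the same set the determinant, sign included,
    does not depend on the enumeration of that set. *)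
Definition fdet (R : comNzRingType) (T : finType) (A : T -> T -> R) : R :=
  \det (\matrix_(i < #|T|, j < #|T|) A (enum_val i) (enum_val j)).

Section FiniteDet.
Variables (T : finType).

Lemma sum_enum_val (V : nmodType) (F : T -> V) :
  \sum_(i < #|T|) F (enum_val i) = \sum_x F x.
Proof. by rewrite -big_enum_val. Qed.

Lemma prod_enum_val (R : comNzRingType) (F : T -> R) :
  \prod_(i < #|T|) F (enum_val i) = \prod_x F x.
Proof. by rewrite -big_enum_val. Qed.

Lemma fdetM (R : comNzRingType) (A B : T -> T -> R) :
  fdet (fun x y => \sum_w A x w * B w y) = fdet A * fdet B.
Proof.
rewrite /fdet -det_mulmx; congr (\det _); apply/matrixP => i j.
rewrite !mxE -[LHS]sum_enum_val; apply: eq_bigr => k _.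
by rewrite !mxE.
Qed.

Lemma eq_fdet (R : comNzRingType) (A B : T -> T -> R) :
  (forall x y, A x y = B x y) -> fdet A = fdet B.
Proof.
by move=> AB; congr (\det _); apply/matrixP => i j; rewrite !mxE AB.
Qed.

Lemma fdet_intr (R : comNzRingType) (A : T -> T -> int) :
  fdet (fun x y => (A x y)%:~R) = (fdet A)%:~R :> R.
Proof.
rewrite /fdet -(det_map_mx (intmul 1)); congr (\det _).
by apply/matrixP => i j; rewrite !mxE.
Qed.

(** A permutation s with h x <= h (s x) for all x has equality throughout,
    since both sides have the same sum. *)
Lemma fdet_tri (R : comNzRingType) (A : T -> T -> R) (h : T -> nat) :
  (forall x y, A x y != 0 -> x = y \/ (h x < h y)%N) ->
  fdet A = \prod_x A x x.
Proof.
move=> tri; rewrite /fdet /determinant (bigD1 (1%g : 'S_#|T|)) //= -[RHS]addr0.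
congr (_ + _).
  rewrite odd_perm1 expr0 mul1r -[RHS]prod_enum_val.
  by apply: eq_bigr => i _; rewrite mxE perm1.
apply: big1.
move=> s s1; apply/eqP; apply: contraR s1 => nz; apply/eqP/permP => i.
pose g i := h (@enum_val T predT i).
have gs j : s j = j \/ (g j < g (s j))%N.
  have : A (enum_val j) (enum_val (s j)) != 0.
    apply: contraNneq nz => A0; rewrite (bigD1 j) //= mxE A0 mul0r mulr0.
    by [].
  by case/tri => [/enum_val_inj|]; [left | right].
have le j : (g j <= g (s j))%N by case: (gs j) => [-> //|/ltnW].
have [E|lt] := gs i; first by rewrite E perm1.
have : (\sum_j g j < \sum_j g (s j))%N.
  rewrite (bigD1 i) // [X in (_ < X)%N](bigD1 i) //= -addSn leq_add //.
  by apply: leq_sum => j _.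
by rewrite [X in (X < _)%N](reindex_inj (@perm_inj _ s)) ltnn.
Qed.

Lemma fdet_tri_down (R : comNzRingType) (A : T -> T -> R) (h : T -> nat) :
  (forall x y, A x y != 0 -> x = y \/ (h y < h x)%N) ->
  fdet A = \prod_x A x x.
Proof.
move=> tri; apply: (@fdet_tri _ _ (fun x => \max_y h y - h x)%N) => x y.
case/tri => [|lt]; [by left | right].
by rewrite ltn_sub2l // (leq_trans lt) // (leq_bigmax x).
Qed.

Lemma fdet_unit_inv (A : T -> T -> int) : fdet A \is a GRing.unit ->
  exists B : T -> T -> int, forall x y, \sum_w B x w * A w y = (x == y)%:R.
Proof.
move=> uA; set M := \matrix_(i < #|T|, j < #|T|) A (enum_val i) (enum_val j).
have uM : M \in unitmx by rewrite unitmxE.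
exists (fun x y => (invmx M) (enum_rank x) (enum_rank y)) => x y.
have := mulVmx uM => /matrixP/(_ (enum_rank x) (enum_rank y)).
rewrite !mxE (inj_eq enum_rank_inj) => <-; rewrite -[LHS]sum_enum_val.
by apply: eq_bigr => k _; rewrite !mxE enum_valK enum_rankK.
Qed.

End FiniteDet.

(** * Newton interpolation and block Vandermonde determinants *)

(** The coefficients of x^n with respect to the Newton polynomials
    prod_(l < i) (x - z_l). *)
Fixpoint newton_coef (R : comNzRingType) (z : nat -> R) n i : R :=
  if n is n'.+1 then
    (if i is i'.+1 then newton_coef z n' i' else 0) + z i * newton_coef z n' i
  else (i == 0%N)%:R.

Section Newton.
Variables (R : comNzRingType) (z : nat -> R).

Lemma newton_coef_gt n i : (n < i)%N -> newton_coef z n i = 0.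
Proof.
elim: n i => [|n IHn] [|i] //= lt; rewrite !IHn ?mulr0 ?addr0 //.
exact: ltnW.
Qed.

Lemma newton_coef_diag n : newton_coef z n n = 1.
Proof.
by elim: n => //= n ->; rewrite newton_coef_gt // mulr0 addr0.
Qed.

Lemma newton_expand v n N : (n < N)%N ->
  v ^+ n = \sum_(i < N) newton_coef z n i * \prod_(l < i) (v - z l).
Proof.
elim: n N => [|n IHn] N lt.
  case: N lt => // N _; rewrite big_ord_recl big_ord0 mul1r big1 ?addr0 //.
  by move=> i _; rewrite mul0r.
case: N lt => // N lt; rewrite exprS.
under eq_bigr => i _ do rewrite /= mulrDl.
rewrite big_split /= big_ord_recl mul0r add0r.
rewrite {1}(IHn N) // mulr_sumr.
rewrite [X in _ = _ + X]big_ord_recr /= newton_coef_gt //.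
rewrite mulr0 mul0r addr0 -big_split; apply: eq_bigr => i _ /=.
by rewrite big_ord_recr /=; ring.
Qed.

End Newton.

(** Injectivity and the bound by the cardinality make rk a numbering of each class
    of cls by 0, 1, 2, ... without gaps. *)
Definition ranking (T : finType) (K : eqType) (cls : T -> K) (rk : T -> nat) :=
  (forall x y, cls x = cls y -> rk x = rk y -> x = y) /\
  (forall x, (rk x < #|[pred y | cls y == cls x]|)%N).

Section Ranking.
Variables (T : finType) (K : eqType) (cls : T -> K) (rk : T -> nat).
Hypothesis rkP : ranking cls rk.

Lemma ranking_perm c :
  perm_eq [seq rk w | w <- enum [pred y | cls y == c]]
    (iota 0 #|[pred y | cls y == c]|).
Proof.
set s := map _ _; have us : uniq s.
  rewrite map_inj_in_uniq ?enum_uniq // => x y.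
  by rewrite !mem_enum !inE => /eqP cx /eqP cy; apply: rkP.1; rewrite cx cy.
apply: uniq_perm; rewrite ?iota_uniq //.
have sub : {subset s <= iota 0 #|[pred y | cls y == c]|}.
  move=> i /mapP[x]; rewrite mem_enum inE => /eqP <- ->.
  by rewrite mem_iota /= add0n rkP.2.
have le : (size (iota 0 #|[pred y | cls y == c]|) <= size s)%N.
  by rewrite size_iota size_map -cardE.
by have [] := uniq_min_size us sub le.
Qed.

Lemma sum_ranking (V : nmodType) c (F : nat -> V) :
  \sum_(w | cls w == c) F (rk w) = \sum_(i < #|[pred y | cls y == c]|) F i.
Proof.
rewrite -(big_mkord predT) /index_iota subn0 -(perm_big _ (ranking_perm c)).
by rewrite big_map big_enum.
Qed.

Lemma ranking_surj c i : (i < #|[pred y | cls y == c]|)%N ->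
  exists2 w, cls w = c & rk w = i.
Proof.
move=> lt; have : i \in iota 0 #|[pred y | cls y == c]| by rewrite mem_iota.
rewrite -(perm_mem (ranking_perm c)) => /mapP[w].
by rewrite mem_enum inE => /eqP cw ->; exists w.
Qed.

Definition nth_in_class (R : comNzRingType) (z : T -> R) c l : R :=
  if [pick w | (cls w == c) && (rk w == l)] is Some w then z w else 0.

Lemma nth_in_classE (R : comNzRingType) (z : T -> R) w :
  nth_in_class z (cls w) (rk w) = z w.
Proof.
rewrite /nth_in_class; case: pickP => [y /andP[/eqP cy /eqP ry]|/(_ w)].
  by rewrite (rkP.1 _ _ cy ry).
by rewrite !eqxx.
Qed.

Lemma prod_before (R : comNzRingType) (z : T -> R) x v :
  \prod_(l < rk x) (v - nth_in_class z (cls x) l)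
    = \prod_(y | (cls y == cls x) && (rk y < rk x)%N) (v - z y).
Proof.
transitivity (\prod_(w | cls w == cls x)
    (if (rk w < rk x)%N then v - nth_in_class z (cls x) (rk w) else 1)).
  have lt := ltnW (rkP.2 x).
  rewrite -(big_mkord predT (fun l => v - nth_in_class z (cls x) l)).
  rewrite /index_iota subn0.
  transitivity (\prod_(i <- iota 0 #|[pred y | cls y == cls x]|)
      (if (i < rk x)%N then v - nth_in_class z (cls x) i else 1)).
    rewrite -(subnKC lt) iotaD big_cat /= -[LHS]mulr1; congr (_ * _).
      apply: eq_big_seq => i.
      by rewrite mem_iota add0n => /andP[_ ->].
    rewrite big_seq; apply/esym/big1 => i; rewrite mem_iota add0n =>
      /andP[le _].
    by rewrite ltnNge le.
  by rewrite -(perm_big _ (ranking_perm (cls x))) big_map big_enum.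
rewrite [RHS]big_mkcondr; apply: eq_bigr => w /eqP cw.
by rewrite -cw nth_in_classE.
Qed.

(** The Newton expansion may be cut off at the size of the class: the terms beyond
    it vanish, either because n is too small, or because v is one of the nodes. *)
Lemma newton_class (R : comNzRingType) (z : T -> R) c v n :
  (n < #|[pred y | cls y == c]|)%N \/ (exists2 y, cls y = c & v = z y) ->
  v ^+ n = \sum_(w | cls w == c) newton_coef (nth_in_class z c) n (rk w) *
             \prod_(l < rk w) (v - nth_in_class z c l).
Proof.
move=> H; rewrite (sum_ranking c (fun i => newton_coef (nth_in_class z c) n i *
  \prod_(l < i) (v - nth_in_class z c l))).
set N := #|_|; have [lt|le] := ltnP n N; first exact: newton_expand.
case: H => [|[y cy Ev]]; first by rewrite ltnNge le.
rewrite (@newton_expand _ (nth_in_class z c) v n n.+1) //.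
rewrite (big_ord_widen n.+1 (fun i => newton_coef (nth_in_class z c) n i *
  \prod_(l < i) (v - nth_in_class z c l)) (leqW le)).
rewrite [RHS]big_mkcond; apply: eq_bigr => i _; case: ltnP => // leNi.
have lt : (rk y < i)%N by apply: leq_trans leNi; rewrite /N -cy rkP.2.
by rewrite (bigD1 (Ordinal lt)) //= -cy nth_in_classE Ev subrr mul0r mulr0.
Qed.

Lemma prod_before_neq0 (R : comNzRingType) (z : T -> R) x y :
  cls y = cls x ->
  \prod_(l < rk x) (z y - nth_in_class z (cls x) l) != 0 -> (rk x <= rk y)%N.
Proof.
move=> cy; apply: contraNleq => lt.
rewrite (bigD1 (Ordinal lt)) //= -cy nth_in_classE subrr.
exact/eqP/mul0r.
Qed.

Lemma newton_unitri (R : comNzRingType) (z : T -> R) :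
  fdet (fun x y => (cls x == cls y)%:R *
    newton_coef (nth_in_class z (cls x)) (rk x) (rk y)) = 1.
Proof.
rewrite (@fdet_tri_down _ _ _ rk).
  by rewrite big1 // => x _; rewrite eqxx newton_coef_diag mulr1.
move=> x y; case: (cls x =P cls y) => [cxy|_]; last by rewrite mul0r eqxx.
rewrite mul1r => nz; have : (rk y <= rk x)%N.
  by apply: contraNleq nz => lt; rewrite newton_coef_gt.
rewrite leq_eqVlt => /orP[/eqP E|]; [left | by right].
exact: rkP.1.
Qed.

Lemma newton_tri (R : comNzRingType) (z : T -> R) :
  fdet (fun x y => (cls x == cls y)%:R *
    \prod_(l < rk x) (z y - nth_in_class z (cls x) l))
  = \prod_x \prod_(y | (cls y == cls x) && (rk y < rk x)%N) (z x - z y).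
Proof.
rewrite (@fdet_tri _ _ _ rk).
  by apply: eq_bigr => x _; rewrite eqxx mul1r prod_before.
move=> x y; case: (cls x =P cls y) => [cxy|_]; last by rewrite mul0r eqxx.
rewrite mul1r => /(prod_before_neq0 (esym cxy)).
rewrite leq_eqVlt => /orP[/eqP E|]; [left | by right].
exact: rkP.1.
Qed.

(** The matrix is block diagonal with Vandermonde blocks.  Expanding the powers in
    the Newton polynomials of each class factors it into a unitriangular matrix
    and a triangular one. *)
Lemma fdet_block_Vandermonde (R : comNzRingType) (z : T -> R) :
  fdet (fun x y => (cls x == cls y)%:R * z y ^+ rk x)
  = \prod_x \prod_(y | (cls y == cls x) && (rk y < rk x)%N) (z x - z y).
Proof.
rewrite -newton_tri -[RHS]mul1r -[X in _ = X * _](newton_unitri z) -fdetM.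
apply: eq_fdet => x y.
transitivity (\sum_(w | cls w == cls x)
   newton_coef (nth_in_class z (cls x)) (rk x) (rk w) * ((cls w == cls y)%:R *
    \prod_(l < rk w) (z y - nth_in_class z (cls w) l))); last first.
  rewrite big_mkcond; apply: eq_bigr => w _; rewrite eq_sym.
  by case: eqP => _; rewrite ?mul1r ?mul0r.
case: eqP => [cxy|ncxy]; last first.
  rewrite mul0r big1 // => w /eqP ->; rewrite (introF eqP ncxy).
  by rewrite mul0r mulr0.
rewrite mul1r (@newton_class _ z (cls x) (z y)); last by right; exists y.
by apply: eq_bigr => w /eqP ->; rewrite cxy eqxx mul1r.
Qed.

End Ranking.

(** The matrix of the functions t^(j x) z^(k x) where k numbers the fibres of
    sm, on which t is constant, and j the level sets of k.  On a fibre with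
    few points the power z^(k x) depends on the lower powers, hence the matrix
    is only block triangular; its diagonal blocks are Vandermonde. *)
Lemma fdet_fibre_Vandermonde (T : finType) (K : eqType) (sm : T -> K)
    (k j : T -> nat) (R : comNzRingType) (t z : T -> R) :
  ranking sm k -> ranking k j -> (forall x y, sm x = sm y -> t x = t y) ->
  fdet (fun x y => t y ^+ j x * z y ^+ k x)
  = (\prod_x \prod_(y | (k y == k x) && (j y < j x)%N) (t x - t y)) *
    (\prod_x \prod_(y | (sm y == sm x) && (k y < k x)%N) (z x - z y)).
Proof.
move=> kP jP tE.
pose tc := nth_in_class k j t; pose zc := nth_in_class sm k z.
(* The Newton polynomials in t of the level sets of k. *)
pose Nw c i v := \prod_(l < i) (v - tc c l).
pose A x y := Nw (k x) (j x) (t y) * newton_coef (zc (sm y)) (k x) (k y).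
have dA : fdet A
    = \prod_x \prod_(y | (k y == k x) && (j y < j x)%N) (t x - t y).
  pose J := (\max_x j x).+1; pose KK := (\max_x k x)%N.
  have jJ x : (j x < J)%N by rewrite ltnS (leq_bigmax x).
  have kK x : (k x <= KK)%N by rewrite (leq_bigmax x).
  (* Lexicographic order: k decreasing first, then j increasing. *)
  rewrite (@fdet_tri _ _ _ (fun x => (KK - k x) * J + j x)%N).
    apply: eq_bigr => x _; rewrite /A newton_coef_diag mulr1.
    exact: (prod_before jP).
  move=> x y nz.
  have le : (k y <= k x)%N.
    by apply: contraNleq nz => lt; rewrite /A newton_coef_gt // mulr0.
  move: le; rewrite leq_eqVlt => /orP[/eqP kxy|lt]; last first.
    right; have h := kK x; have hj := jJ x.
    have : ((KK - k x).+1 * J <= (KK - k y) * J)%N.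
      by rewrite leq_mul2r ltn_sub2l ?orbT // (leq_trans lt).
    by rewrite mulSn; lia.
  have : (j x <= j y)%N.
    apply: (prod_before_neq0 jP (z := t) kxy).
    by apply: contraNneq nz => E; rewrite /A /Nw E mul0r.
  rewrite leq_eqVlt => /orP[/eqP jxy|lt]; first by left; exact: jP.1.
  by right; rewrite kxy ltn_add2l.
rewrite -dA -(newton_tri kP z) -fdetM -[RHS]mul1r.
rewrite -[X in _ = X * _](newton_unitri jP t) -fdetM.
apply: eq_fdet => x y.
transitivity (\sum_(w | k w == k x)
    newton_coef (tc (k x)) (j x) (j w) * Nw (k x) (j w) (t y) * z y ^+ k x).
  rewrite -mulr_suml; congr (_ * _).
  by apply: (newton_class jP); left; exact: jP.2.
have zE w : z y ^+ k w * Nw (k w) (j w) (t y) = \sum_v A w v *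
    ((sm v == sm y)%:R * \prod_(l < k v) (z y - zc (sm v) l)).
  rewrite (@newton_class _ _ _ _ kP _ z (sm y) (z y)); last by right; exists y.
  rewrite mulr_suml big_mkcond; apply: eq_bigr => v _.
  case: eqP => [E|_]; last by rewrite mul0r mulr0.
  by rewrite /A mul1r E (tE _ _ E); ring.
rewrite big_mkcond; apply: eq_bigr => w _; rewrite -zE eq_sym.
case: (k x =P k w) => [E|_]; last by rewrite !mul0r.
by rewrite mul1r -E -mulrA; congr (_ * _); exact: mulrC.
Qed.

(** * Convolution on a finite abelian group *)

Section Convolution.
Variables (G : finZmodType) (K : pred G) (d : G).
Hypothesis KD : forall i j, K i -> K j -> K (i + j).
Hypothesis Kd : forall i, K i -> ~~ K (i + d).

Definition conv (V : pzSemiRingType) (f g : G -> V) (c : G) : V :=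
  \sum_i f i * g (c - i).

Lemma conv_sum (f g : G -> int) :
  \sum_c conv f g c = (\sum_i f i) * (\sum_j g j).
Proof.
rewrite /conv exchange_big /= mulr_suml; apply: eq_bigr => i _.
rewrite -mulr_sumr; congr (_ * _).
by rewrite [RHS](reindex_inj (addIr (- i))).
Qed.

(** How f differs from its translate by d: the invariant part F drops out, and
    what remains has constant sign, negative if b = true, and L1-norm s. *)
Definition d_split (b : bool) (f : G -> int) (s : int) : Prop :=
  exists F h : G -> int,
  [/\ forall i, f i = F i + h i, forall i, F (i + d) = F i,
      forall i, ~~ K i -> h i = 0, forall i, 0 <= (-1) ^+ b * h i
    & \sum_i (-1) ^+ b * h i = s].

(** (F + h) * (F' + h') = (F * F' + F * h' + h * F') + h * h', where the
    first part is invariant again and the signs multiply. *)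
Lemma d_split_conv b1 b2 f g s1 s2 :
  d_split b1 f s1 -> d_split b2 g s2 ->
  d_split (b1 (+) b2) (conv f g) (s1 * s2).
Proof.
move=> [F [h [fE Fd hK h0 hs]]] [F' [h' [gE Fd' hK' h0' hs']]].
exists (fun c => conv f g c - conv h h' c), (conv h h').
have term c i : (-1) ^+ (b1 (+) b2) * (h i * h' (c - i))
    = ((-1) ^+ b1 * h i) * ((-1) ^+ b2 * h' (c - i)) :> int.
  by rewrite signr_addb; ring.
split.
- by move=> c; rewrite subrK.
- move=> c.
  have E x : conv f g x - conv h h' x
      = conv F g x + conv h F' x.
    rewrite /conv -sumrB -big_split /=; apply: eq_bigr => i _.
    by rewrite fE gE; ring.
  rewrite !E; congr (_ + _); last first.
    by apply: eq_bigr => i _; rewrite addrAC Fd'.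
  rewrite /conv [LHS](reindex_inj (addIr d)) /=; apply: eq_bigr => i _.
  by rewrite Fd opprD addrACA subrr addr0.
- move=> c Kc; rewrite /conv big1 // => i _.
  have [Ki|/hK ->] := boolP (K i); last by rewrite mul0r.
  have [Kci|/hK' ->] := boolP (K (c - i)); last by rewrite mulr0.
  by case/negP: Kc; rewrite -(subrK i c); apply: KD.
- move=> c; rewrite /conv mulr_sumr sumr_ge0 // => i _.
  by rewrite term mulr_ge0.
rewrite -mulr_sumr conv_sum -hs -hs' -!mulr_sumr signr_addb; ring.
Qed.

Lemma d_split_le b f s i : d_split b f s -> K i ->
  if b then f i <= f (i + d) else f (i + d) <= f i.
Proof.
move=> [F [h [fE Fd hK h0 _]]] Ki; rewrite !fE Fd (hK _ (Kd Ki)) addr0.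
by have := h0 i; case: (b); rewrite /= ?expr0 ?expr1; lia.
Qed.

(** At every point the minimum differs from f by h, up to the sign and a
    translation: K and its translate by d are disjoint. *)
Lemma d_split_min b (f : G -> nat) s : d_split b (fun i => (f i)%:Z) s ->
  (\sum_c minn (f c) (f (c + d)%R))%N%:Z = (\sum_c f c)%N%:Z - s.
Proof.
move=> [F [h [fE Fd hK h0 <-]]].
rewrite !(big_morph Posz PoszD (erefl _)).
have E (h' : G -> int) : \sum_i (-1) ^+ b * h i = \sum_i h' i ->
    (forall c, (minn (f c) (f (c + d)))%:Z = (f c)%:Z - h' c) ->
    \sum_c (minn (f c) (f (c + d)))%:Z
      = \sum_c (f c)%:Z - \sum_i (-1) ^+ b * h i.
  by move=> -> H; rewrite -sumrB; apply: eq_bigr => c _.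
pose sh c : int := if b then - h (c + d) else h c.
apply: (E sh).
  rewrite /sh; case: (b); last first.
    by apply: eq_bigr => i _; rewrite mul1r.
  by rewrite (reindex_inj (addIr d)); apply: eq_bigr => i _; rewrite mulN1r.
move=> c; have := fE c; have := fE (c + d); rewrite Fd.
have := h0 c; have := h0 (c + d); rewrite /sh.
have [Kc|Kc] := boolP (K c).
  by rewrite (hK _ (Kd Kc)); case: (b); rewrite /= ?expr0 ?expr1; lia.
by rewrite (hK _ Kc); case: (b); rewrite /= ?expr0 ?expr1; lia.
Qed.

End Convolution.

(** * Orders in the cyclic group Z / N *)

Section CyclicOrder.
Variable N0 : nat.
Notation N := N0.+1.
Notation G := 'I_N0.+1.

(** The order of i in the additive group Z / N. *)
Definition zord (i : G) : nat := N %/ gcdn i N.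

Lemma zord_gt0 i : (0 < zord i)%N.
Proof. by rewrite divn_gt0 ?gcdn_gt0 ?orbT // dvdn_leq // dvdn_gcdr. Qed.

Lemma zord_dvd i : (zord i %| N)%N.
Proof. exact/dvdn_div/dvdn_gcdr. Qed.

Lemma zord_dvdn i c : (zord i %| c)%N = (i *+ c == 0).
Proof.
have -> : (i *+ c == 0) = (N %| i * c)%N.
  by rewrite Zp_mulrn -val_eqE /= mulnC.
set g := gcdn i N; have g0 : (0 < g)%N by rewrite gcdn_gt0 orbT.
have Ei : (i : nat) = (g * (i %/ g))%N by rewrite mulnC divnK // dvdn_gcdl.
have EN : N = (g * (N %/ g))%N by rewrite mulnC divnK // dvdn_gcdr.
have co : coprime (N %/ g) (i %/ g).
  by rewrite /coprime -(eqn_pmul2l g0) muln_gcdr -Ei -EN muln1 gcdnC.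
rewrite -(Gauss_dvdr _ co) -(dvdn_pmul2l g0) -EN mulnA -Ei.
by [].
Qed.

Lemma zordN i : zord (- i) = zord i.
Proof.
have H j : (zord (- j) %| zord j)%N.
  by rewrite zord_dvdn mulNrn oppr_eq0 -zord_dvdn.
by apply/eqP; rewrite eqn_dvd H -{1}[i]opprK H.
Qed.

Lemma zordD (i j : G) : (zord (i + j)%R %| lcmn (zord i) (zord j))%N.
Proof.
set c := lcmn _ _.
have /eqP Ei : i *+ c == 0 by rewrite -zord_dvdn dvdn_lcml.
have /eqP Ej : j *+ c == 0 by rewrite -zord_dvdn dvdn_lcmr.
by rewrite zord_dvdn mulrnDl Ei Ej addr0.
Qed.

Lemma zord_surj l : (l %| N)%N -> exists i, zord i = l.
Proof.
move=> lN; have l0 : (0 < l)%N := dvdn_gt0 (ltn0Sn _) lN.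
have q0 : (0 < N %/ l)%N by rewrite divn_gt0 // dvdn_leq.
have E : gcdn (N %/ l) N = (N %/ l)%N.
  by apply/gcdn_idPl; rewrite -{2}(divnK lN) dvdn_mulr.
exists (inZp (N %/ l)); rewrite /zord /= gcdn_modl E.
by rewrite divnA // mulKn.
Qed.

Section PrimePower.
Variables (p r : nat) (d : G).
Hypotheses (pp : prime p) (r0 : (0 < r)%N) (dE : zord d = (p ^ r)%N).

(** Membership in the subgroup of the elements whose order has p-part smaller
    than p^r. *)
Definition low (i : G) : bool := (logn p (zord i) < r)%N.

Lemma lowD i j : low i -> low j -> low (i + j).
Proof.
move=> li lj; apply: (leq_ltn_trans (dvdn_leq_log p _ (zordD i j))).
  by rewrite lcmn_gt0 !zord_gt0.
by rewrite logn_lcm ?zord_gt0 // gtn_max; apply/andP; split.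
Qed.

Lemma lowN i : low (- i) = low i. Proof. by rewrite /low zordN. Qed.

Lemma low_shift i : low i -> ~~ low (i + d).
Proof.
move=> li; apply/negP => lid; have := lowD lid (etrans (lowN i) li).
by rewrite addrC addKr /low dE pfactorK // ltnn.
Qed.

(** A multiple of p^r annihilates d, so it annihilates i + d if and only if it
    annihilates i. *)
Lemma lcm_shift (i : G) : lcmn (zord (i + d)) (p ^ r)%N = lcmn (zord i) (p ^
  r)%N.
Proof.
apply/eqP; rewrite eqn_dvd !dvdn_lcm !dvdn_lcmr !andbT.
have := zordD i d; rewrite dE => ->.
by have := zordD (i + d) (- d); rewrite addrK zordN dE => ->.
Qed.

Lemma zord_not_low i : ~~ low i -> lcmn (zord i) (p ^ r)%N = zord i.
Proof.
rewrite /low -leqNgt => le; apply/lcmn_idPl.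
by rewrite pfactor_dvdn // zord_gt0.
Qed.

Lemma zord_shift_high i : ~~ low i -> ~~ low (i + d) -> zord (i + d) = zord i.
Proof.
by move=> /zord_not_low Ei /zord_not_low Eid; rewrite -Eid lcm_shift Ei.
Qed.

(** Adding d raises the p-part of the order to p^r and leaves the rest. *)
Lemma zord_shift_low i : low i -> exists u l,
  [/\ (0 < u)%N, ~~ (p %| u)%N, (l < r)%N, zord i = (u * p ^ l)%N
    & zord (i + d) = (u * p ^ r)%N].
Proof.
move=> li; have [u pu Eu] := pfactor_coprime pp (zord_gt0 i).
have u0 : (0 < u)%N by have := zord_gt0 i; rewrite Eu muln_gt0 => /andP[].
exists u, (logn p (zord i)); split=> //; first by rewrite -prime_coprime.
rewrite -(zord_not_low (low_shift li)) lcm_shift {1}Eu.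
have co : coprime u (p ^ r) by rewrite coprime_sym coprimeXl.
apply/eqP; rewrite eqn_dvd; apply/andP; split.
  rewrite dvdn_lcm; apply/andP; split; last by rewrite dvdn_mull.
  by apply: dvdn_mul => //; apply: dvdn_exp2l; exact: ltnW.
rewrite Gauss_dvd // dvdn_lcmr andbT.
by apply: dvdn_trans (dvdn_lcml _ _); rewrite dvdn_mulr.
Qed.

End PrimePower.
End CyclicOrder.

(** Monotonicity of the multiplicities m = u p^l between the exponents l < r
    and the exponent r: this is what an excellent order with r in S, when
    b = true, respectively r not in S, prescribes. *)
Definition exponent_mono (chi : nat -> nat) (p r : nat) (b : bool) : Prop :=
  forall u l, (0 < u)%N -> ~~ (p %| u)%N -> (l < r)%N ->
  if b then (chi (u * p ^ l) <= chi (u * p ^ r))%N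
  else (chi (u * p ^ r) <= chi (u * p ^ l))%N.

Section MonoSplit.
Variables (N0 p r : nat) (d : 'I_N0.+1).
Hypotheses (pp : prime p) (r0 : (0 < r)%N) (dE : zord d = (p ^ r)%N).

(** h measures the jump of chi from the exponents below r to the exponent r. *)
Lemma mono_split chi b : exponent_mono chi p r b ->
  exists s, d_split (low p r) d b (fun i : 'I_N0.+1 => (chi (zord i))%:Z) s.
Proof.
move=> mchi; pose f (i : 'I_N0.+1) := (chi (zord i))%:Z.
pose h i := if low p r i then f i - f (i + d) else 0.
exists (\sum_i (-1) ^+ b * h i), (fun i => f i - h i), h; split=> //.
- by move=> i; rewrite subrK.
- move=> i; rewrite /h; have [li|hi] := boolP (low p r i).
    by rewrite (negbTE (low_shift pp dE li)) subr0 opprB [RHS]addrC subrK.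
  rewrite subr0; case: ifP => [lid|/negbT hid]; last first.
    by rewrite subr0 /f (zord_shift_high pp dE hi hid).
  have dNE : zord (- d) = (p ^ r)%N by rewrite zordN.
  have [u [l [_ _ _ E1 E2]]] := zord_shift_low pp dE lid.
  have [u' [l' [u'0 pu' _ E1' E2']]] := zord_shift_low pp dNE lid.
  rewrite opprB [LHS]addrC subrK /f E2; rewrite addrK in E2'; rewrite E2'.
  congr (chi _)%:Z; rewrite -E2 -E2'.
  rewrite -(zord_not_low pp hi) -(zord_not_low pp (low_shift pp dE lid)).
  by rewrite lcm_shift // lcm_shift.
- by move=> i /negbTE E; rewrite /h E.
move=> i; rewrite /h; case: ifP => [li|_]; last by rewrite mulr0.
have [u [l [u0 pu lr E1 E2]]] := zord_shift_low pp dE li.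
have := mchi u l u0 pu lr; rewrite /f E1 E2.
by case: (b) => /=; lia.
Qed.

End MonoSplit.

(** * Convolution of multiplicities *)

Lemma logn_coprime_pow p u l : prime p -> (0 < u)%N -> ~~ (p %| u)%N ->
  logn p (u * p ^ l)%N = l.
Proof.
move=> pp u0 pu; have pl0 : (0 < p ^ l)%N by rewrite expn_gt0 prime_gt0.
rewrite (lognM _ u0 pl0) (pfactorK l pp).
by rewrite lognE pp u0 (negbTE pu).
Qed.

Section MonoConv.
Variables (N0 p r : nat) (d : 'I_N0.+1) (chi1 chi2 : nat -> nat) (b1 b2 : bool).
Notation G := 'I_N0.+1.
Hypotheses (pp : prime p) (r0 : (0 < r)%N) (dE : zord d = (p ^ r)%N).
Hypotheses (m1 : exponent_mono chi1 p r b1) (m2 : exponent_mono chi2 p r b2).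

Let f (i : G) := chi1 (zord i).
Let g (i : G) := chi2 (zord i).

Lemma conv_nat_int (c : G) :
  conv (fun i => (f i)%:Z) (fun i => (g i)%:Z) c = (conv f g c)%:Z.
Proof.
rewrite /conv (big_morph Posz PoszD (erefl _)).
by apply: eq_bigr => i _; rewrite PoszM.
Qed.

Lemma mono_conv_split : exists s1 s2,
  [/\ d_split (low p r) d b1 (fun i => (f i)%:Z) s1,
      d_split (low p r) d b2 (fun i => (g i)%:Z) s2
    & d_split (low p r) d (b1 (+) b2) (fun i => (conv f g i)%:Z) (s1 * s2)].
Proof.
have [s1 S1] := mono_split pp r0 dE m1; have [s2 S2] := mono_split pp r0 dE m2.
exists s1, s2; split=> //.
have := d_split_conv (@lowD _ _ _ ) S1 S2.
move=> [F [h [fE *]]]; exists F, h; split=> // i.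
by rewrite -fE conv_nat_int.
Qed.

(** With c of order u p^l and d of order p^r, the order of c + d is u p^r. *)
Lemma mono_conv_le (u l : nat) (c : G) :
  (0 < u)%N -> ~~ (p %| u)%N -> (l < r)%N -> zord c = (u * p ^ l)%N ->
  zord (c + d) = (u * p ^ r)%N /\
  if b1 (+) b2 then (conv f g c <= conv f g (c + d)%R)%N
  else (conv f g (c + d)%R <= conv f g c)%N.
Proof.
move=> u0 pu lr Ec.
have lc : low p r c.
  by rewrite /low Ec logn_coprime_pow.
split.
  have [u' [l' [u'0 pu' _ E1 ->]]] := zord_shift_low pp dE lc.
  congr (_ * _)%N; have E : (u' * p ^ l' = u * p ^ l)%N by rewrite -E1 Ec.
  have El : l' = l.
    by rewrite -(logn_coprime_pow l' pp u'0 pu') E logn_coprime_pow.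
  by apply/eqP; move/eqP: E; rewrite El eqn_pmul2r // expn_gt0 prime_gt0.
have [s1 [s2 [_ _ S]]] := mono_conv_split.
have := d_split_le (low_shift pp dE) S lc.
by case: (_ (+) _).
Qed.

(** (m - a)(n - b) = m n - e, where a, b and e are the correlations with the
    translate by d: the three differences are the total masses in the
    decompositions above. *)
Lemma correlation_identity :
  let cor (h : G -> nat) := (\sum_c minn (h c) (h (c + d)%R))%N in
  ((\sum_c g c) * cor f + (\sum_c f c) * cor g
    = cor (conv f g) + cor f * cor g)%N.
Proof.
move=> cor; have [s1 [s2 [S1 S2 S3]]] := mono_conv_split.
have E1 := d_split_min (low_shift pp dE) S1.
have E2 := d_split_min (low_shift pp dE) S2.
have E3 := d_split_min (low_shift pp dE) S3.
have Es : (\sum_c conv f g c)%N%:Z = (\sum_c f c)%N%:Z * (\sum_c g c)%N%:Z.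
  rewrite !(big_morph Posz PoszD (erefl _)) -conv_sum.
  by apply: eq_bigr => c _; rewrite conv_nat_int.
apply/eqP; rewrite -eqz_nat !PoszD !PoszM E1 E2 E3 Es; apply/eqP; ring.
Qed.

End MonoConv.

(** * Differences of roots of unity up to units *)

Definition Aint_multiple (a b : algC) : Prop := exists2 u,
  u \in Aint & a = u * b.

Lemma Aint_multiple_refl a : Aint_multiple a a.
Proof. by exists 1; rewrite ?rpred1 ?mul1r. Qed.

Lemma Aint_multiple_trans a b c : Aint_multiple a b -> Aint_multiple b c ->
  Aint_multiple a c.
Proof.
by move=> [u uA ->] [v vA ->]; exists (u * v); rewrite ?rpredM // mulrA.
Qed.

Lemma Aint_multipleM a b a' b' : Aint_multiple a b -> Aint_multiple a' b' ->
  Aint_multiple (a * a') (b * b').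
Proof.
by move=> [u uA ->] [v vA ->]; exists (u * v); rewrite ?rpredM // mulrACA.
Qed.

Lemma Aint_multiple_prod (I : Type) (s : seq I) (P : pred I) (F F' : I ->
  algC) :
  (forall i, P i -> Aint_multiple (F i) (F' i)) ->
  Aint_multiple (\prod_(i <- s | P i) F i) (\prod_(i <- s | P i) F' i).
Proof.
by move=> H; apply: (big_ind2 Aint_multiple) => //; [exact:
  Aint_multiple_refl | exact: Aint_multipleM].
Qed.

Lemma Cyclotomic1 : 'Phi_1 = 'X - 1.
Proof. by rewrite -(expr1 'X) -(prod_Cyclotomic (ltn0Sn 0)) big_seq1. Qed.

Section RootsOfUnity.
Variables (N0 : nat) (zeta : algC).
Notation N := N0.+1.
Notation G := 'I_N0.+1.
Hypothesis zetaP : N.-primitive_root zeta.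

(** The isomorphism of Z / N with the group of N-th roots of unity. *)
Definition zr (i : G) : algC := zeta ^+ i.

Lemma zrD i j : zr (i + j) = zr i * zr j.
Proof. by rewrite /zr /= prim_expr_mod // exprD. Qed.

Lemma zr_inj : injective zr.
Proof.
move=> i j /eqP; rewrite /zr (eq_prim_root_expr zetaP) !modn_small //.
by move=> /eqP/val_inj.
Qed.

Lemma zr_prim i : (zord i).-primitive_root (zr i).
Proof. by rewrite /zord /zr exp_prim_root. Qed.

Lemma zr_Aint i : zr i \in Aint.
Proof. by apply: Aint_unity_root (prim_order_gt0 zetaP) _; apply/unity_rootP;
  rewrite /zr exprAC (prim_expr_order zetaP) expr1n. Qed.

Lemma zr0 : zr 0 = 1.
Proof. by rewrite /zr expr0. Qed.

Lemma zr_sub i j : zr i - zr j = zr j * (zr (i - j) - 1).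
Proof. by rewrite mulrBr mulr1 -zrD (addrC j) subrK. Qed.

Lemma zr_subV i j : zr (i - j) - 1 = zr (- j) * (zr i - zr j).
Proof. by rewrite mulrBr -!zrD addNr zr0 (addrC (- j)). Qed.

(** A Bezout relation between Phi_m and t - 1, evaluated at a primitive m-th
    root of unity, exhibits the inverse of 1 - zeta. *)
Lemma zr_sub1_unit i : (forall p k, prime p -> zord i != (p ^ k)%N) ->
  (zr i - 1)^-1 \in Aint.
Proof.
move=> npp; have [u [v E]] : comax 'Phi_(zord i) 'Phi_1.
  apply: Cyclotomic_comax => //; first exact: zord_gt0.
    by move=> p k pp; rewrite mul1n npp.
  move=> p k pp; apply: contra (npp p 0%N pp) => /eqP /esym/eqP.
  by rewrite muln_eq1 => /andP[].
have {}E : (map_poly intr v).[zr i] * (zr i - 1) = 1.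
  have := congr1 (fun q : {poly int} => (map_poly (intr : int ->
    algC) q).[zr i]) E.
  rewrite /= rmorphD !rmorphM rmorph1 /= hornerD !hornerM hornerC.
  rewrite (Cintr_Cyclotomic (zr_prim i)).
  have /rootP -> : root (cyclotomic (zr i) (zord i)) (zr i).
    by rewrite root_cyclotomic ?zr_prim.
  rewrite mulr0 add0r Cyclotomic1 rmorphB /= map_polyX rmorph1.
  by rewrite !hornerE.
have nz : zr i - 1 != 0.
  by apply/eqP => z0; move/eqP: E; rewrite z0 mulr0 eq_sym oner_eq0.
have -> : (zr i - 1)^-1 = (map_poly intr v).[zr i].
  by apply: (mulIf nz); rewrite mulVf // E.
apply: rpred_horner (zr_Aint i).
by apply/polyOverP => k; rewrite coef_map Aint_int.
Qed.

(** Up to sign, the square of a product of Vandermonde determinants, one for each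
    class. *)
Definition class_disc (T : finType) (K : eqType) (cls : T -> K) (e : T -> G) :=
  \prod_x \prod_(y | (cls y == cls x) && (y != x)) (zr (e x) - zr (e y)).

Definition class_cnt (T : finType) (K : eqType) (cls : T -> K) (e : T -> G)
    (d : G) : nat :=
  (\sum_x #|[pred y | (cls y == cls x) && (e x == e y + d)%R]|)%N.

Section ClassDisc.
Variables (T : finType) (K : eqType) (cls : T -> K) (e : T -> G).
Hypothesis e_inj : forall x y, cls x = cls y -> e x = e y -> x = y.

(** The factors are grouped by the difference d of exponents. *)
Lemma class_disc_cnt :
  \prod_x \prod_(y | (cls y == cls x) && (y != x)) (zr (e x - e y) - 1)
  = \prod_(d | d != 0) (zr d - 1) ^+ class_cnt cls e d.
Proof.
under [RHS]eq_bigr => d _ do rewrite /class_cnt -prodrXr.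
rewrite exchange_big /=; apply: eq_bigr => x _.
rewrite (partition_big (fun y => e x - e y) (fun d => d != 0)) /=.
  apply: eq_bigr => d d0; rewrite -prodr_const.
  apply: eq_big => [y|y /andP[_ /eqP ->]] //; rewrite inE.
  rewrite subr_eq addrC -andbA; congr (_ && _).
  apply: andb_idl => /eqP E; apply: contraNneq d0 => yx.
  by rewrite -(addKr (e y) d) -E yx addNr.
move=> y /andP[/eqP c yx]; rewrite subr_eq0; apply: contraNneq yx => E.
by apply/eqP/(e_inj c).
Qed.

(** Up to a root of unity, zr i - zr j only depends on i - j. *)
Lemma class_disc_multiple :
  Aint_multiple (class_disc cls e) (\prod_(d | d != 0) (zr d - 1) ^+ class_cnt
    cls e d).
Proof.
rewrite -class_disc_cnt; apply: Aint_multiple_prod => x _; apply: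
  Aint_multiple_prod => y _.
by exists (zr (e y)); rewrite ?zr_Aint // zr_sub.
Qed.

Lemma multiple_class_disc :
  Aint_multiple (\prod_(d | d != 0) (zr d - 1) ^+ class_cnt cls e d)
    (class_disc cls e).
Proof.
rewrite -class_disc_cnt; apply: Aint_multiple_prod => x _; apply:
  Aint_multiple_prod => y _.
by exists (zr (- e y)); rewrite ?zr_Aint // zr_subV.
Qed.

(** Each pair of points occurs in both orders, with opposite differences. *)
Lemma class_disc_sqr (rk : T -> nat) : ranking cls rk ->
  exists s : nat, class_disc cls e = (-1) ^+ s *
    (\prod_x \prod_(y | (cls y == cls x) && (rk y < rk x)%N)
       (zr (e x) - zr (e y))) ^+ 2.
Proof.
move=> [rk_inj _].
pose A x y := (cls y == cls x) && (rk y < rk x)%N.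
exists (\sum_x #|[pred y | A x y]|)%N.
have E x : \prod_(y | (cls y == cls x) && (y != x)) (zr (e x) - zr (e y))
  = (\prod_(y | A x y) (zr (e x) - zr (e y)))
    * \prod_(y | A y x) (zr (e x) - zr (e y)).
  rewrite (bigID (fun y => (rk y < rk x)%N)) /=; congr (_ * _).
    apply: eq_bigl => y; rewrite /A -andbA; congr (_ && _).
    by apply: andb_idl => lt; apply: contraTneq lt => ->; rewrite ltnn.
  apply: eq_bigl => y; rewrite /A -andbA [cls x == _]eq_sym.
  case: eqP => //= c; rewrite -leqNgt leq_eqVlt.
  case: (rk x =P rk y) => [r|r] /=.
    by rewrite (rk_inj _ _ c (esym r)) eqxx ltnn.
  by case: (y =P x) r => // ->.
rewrite /class_disc; under eq_bigr => x _ do rewrite E.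
rewrite big_split /= expr2 mulrCA; congr (_ * _).
rewrite (exchange_big_dep predT) //= -prodrXr -big_split /=.
apply: eq_bigr => y _; rewrite -prodr_const.
rewrite (eq_bigl (A y)) // -big_split; apply: eq_bigr => x _ /=.
by rewrite mulN1r opprB.
Qed.

End ClassDisc.
End RootsOfUnity.

(** * Roots of products of cyclotomic polynomials *)

Section CycloRoots.
Variables (N0 : nat) (zeta : algC).
Notation N := N0.+1.
Notation G := 'I_N0.+1.
Hypothesis zetaP : N.-primitive_root zeta.
Notation zr := (@zr N0 zeta).
Notation pZtoC := (map_poly (intr : int -> algC)).

Lemma prim_order_uniq (R : nzRingType) (x : R) m n :
  m.-primitive_root x -> n.-primitive_root x -> m = n.
Proof.
move=> Pm Pn; apply/eqP; rewrite eqn_dvd (prim_order_dvd Pm) (prim_order_dvd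
  Pn).
by rewrite (prim_expr_order Pm) (prim_expr_order Pn) !eqxx.
Qed.

Lemma zr_primE l i : l.-primitive_root (zr i) = (zord i == l).
Proof.
apply/idP/eqP => [P|<-]; last exact: zr_prim.
exact: prim_order_uniq (zr_prim zetaP i) P.
Qed.

Lemma zr_surj x : x ^+ N = 1 -> exists i, x = zr i.
Proof. by move=> /(prim_rootP zetaP)[i ->]; exists i. Qed.

Lemma Cyclotomic_roots l : (l %| N)%N ->
  pZtoC 'Phi_l = \prod_(i : G | zord i == l) ('X - (zr i)%:P).
Proof.
move=> lN; have [i0 Ei0] := zord_surj lN.
have prim0 := zr_prim zetaP i0; rewrite Ei0 in prim0.
rewrite (Cintr_Cyclotomic prim0).
have Ec : cyclotomic (zr i0) l
    = \prod_(x <- [seq zr i0 ^+ k | k : 'I_l <- index_enum 'I_l & coprime k l])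
        ('X - x%:P) by rewrite big_map big_filter.
have Er : \prod_(i : G | zord i == l) ('X - (zr i)%:P)
    = \prod_(x <- [seq zr i | i : G <- index_enum G & zord i == l]) ('X - x%:P).
  by rewrite big_map big_filter.
rewrite Ec Er; apply: perm_big; apply: uniq_perm.
- rewrite map_inj_uniq ?filter_uniq ?index_enum_uniq // => k k' /eqP.
  by rewrite (eq_prim_root_expr prim0) !modn_small // => /eqP/val_inj.
- by rewrite map_inj_uniq ?filter_uniq ?index_enum_uniq //; exact:
  (zr_inj zetaP).
move=> x; rewrite -root_prod_XsubC -Ec root_cyclotomic //.
apply/idP/mapP => [Px|[i]]; last first.
  by rewrite mem_filter => /andP[/eqP <- _] ->; exact: zr_prim.
have [|i Ei] := @zr_surj x.
  by rewrite -(divnK lN) mulnC exprM (prim_expr_order Px) expr1n.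
by exists i => //; rewrite mem_filter mem_index_enum andbT -zr_primE -Ei.
Qed.

Lemma prod_Cyclotomic_roots (s : seq nat) (chi : nat -> nat) :
  uniq s -> (forall l, l \in s -> (l %| N)%N) ->
  pZtoC (\prod_(l <- s) 'Phi_l ^+ chi l)
    = \prod_(i : G | zord i \in s) ('X - (zr i)%:P) ^+ chi (zord i).
Proof.
elim: s => [_ _|l s IHs /= /andP[ls us] sN].
  by rewrite !big_nil rmorph1 big_pred0.
rewrite big_cons rmorphM rmorphXn /= IHs //; last first.
  by move=> k ks; apply: sN; rewrite inE ks orbT.
rewrite Cyclotomic_roots ?sN ?mem_head // [RHS](bigID (fun i =>
  zord i == l)) /=.
rewrite -prodrXl; congr (_ * _); apply: eq_big => i.
- by rewrite inE; case: eqP; rewrite ?andbF.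
- by move=> /eqP ->.
- by rewrite inE; case: eqP => [->|_]; rewrite ?(negbTE ls) ?andbT.
by [].
Qed.

Lemma cyclo_prod_roots (L : {fset nat}) : (forall l, l \in L -> (l %| N)%N) ->
  pZtoC (cyclo_prod L) = \prod_(i : G | zord i \in L) ('X - (zr i)%:P).
Proof.
move=> LN; have := @prod_Cyclotomic_roots L (fun=> 1%N) (fset_uniq _) LN.
by rewrite /cyclo_prod; under eq_bigr do rewrite expr1.
Qed.

Lemma size_cyclo_prod (L : {fset nat}) : (forall l, l \in L -> (l %| N)%N) ->
  size (cyclo_prod L) = #|[pred i : G | zord i \in L]|.+1.
Proof.
move=> LN; rewrite -(size_map_inj_poly (@intr_inj algC)) // cyclo_prod_roots //.
by rewrite -big_filter size_prod_XsubC cardE.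
Qed.

(** A monic product of cyclotomic polynomials has simple roots, so it divides
    every integral polynomial that vanishes at them. *)
Lemma cyclo_prod_dvd (L : {fset nat}) (q : {poly int}) :
  (forall l, l \in L -> (l %| N)%N) ->
  (forall i : G, zord i \in L -> (pZtoC q).[zr i] = 0) ->
  exists r, q = r * cyclo_prod L.
Proof.
move=> LN q0; apply/(Pdiv.RingMonic.rdvdpP (cyclo_prod_monic L)).
have Eq := Pdiv.RingMonic.rdivp_eq (cyclo_prod_monic L) q.
apply/Pdiv.CommonRing.rmodp_eq0P.
set r := Pdiv.CommonRing.rmodp _ _ in Eq *.
apply: (map_inj_poly (@intr_inj algC)) => //; rewrite rmorph0.
pose rs := [seq zr i | i : G <- enum [pred i : G | zord i \in L]].
apply: (@roots_geq_poly_eq0 _ _ rs).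
- apply/allP => _ /mapP[i + ->]; rewrite mem_enum inE => iL; apply/rootP.
  have := q0 i iL; rewrite {1}Eq rmorphD rmorphM /= hornerD hornerM.
  rewrite cyclo_prod_roots // [X in _ * X](_ : _ = 0) ?mulr0 ?add0r //.
  by rewrite (bigD1 i) //= hornerM !hornerE subrr mul0r.
- by rewrite map_inj_uniq ?enum_uniq //; exact: (zr_inj zetaP).
rewrite size_map -cardE -ltnS -size_cyclo_prod //.
apply: leq_ltn_trans (size_poly _ _) _.
by rewrite Pdiv.CommonRing.ltn_rmodpN0 // monic_neq0 // cyclo_prod_monic.
Qed.

End CycloRoots.

(** * Galois invariance of the convolution *)

(** A unit modulo l lifts to a unit modulo every multiple N of l: add to it l
    times the part of N prime to it. *)
Lemma coprime_lift e l N : (0 < N)%N -> (l %| N)%N -> coprime e l ->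
  exists2 e', coprime e' N & (e' = e %[mod l])%N.
Proof.
move=> N0 lN cel; have l0 : (0 < l)%N := dvdn_gt0 N0 lN.
pose e1 := (e + l)%N; have e10 : (0 < e1)%N by rewrite addn_gt0 l0 orbT.
have ce1 : coprime e1 l by rewrite /coprime -gcdn_modl modnDr gcdn_modl.
pose w := (N`_(\pi(e1)^'))%N.
exists (w * l + e1)%N; last by rewrite modnMDl /e1 modnDr.
set e' := (w * l + e1)%N.
have g0 : (0 < gcdn e' N)%N by rewrite gcdn_gt0 N0 orbT.
rewrite /coprime; apply: contraT => g1.
have {}g1 : (1 < gcdn e' N)%N by rewrite ltn_neqAle eq_sym g1.
set p := pdiv (gcdn e' N); have pp : prime p := pdiv_prime g1.
have := pdiv_dvd (gcdn e' N); rewrite -/p dvdn_gcd => /andP[pe pN].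
have w0 : (0 < w)%N := part_gt0 _ _.
have := pi_of_part (\pi(e1)^') N0 p; rewrite -/w !inE !mem_primes pp w0 N0 pN
  e10 /=.
move=> pw.
have [pe1|pe1] := boolP (p %| e1)%N.
  move: pe; rewrite /e' (dvdn_addl _ pe1) Euclid_dvdM // pw pe1 /= => pl.
  have := coprime_dvdl pe1 (coprime_dvdr pl ce1).
  by rewrite prime_coprime // dvdnn.
by case/negP: (pe1); move: pe; rewrite /e' dvdn_addr // dvdn_mulr // pw pe1.
Qed.

Section ConvGalois.
Variables (N0 : nat) (zeta : algC).
Notation N := N0.+1.
Notation G := 'I_N0.+1.
Hypothesis zetaP : N.-primitive_root zeta.
Variables chi1 chi2 : nat -> nat.

Notation X := (conv (fun i : G => chi1 (zord i)) (fun i : G => chi2 (zord i))).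

(** Multiplication by a unit modulo N permutes the pairs (i, j) with given
    orders and carries those with sum c to those with sum e c. *)
Lemma conv_zord (c c' : G) : zord c = zord c' -> X c = X c'.
Proof.
move=> Ec; have P := zr_prim zetaP c; have P' := zr_prim zetaP c'.
rewrite -Ec in P'; have [e0 Ee0] := prim_rootP P (prim_expr_order P').
have ce0 : coprime e0 (zord c) by rewrite -(prim_root_exp_coprime _ P) -Ee0.
have [e ce Ee] := coprime_lift (ltn0Sn N0) (zord_dvd c) ce0.
have {Ee0} Ec' : c' = c *+ e.
  apply: (zr_inj zetaP); rewrite Ee0 -(prim_expr_mod P) -Ee (prim_expr_mod P).
  by rewrite /zr Zp_mulrn /= prim_expr_mod // exprM.
have ordM (i : G) : zord (i *+ e) = zord i.
  apply/eqP; rewrite eqn_dvd !zord_dvdn -mulrnA mulnC mulrnA.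
  have /eqP -> : i *+ zord i == 0 by rewrite -zord_dvdn.
  rewrite mul0rn eqxx /= -zord_dvdn -(@Gauss_dvdr _ e).
    by rewrite zord_dvdn mulrnA -zord_dvdn.
  by rewrite coprime_sym; exact: coprime_dvdr (zord_dvd i) ce.
have inje : injective (fun i : G => i *+ e).
  move=> i j /eqP; rewrite -subr_eq0 -mulrnBl => E.
  apply/eqP; rewrite -subr_eq0; move: E; rewrite -!zord_dvdn.
  move=> E; have := coprime_dvdl E (coprime_dvdr (zord_dvd (i - j)) ce).
  rewrite /coprime gcdnn => /eqP E1.
  by have := zord_dvdn (i - j) 1; rewrite E1 mulr1n => <-.
rewrite Ec' /conv [RHS](reindex_inj inje) /=; apply: eq_bigr => i _.
by rewrite ordM -mulrnBl ordM.
Qed.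

Lemma conv_class_fun : exists chi3 : nat -> nat, forall c, X c = chi3 (zord c).
Proof.
exists (fun l => X (odflt 0 [pick c : G | zord c == l])) => c.
case: pickP => [c' /eqP E|/(_ c)]; last by rewrite eqxx.
by apply: conv_zord.
Qed.

End ConvGalois.

(** * The tensor product of two Orlik blocks: the determinant *)

Lemma card_sum_nat (T : finType) (P : pred T) :
  #|[pred x | P x]| = (\sum_x nat_of_bool (P x))%N.
Proof.
rewrite -sum1_card big_mkcond /=; apply: eq_bigr => x _.
by rewrite inE; case: (P x).
Qed.

Definition class_rank (T : finType) (K : eqType) (cls : T -> K) (x : T) : nat :=
  index x (enum [pred y | cls y == cls x]).

Lemma class_rankP (T : finType) (K : eqType) (cls : T -> K) :
  ranking cls (class_rank cls).
Proof.
split=> [x y c r|x]; last by rewrite cardE index_mem mem_enum inE.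
have xin : x \in enum [pred z | cls z == cls x] by rewrite mem_enum inE.
have yin : y \in enum [pred z | cls z == cls x] by rewrite mem_enum inE c.
by rewrite -(nth_index x xin) -/(class_rank cls x) r /class_rank -c nth_index.
Qed.

Lemma ranking_sum1 (T : finType) (K : eqType) (cls : T -> K) rk c k :
  ranking cls rk ->
  (\sum_x nat_of_bool ((cls x == c) && (rk x == k)))%N
    = (k < #|[pred y | cls y == c]|)%N :> nat.
Proof.
move=> rkP; case: ltnP => [lt|le].
  have [w cw rw] := ranking_surj rkP lt.
  rewrite (bigD1 w) //= cw rw !eqxx big1 // => x xw.
  case: eqP => //= cx; case: eqP => // rx; case/eqP: xw.
  by apply: rkP.1; rewrite ?cw ?rx ?cx.
rewrite big1 // => x _; case: eqP => //= cx; case: eqP => // rx.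
by have := rkP.2 x; rewrite rx cx ltnNge le.
Qed.

Section EnumPred.
Variables (G : finZmodType) (P : pred G).

Lemma sum_enum_pred (V : nmodType) (F : G -> V) :
  \sum_(a < #|P|) F (enum_val a) = \sum_(i | P i) F i.
Proof. by rewrite -big_enum_val. Qed.

Lemma sum_enum_eq (c : G) :
  (\sum_(a < #|P|) nat_of_bool (enum_val a == c))%N = P c.
Proof.
rewrite (sum_enum_pred (fun i => nat_of_bool (i == c))) big_mkcond (bigD1 c)
  //=.
by rewrite eqxx big1 => [|i /negbTE ->]; case: ifP.
Qed.

(** The minimum of two indicator functions is their product, and counts pairs. *)
Lemma cor_enum (d : G) :
  (\sum_(a < #|P|) \sum_(a' < #|P|) (enum_val a == enum_val a' + d)%R)%N
  = (\sum_c minn (P c) (P (c + d)%R))%N.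
Proof.
rewrite exchange_big /=.
under eq_bigr => a _ do rewrite sum_enum_eq.
rewrite (sum_enum_pred (fun i => nat_of_bool (P (i + d)))) big_mkcond /=.
by apply: eq_bigr => i _; case: (P i); case: (P (i + d)).
Qed.

End EnumPred.

Section Pair.
Variable N0 : nat.
Notation G := 'I_N0.+1.
Variables (A B : {fset nat}).

Definition in_ord (L : {fset nat}) : pred G := [pred i | zord i \in L].
Notation m := #|in_ord A|.
Notation n := #|in_ord B|.

(** The pairs of a root of p_A and a root of p_B; exp1 and exp2 are the exponents
    of the two roots, and exp12 is the exponent of their product. *)
Definition pair_index : finType := ('I_m * 'I_n)%type.
Notation T := pair_index.

Definition exp1 (x : T) : G := @enum_val G (in_ord A) x.1.
Definition exp2 (x : T) : G := @enum_val G (in_ord B) x.2.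
Definition exp12 (x : T) : G := exp1 x + exp2 x.

(** The first numbers the fibres of exp12, the second the sets of all points with
    a given number in their fibre. *)
Definition fib_rank : T -> nat := class_rank exp12.
Definition lev_rank : T -> nat := class_rank fib_rank.

Definition pconv : G -> nat :=
  conv (fun i : G => nat_of_bool (zord i \in A))
       (fun i : G => nat_of_bool (zord i \in B)).

Lemma card_fibre c : #|[pred x | exp12 x == c]| = pconv c.
Proof.
rewrite card_sum_nat /pconv /conv.
rewrite -(pair_bigA _ (fun a b => nat_of_bool (exp12 (a, b) == c))) /=.
transitivity (\sum_(a < m) nat_of_bool (in_ord B (c - @enum_val G (in_ord A)
  a)%R))%N.
  apply: eq_bigr => a _; rewrite -sum_enum_eq; apply: eq_bigr => b _.
  congr nat_of_bool; rewrite /exp12 /exp1 /exp2 /=.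
  by rewrite [RHS]eq_sym subr_eq [RHS]eq_sym addrC.
rewrite (sum_enum_pred _ (fun i => nat_of_bool (in_ord B (c - i)))) big_mkcond.
apply: eq_bigr => i _; rewrite /in_ord /=.
by case: (zord i \in A); rewrite /= ?mul1r ?mul0r.
Qed.

Notation cor := (fun (h : G -> nat) d => (\sum_c minn (h c) (h (c + d)%R))%N).

Lemma cnt1 d : class_cnt (snd : T -> 'I_n) exp1 d = (n * cor (in_ord A) d)%N.
Proof.
rewrite /class_cnt -cor_enum.
under eq_bigr => x _ do rewrite card_sum_nat.
rewrite -(pair_bigA _ (fun a b => \sum_(y : T)
  nat_of_bool ((y.2 == b) && (exp1 (a, b) == (exp1 y + d)%R))))%N /=.
rewrite exchange_big /=; set S := (X in (_ * X)%N).
transitivity (\sum_(b < n) S)%N; last by rewrite sum_nat_const card_ord.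
apply: eq_bigr => b _; apply: eq_bigr => a _.
rewrite -(pair_bigA _ (fun a' b' =>
  nat_of_bool ((b' == b) && (exp1 (a, b) == (exp1 (a', b') + d)%R)))) /=.
apply: eq_bigr => a' _; rewrite (bigD1 b) //= eqxx big1 ?addn0 //.
by move=> b' /negbTE ->.
Qed.

Lemma cnt2 d : class_cnt (fst : T -> 'I_m) exp2 d = (m * cor (in_ord B) d)%N.
Proof.
rewrite /class_cnt -cor_enum.
under eq_bigr => x _ do rewrite card_sum_nat.
rewrite -(pair_bigA _ (fun a b => \sum_(y : T)
  nat_of_bool ((y.1 == a) && (exp2 (a, b) == (exp2 y + d)%R))))%N /=.
set S := (X in (_ * X)%N).
transitivity (\sum_(a < m) S)%N; last by rewrite sum_nat_const card_ord.
apply: eq_bigr => a _; apply: eq_bigr => b _.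
rewrite -(pair_bigA _ (fun a' b' =>
  nat_of_bool ((a' == a) && (exp2 (a, b) == (exp2 (a', b') + d)%R)))) /=.
rewrite (bigD1 a) //= [X in (_ + X)%N]big1 ?addn0; last first.
  by move=> a' /negbTE ne; apply: big1 => b' _; rewrite ne.
by apply: eq_bigr => b' _; rewrite eqxx.
Qed.

(** Over c and c + d the points with equal numbers pair up as long as both fibres
    have a point with that number. *)
Lemma cnt3 d : class_cnt fib_rank exp12 d = cor pconv d.
Proof.
rewrite /class_cnt; under eq_bigr => x _ do rewrite card_sum_nat.
rewrite exchange_big /=.
transitivity (\sum_y nat_of_bool (fib_rank y < pconv (exp12 y + d)%R))%N.
  apply: eq_bigr => y _; rewrite -card_fibre.
  rewrite -(ranking_sum1 _ _ (class_rankP exp12)); apply: eq_bigr => x _.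
  by rewrite andbC [fib_rank y == _]eq_sym.
rewrite (partition_big exp12 predT) //=; apply: eq_bigr => c _.
transitivity (\sum_(y | exp12 y == c) nat_of_bool (fib_rank y < pconv (c +
  d)%R))%N.
  by apply: eq_bigr => y /eqP ->.
rewrite (sum_ranking (class_rankP exp12) c
  (fun i => nat_of_bool (i < pconv (c + d)%R)%N)) card_fibre.
move: (pconv c) (pconv (c + d)%R) => u v.
transitivity (\sum_(i < u | (i < v)%N) 1)%N; first by rewrite [RHS]big_mkcond.
rewrite minnC /minn; case: ltnP => [vu|uv].
  by rewrite -(big_ord_widen _ (fun=> 1%N) (ltnW vu)) sum1_card card_ord.
by rewrite (eq_bigl xpredT) ?sum1_card ?card_ord // => i; apply: leq_trans uv.
Qed.

(** If x and y have the same product and first components differing by d, then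
    their second components differ by - d. *)
Lemma cnt4 d :
  class_cnt exp12 exp1 d = (cor (in_ord A) d * cor (in_ord B) d)%N.
Proof.
rewrite /class_cnt -!cor_enum.
under eq_bigr => x _ do rewrite card_sum_nat.
rewrite -(pair_bigA _ (fun a b => \sum_(y : T)
  nat_of_bool ((exp12 y == exp12 (a, b)) && (exp1 (a,
    b) == (exp1 y + d)%R))))%N /=.
rewrite big_distrl /=; apply: eq_bigr => a _.
rewrite [X in (_ * X)%N]exchange_big /= big_distrr /=; apply: eq_bigr => b _.
rewrite -(pair_bigA _ (fun a' b' => nat_of_bool
  ((exp12 (a', b') == exp12 (a, b)) && (exp1 (a, b) == (exp1 (a',
    b') + d)%R)))) /=.
rewrite big_distrl /=; apply: eq_bigr => a' _.
rewrite big_distrr /=; apply: eq_bigr => b' _.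
rewrite /exp12 /exp1 /exp2 /= andbC; case: eqP => [->|_]; last by [].
by rewrite mul1n -addrA (inj_eq (addrI _)) addrC.
Qed.

End Pair.

(** * The change of basis is unimodular *)

Section Unimodular.
Variables (N0 : nat) (zeta : algC).
Notation N := N0.+1.
Notation G := 'I_N0.+1.
Hypothesis zetaP : N.-primitive_root zeta.
Notation zr := (@zr N0 zeta).
Variables (A B : {fset nat}) (b1 b2 : nat -> nat -> bool).
Hypothesis mA : forall p r, prime p -> (0 < r)%N ->
  exponent_mono (fun l => nat_of_bool (l \in A)) p r (b1 p r).
Hypothesis mB : forall p r, prime p -> (0 < r)%N ->
  exponent_mono (fun l => nat_of_bool (l \in B)) p r (b2 p r).

Notation m := #|@in_ord N0 A|.
Notation n := #|@in_ord N0 B|.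
Notation T := (@pair_index N0 A B).
Notation exp1 := (@exp1 N0 A B).
Notation exp2 := (@exp2 N0 A B).
Notation exp12 := (@exp12 N0 A B).
Notation fib_rank := (@fib_rank N0 A B).
Notation lev_rank := (@lev_rank N0 A B).

Lemma exp1_inj (x y : T) : x.2 = y.2 -> exp1 x = exp1 y -> x = y.
Proof. by case: x y => [a b] [a' b'] /= + /enum_val_inj /= => -> ->. Qed.

Lemma exp2_inj (x y : T) : x.1 = y.1 -> exp2 x = exp2 y -> x = y.
Proof. by case: x y => [a b] [a' b'] /= + /enum_val_inj /= => -> ->. Qed.

Lemma exp12_inj1 (x y : T) : exp12 x = exp12 y -> exp1 x = exp1 y -> x = y.
Proof.
move=> E E1; apply: exp1_inj => //; have : exp2 x = exp2 y.
  by apply: (addrI (exp1 x)); rewrite [in RHS]E1.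
by move/enum_val_inj.
Qed.

Lemma exp12_inj (x y : T) : fib_rank x = fib_rank y -> exp12 x = exp12 y ->
  x = y.
Proof. by move=> r c; apply: (class_rankP exp12).1. Qed.

Lemma ranking_fst : ranking (snd : T -> _) (fun x => x.1 : nat).
Proof.
split=> [[a b] [a' b'] /= -> /val_inj -> //|x].
apply: (leq_trans (ltn_ord x.1)).
have inj : injective (fun a : 'I_m => (a, x.2) : T) by move=> a a' [].
rewrite -{1}(card_ord m) -(card_codom inj) subset_leq_card //.
by apply/subsetP => y /codomP[a ->]; rewrite inE.
Qed.

Lemma ranking_snd : ranking (fst : T -> _) (fun x => x.2 : nat).
Proof.
split=> [[a b] [a' b'] /= -> /val_inj -> //|x].
apply: (leq_trans (ltn_ord x.2)).
have inj : injective (fun b : 'I_n => (x.1, b) : T) by move=> b b' [].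
rewrite -{1}(card_ord n) -(card_codom inj) subset_leq_card //.
by apply/subsetP => y /codomP[b ->]; rewrite inE.
Qed.

(** The values of x^i y^j and of t^j x^k, where t = x y. *)
Definition mon_mx (x y : T) : algC := zr (exp1 y) ^+ x.1 * zr (exp2 y) ^+ x.2.
Definition orb_mx (x y : T) : algC :=
  zr (exp12 y) ^+ lev_rank x * zr (exp1 y) ^+ fib_rank x.

Notation before cls rk e := (\prod_(x : T)
  \prod_(y | (cls y == cls x) && (rk y < rk x)%N) (zr (e x) - zr (e y))).

(** The matrix is the product of two block Vandermonde matrices, one for each
    variable. *)
Lemma det_mon_mx : fdet mon_mx
  = before (snd : T -> 'I_n) (fun x : T => nat_of_ord x.1) exp1
    * before (fst : T -> 'I_m) (fun x : T => nat_of_ord x.2) exp2.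
Proof.
rewrite -(fdet_block_Vandermonde ranking_fst (fun x => zr (exp1 x))).
rewrite -(fdet_block_Vandermonde ranking_snd (fun x => zr (exp2 x))) -fdetM.
apply: eq_fdet => x y; pose w : T := (y.1, x.2).
rewrite (bigD1 w) //= !eqxx !mul1r big1 ?addr0.
  by [].
move=> v vw; case: (x.2 =P v.2) => [E1|_]; last by rewrite !mul0r.
case: (v.1 =P y.1) => [E2|_]; last by rewrite mul0r mulr0.
by case/eqP: vw; rewrite /w E1 -E2; case: (v).
Qed.

Lemma det_orb_mx : fdet orb_mx
  = before fib_rank lev_rank exp12 * before exp12 fib_rank exp1.
Proof.
apply: (@fdet_fibre_Vandermonde T _ exp12 fib_rank lev_rank _
  (fun x => zr (exp12 x)) (fun x => zr (exp1 x)) (class_rankP exp12)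
  (class_rankP fib_rank)).
by move=> x y ->.
Qed.

Lemma det_mon_mx_neq0 : fdet mon_mx != 0.
Proof.
have nz (K : eqType) (cls : T -> K) (rk : T -> nat) (e : T -> G) :
    (forall x y, cls x = cls y -> e x = e y -> x = y) -> before cls rk e != 0.
  move=> inj; apply/prodf_neq0 => x _; apply/prodf_neq0 => y /andP[/eqP c lt].
  rewrite subr_eq0; apply: contraTneq lt => /(zr_inj zetaP) E.
  by rewrite (inj _ _ (esym c) E) ltnn.
by rewrite det_mon_mx mulf_neq0 // nz //; [exact: exp1_inj | exact: exp2_inj].
Qed.

Lemma cnt_identity d : d != 0 -> (exists p k, prime p /\ zord d = (p ^ k)%N) ->
  (class_cnt (snd : T -> 'I_n) exp1 d + class_cnt (fst : T -> 'I_m) exp2 d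
   = class_cnt fib_rank exp12 d + class_cnt exp12 exp1 d)%N.
Proof.
move=> d0 [p [k [pp Ed]]]; have k0 : (0 < k)%N.
  rewrite lt0n; apply: contraNneq d0 => k0.
  by have := zord_dvdn d 1; rewrite mulr1n Ed k0 dvd1n.
rewrite cnt1 cnt2 cnt3 cnt4.
have := correlation_identity pp k0 Ed (mA pp k0) (mB pp k0).
have cardE (L : {fset nat}) :
    (\sum_(c : G) nat_of_bool (zord c \in L))%N = #|@in_ord N0 L|.
  by rewrite /in_ord card_sum_nat.
by rewrite /= !cardE.
Qed.

(** Up to units the two determinants have the same prime factors, 1 - zeta^d
    being a unit when the order of d is not a power of a prime. *)
Lemma class_disc_quot :
  Aint_multiple (class_disc zeta (snd : T ->
    'I_n) exp1 * class_disc zeta (fst : T -> 'I_m) exp2)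
      (class_disc zeta fib_rank exp12 * class_disc zeta exp12 exp1).
Proof.
apply: Aint_multiple_trans (Aint_multipleM (class_disc_multiple zetaP exp1_inj)
  (class_disc_multiple zetaP exp2_inj)) _.
apply: Aint_multiple_trans (Aint_multipleM (multiple_class_disc zetaP exp12_inj)
  (multiple_class_disc zetaP exp12_inj1)).
rewrite -!big_split; apply: Aint_multiple_prod => d d0 /=; rewrite -!exprD.
have [pk|npk] := pselect (exists p k, prime p /\ zord d = (p ^ k)%N).
  by rewrite cnt_identity //; exact: Aint_multiple_refl.
have uA : (zr d - 1)^-1 \in Aint.
  apply: (zr_sub1_unit zetaP) => p k pp; apply/eqP => E.
  by apply: npk; exists p, k.
have nz : zr d - 1 != 0.
  by rewrite subr_eq0 -(zr0 N0 zeta); apply: contraNneq d0 =>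
    /(zr_inj zetaP) ->.
set a := (_ + _)%N; set b := (_ + _)%N.
exists ((zr d - 1) ^+ a * (zr d - 1)^-1 ^+ b).
  by rewrite rpredM ?rpredX // rpredB ?(zr_Aint zetaP) // rpred1.
by rewrite exprVn mulfVK // expf_neq0.
Qed.

(** The square of det C is, up to sign, the quotient of the two products of
    differences in class_disc_quot, whose inverse is an algebraic integer. *)
Lemma base_change_unit (C : T -> T -> int) :
  (forall x y, orb_mx x y = \sum_w (C x w)%:~R * mon_mx w y) ->
  fdet C \is a GRing.unit.
Proof.
move=> CE; have dC : fdet orb_mx = (fdet C)%:~R * fdet mon_mx.
  by rewrite -fdet_intr -fdetM; apply: eq_fdet => x y; rewrite CE.
have [u uA] := class_disc_quot.
have [s1 ->] := class_disc_sqr zeta exp1 ranking_fst.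
have [s2 ->] := class_disc_sqr zeta exp2 ranking_snd.
have [s3 ->] := class_disc_sqr zeta exp12 (class_rankP fib_rank).
have [s4 ->] := class_disc_sqr zeta exp1 (class_rankP exp12).
rewrite mulrACA -exprMn -det_mon_mx [X in _ = _ * X]mulrACA -exprMn.
rewrite -det_orb_mx dC exprMn -!exprD => E.
have nz := det_mon_mx_neq0; set D := fdet mon_mx in E nz.
pose c := fdet C; pose v := (-1) ^+ (s1 + s2) * u * (-1) ^+ (s3 + s4) * c%:~R.
have Ev : v * c%:~R = 1.
  apply: (mulIf (expf_neq0 2 nz)); rewrite mul1r.
  transitivity ((-1) ^+ (s1 + s2) * (u * ((-1) ^+ (s3 + s4)
     * (c%:~R ^+ 2 * D ^+ 2)))); first by rewrite /v; ring.
  by rewrite -E mulrA -exprD addnn -mul2n exprM sqrrN !expr1n mul1r.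
have vA : v \in Aint.
  by rewrite /v !rpredM ?rpredX ?rpredN ?rpred1 ?Aint_int.
have c0 : c%:~R != 0 :> algC.
  by apply: contra_eq_neq Ev => ->; rewrite mulr0 eq_sym oner_neq0.
have vQ : v \in Crat.
  have -> : v = c%:~R^-1 by apply: (mulIf c0); rewrite mulVf.
  by rewrite rpredV // rpred_int.
have /intrP[w Ew] := Cint_rat_Aint vQ vA.
have : (w * c)%:~R = 1 :> algC by rewrite intrM -Ew.
move=> /(@intr_inj _ _ 1) E1.
by apply/unitrP; exists w; rewrite E1 mulrC.
Qed.

End Unimodular.

(** * The tensor product of two Orlik blocks: the decomposition *)

Section TensorBlocks.
Variables (N0 : nat) (zeta : algC).
Notation N := N0.+1.
Notation G := 'I_N0.+1.
Hypothesis zetaP : N.-primitive_root zeta.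
Notation zr := (@zr N0 zeta).
Notation pZtoC := (map_poly (intr : int -> algC)).
Variables (A B : {fset nat}) (b1 b2 : nat -> nat -> bool).
Hypotheses (AN : forall l, l \in A -> (l %| N)%N)
           (BN : forall l, l \in B -> (l %| N)%N).
Hypotheses (A0 : A != fset0) (B0 : B != fset0).
Hypothesis mA : forall p r, prime p -> (0 < r)%N ->
  exponent_mono (fun l => nat_of_bool (l \in A)) p r (b1 p r).
Hypothesis mB : forall p r, prime p -> (0 < r)%N ->
  exponent_mono (fun l => nat_of_bool (l \in B)) p r (b2 p r).

(** The level sets of the multiplicities, indexed from 0. *)
Variables (L : nat -> {fset nat}) (l : nat).
Hypothesis LN : forall K m, m \in L K -> (m %| N)%N.
Hypothesis LE : forall K (c : G), (zord c \in L K) = (K < pconv A B c)%N.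
Hypothesis lE : forall c : G, (pconv A B c <= l)%N.

Notation T := (@pair_index N0 A B).
Notation exp1 := (@exp1 N0 A B).
Notation exp2 := (@exp2 N0 A B).
Notation exp12 := (@exp12 N0 A B).
Notation fib_rank := (@fib_rank N0 A B).
Notation lev_rank := (@lev_rank N0 A B).
Notation H := (ztens (Or A) (Or B)).
Notation pA := (cyclo_prod A).
Notation pB := (cyclo_prod B).

Lemma notin0 (M : {fset nat}) : (forall k, k \in M -> (k %| N)%N) ->
  0%N \notin M.
Proof. by move=> MN; apply/negP => /MN; rewrite dvd0n. Qed.

Let mkA : mk_monic pA = pA.
Proof. by rewrite mk_monic_cyclo_prod ?notin0. Qed.
Let mkB : mk_monic pB = pB.
Proof. by rewrite mk_monic_cyclo_prod ?notin0. Qed.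

Lemma cyclo_prod_root (M : {fset nat}) (i : G) :
  (forall k, k \in M -> (k %| N)%N) -> zord i \in M ->
  (pZtoC (cyclo_prod M)).[zr i] = 0.
Proof.
move=> MN iM; rewrite (cyclo_prod_roots zetaP MN) (bigD1 i) //=.
by rewrite hornerM !hornerE subrr mul0r.
Qed.

Lemma in_qpoly_eval (M : {fset nat}) (q : {poly int}) (i : G) :
  (forall k, k \in M -> (k %| N)%N) -> mk_monic (cyclo_prod M) = cyclo_prod M ->
  zord i \in M ->
  (pZtoC (in_qpoly (cyclo_prod M) q : {poly int})).[zr i] = (pZtoC q).[zr i].
Proof.
move=> MN mk iM; rewrite /= mk.
rewrite [in RHS](Pdiv.RingMonic.rdivp_eq (cyclo_prod_monic M) q).
by rewrite rmorphD rmorphM /= hornerD hornerM cyclo_prod_root // mulr0 add0r.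
Qed.

Lemma Or_act_eval (M : {fset nat}) (q : {poly %/ cyclo_prod M}) (i : G) :
  (forall k, k \in M -> (k %| N)%N) -> mk_monic (cyclo_prod M) = cyclo_prod M ->
  zord i \in M ->
  (pZtoC (Or_act q : {poly int})).[zr i] = zr i * (pZtoC (q :
    {poly int})).[zr i].
Proof.
move=> MN mk iM.
have -> : Or_act q = in_qpoly (cyclo_prod M) ('X * (q : {poly int})).
  by rewrite /Or_act -{1}(in_qpolyK q) in_qpolyM.
by rewrite in_qpoly_eval // rmorphM /= map_polyX hornerM hornerX.
Qed.

(** The class of x^i y^j. *)
Definition xy (i j : nat) : H :=
  tpure (in_qpoly pA 'X^i : Or A) (in_qpoly pB 'X^j : Or B).

Lemma ord_exp1 (x : T) : zord (exp1 x) \in A.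
Proof. by have := enum_valP x.1. Qed.

Lemma ord_exp2 (x : T) : zord (exp2 x) \in B.
Proof. by have := enum_valP x.2. Qed.

(** Evaluation at a pair of roots, an additive map on the tensor product for which
    h acts as the product of the two roots. *)
Lemma eval_exists (x : T) : exists ev : {additive H -> algC},
  (forall i j, ev (xy i j) = zr (exp1 x) ^+ i * zr (exp2 x) ^+ j) /\
  (forall v, ev (zact H v) = zr (exp12 x) * ev v).
Proof.
pose beta (q : Or A) (r : Or B) :=
  (pZtoC (q : {poly %/ pA})).[zr (exp1 x)] * (pZtoC (r :
    {poly %/ pB})).[zr (exp2 x)].
have [ev evE] : exists f : {additive tens (Or A) (Or B) -> algC},
    forall q r, f (tpure q r) = beta q r.
  apply: tens_lift => [q q' r|q r r']; rewrite /beta.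
    by rewrite poly_of_qpolyD rmorphD /= hornerD mulrDl.
  by rewrite poly_of_qpolyD rmorphD /= hornerD mulrDr.
exists ev; split=> [i j|].
  rewrite /xy evE /beta !in_qpoly_eval ?ord_exp1 ?ord_exp2 //.
  by rewrite !map_polyXn !hornerXn.
apply: tens_ind => [|v w Ev Ew|q r]; first by rewrite !raddf0 mulr0.
  by rewrite !raddfB Ev Ew mulrBr.
rewrite zact_tpure !evE /beta /= !Or_act_eval ?ord_exp1 ?ord_exp2 //.
by rewrite (zrD zetaP); ring.
Qed.

Lemma Or_span (M : {fset nat}) (q : Or M) :
  (forall k, k \in M -> (k %| N)%N) -> mk_monic (cyclo_prod M) = cyclo_prod M ->
  exists c : nat -> int, q = \sum_(i < #|@in_ord N0 M|)
    (in_qpoly (cyclo_prod M) 'X^i : Or M) *~ c i.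
Proof.
move=> MN mk; exists (fun i => (q : {poly %/ cyclo_prod M})`_i).
rewrite -[LHS](in_qpolyK q); set p : {poly int} := (q : {poly %/ _}).
have sp : (size p <= #|@in_ord N0 M|)%N.
  have : (size p < size (mk_monic (cyclo_prod M)))%N := size_mk_monic _.
  by rewrite mk (size_cyclo_prod zetaP MN).
rewrite -[LHS](congr1 (in_qpoly (cyclo_prod M)) (coefK p)).
have -> : \poly_(i < size p) p`_i = \sum_(i < #|@in_ord N0 M|) p`_i *: 'X^i.
  rewrite coefK -{1}(coefK p) poly_def (big_ord_widen _ (fun i => p`_i *:
    'X^i) sp).
  rewrite big_mkcond; apply: eq_bigr => i _; case: ltnP =>
    // /(nth_default 0) ->.
  by rewrite scale0r.
rewrite linear_sum; apply: eq_bigr => i _; rewrite linearZ /=.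
by rewrite -[p`_i in LHS]intz scaler_int.
Qed.

Lemma tens_span (v : H) : exists c : T -> int,
  v = \sum_(x : T) xy x.1 x.2 *~ c x.
Proof.
elim/tens_ind: v => [|v w [c ->] [c' ->]|q r].
- by exists (fun=> 0); rewrite big1 // => x _; rewrite mulr0z.
- by exists (fun x => c x - c' x); rewrite -sumrB; apply: eq_bigr => x _;
  rewrite mulrzBr.
have [c ->] := Or_span q AN mkA; have [c' ->] := Or_span r BN mkB.
exists (fun x : T => c x.1 * c' x.2).
have addl (s : Or B) : {f : {additive Or A -> H} | forall q, f q = tpure q s}.
  pose f q : H := tpure q s.
  have fB : zmod_morphism f by move=> u u'; exact: tpureBl.
  pose fm := GRing.isZmodMorphism.Build (Or A) H f fB.
  by exists (HB.pack f fm : {additive Or A -> H}).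
have addr (u : Or A) : {f : {additive Or B -> H} | forall s, f s = tpure u s}.
  pose f s : H := tpure u s.
  have fB : zmod_morphism f by move=> w w'; exact: tpureBr.
  pose fm := GRing.isZmodMorphism.Build (Or B) H f fB.
  by exists (HB.pack f fm : {additive Or B -> H}).
rewrite -(svalP (addl _)) raddf_sum.
rewrite -(pair_bigA _ (fun (a : 'I_#|@in_ord N0 A|) (b : 'I_#|@in_ord N0 B|) =>
  xy a b *~ (c a * c' b))) /=.
apply: eq_bigr => a _; rewrite raddfMz (svalP (addl _)) -(svalP (addr _)).
rewrite raddf_sum mulrz_suml; apply: eq_bigr => b _.
by rewrite raddfMz (svalP (addr _)) mulrC mulrzA.
Qed.

Lemma eval_fun : exists ev : T -> {additive H -> algC},
  (forall x i j, ev x (xy i j) = zr (exp1 x) ^+ i * zr (exp2 x) ^+ j) /\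
  (forall x v, ev x (zact H v) = zr (exp12 x) * ev x v).
Proof.
have [ev evP] := choice eval_exists.
by exists ev; split=> x; [exact: (evP x).1 | exact: (evP x).2].
Qed.

Section WithEval.
Variable ev : T -> {additive H -> algC}.
Hypothesis ev_xy : forall x i j,
  ev x (xy i j) = zr (exp1 x) ^+ i * zr (exp2 x) ^+ j.
Hypothesis ev_zact : forall x v, ev x (zact H v) = zr (exp12 x) * ev x v.

Lemma ev_pact x (q : {poly int}) v :
  ev x (pact q v) = (pZtoC q).[zr (exp12 x)] * ev x v.
Proof.
elim/poly_ind: q => [|q c IHq]; first by rewrite pact0l raddf0 rmorph0 horner0
  mul0r.
rewrite pactDl pactMX raddfD /= ev_zact IHq pactC raddfMz.
rewrite rmorphD rmorphM /= map_polyX map_polyC hornerD hornerM hornerX hornerC.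
by rewrite -mulrzr; ring.
Qed.

(** The elements t^j x^k, with t = x y, indexed by the points. *)
Definition orb (x : T) : H := pact 'X^(lev_rank x) (xy (fib_rank x) 0).

(** The monomials span, and the base change to the elements orb is invertible. *)
Lemma orb_span v : exists c : T -> int, v = \sum_(x : T) orb x *~ c x.
Proof.
have [C CE] := choice (fun x => tens_span (orb x)).
have uC : fdet C \is a GRing.unit.
  apply: (base_change_unit zetaP mA mB) => x y.
  transitivity (ev y (orb x)).
    by rewrite /orb ev_pact map_polyXn hornerXn ev_xy expr0 mulr1.
  rewrite {1}(CE x) raddf_sum; apply: eq_bigr => w _.
  by rewrite [LHS]raddfMz ev_xy mulrzl.
have [D DE] := fdet_unit_inv uC; have [c ->] := tens_span v.
have E (y : T) : xy y.1 y.2 = \sum_x orb x *~ D y x.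
  under eq_bigr => x _ do rewrite (CE x) mulrz_suml.
  rewrite exchange_big /= (bigD1 y) //= [X in _ = _ + X]big1 ?addr0.
    transitivity (xy y.1 y.2 *~ \sum_w D y w * C w y).
      by rewrite DE eqxx.
    by rewrite mulrz_sumr; apply: eq_bigr => w _; rewrite mulrC mulrzA.
  move=> w wy; transitivity (xy w.1 w.2 *~ \sum_u D y u * C u w).
    by rewrite mulrz_sumr; apply: eq_bigr => u _; rewrite mulrC mulrzA.
  by rewrite DE eq_sym (negbTE wy) mulr0z.
exists (fun x => \sum_y D y x * c y).
under eq_bigr => y _ do rewrite E mulrz_suml.
rewrite exchange_big /=; apply: eq_bigr => x _; rewrite mulrz_sumr.
by apply: eq_bigr => y _; rewrite mulrzA.
Qed.

Notation x_ k := (xy k 0).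
Notation p_ k := (cyclo_prod (L k)).

Lemma ev_sum (q : nat -> {poly int}) K x :
  ev x (\sum_(k < K) pact (q k) (x_ k))
  = \sum_(k < K) (pZtoC (q k)).[zr (exp12 x)] * zr (exp1 x) ^+ k.
Proof.
rewrite raddf_sum; apply: eq_bigr => k _.
by rewrite ev_pact ev_xy expr0 mulr1.
Qed.

(** Over a point t of L_K the fibre has more than K points, at which the
    polynomial sum_k q_k(t) x^k of degree at most K vanishes. *)
Lemma fibre_vanish (q : nat -> {poly int}) K :
  (forall x : T, exp12 x \in [pred c | zord c \in L K] ->
     \sum_(k < K.+1) (pZtoC (q k)).[zr (exp12 x)] * zr (exp1 x) ^+ k = 0) ->
  forall k, (k <= K)%N -> exists r, q k = r * p_ K.
Proof.
move=> q0 k kK; apply: (cyclo_prod_dvd zetaP (@LN K)) => c cK.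
pose h := \poly_(k < K.+1) (pZtoC (q k)).[zr c].
suff h0 : h = 0.
  by have := congr1 (fun h : {poly algC} => h`_k) h0;
    rewrite coef_poly ltnS kK coef0.
pose rs := [seq zr (exp1 x) | x <- enum [pred x | exp12 x == c]].
apply: (@roots_geq_poly_eq0 _ _ rs).
- apply/allP => _ /mapP[x + ->]; rewrite mem_enum inE => /eqP xc.
  have := q0 x; rewrite inE xc cK => /(_ isT) E.
  by apply/rootP; rewrite horner_poly.
- rewrite map_inj_in_uniq ?enum_uniq // => x y; rewrite !mem_enum !inE.
  by move=> /eqP xc /eqP yc /(zr_inj zetaP); apply: exp12_inj1; rewrite xc yc.
rewrite size_map -cardE card_fibre (leq_trans (size_poly _ _)) //.
by rewrite -LE.
Qed.

Lemma fibre_vanish0 (q : nat -> {poly int}) K :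
  \sum_(k < K.+1) pact (q k) (x_ k) = 0 ->
  forall k, (k <= K)%N -> exists r, q k = r * p_ K.
Proof.
move=> E; apply: fibre_vanish => x _; rewrite -ev_sum E.
exact: raddf0.
Qed.

(** On the points with number K in their fibre, exp12 is injective, and its image
    consists of the points of Z / N with more than K points above them. *)
Lemma size_level K : #|[pred x | fib_rank x == K]| = #|[pred c :
  G | zord c \in L K]|.
Proof.
have inj : {in [pred x | fib_rank x == K] &, injective exp12}.
  move=> x y; rewrite !inE => /eqP rx /eqP ry.
  by apply: (@exp12_inj N0 A B); rewrite rx ry.
rewrite -(card_in_image inj); apply: eq_card => c; rewrite inE LE.
apply/imageP/idP => [[x + ->]|].
  rewrite inE => /eqP <-; rewrite -card_fibre.
  exact: (class_rankP exp12).2.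
rewrite -card_fibre => /(ranking_surj (class_rankP exp12))[x xc xK].
by exists x; rewrite ?xc // inE; apply/eqP.
Qed.

Lemma lev_span v : exists2 q : nat -> {poly int},
  v = \sum_(k < l) pact (q k) (x_ k) &
  forall k, (size (q k) < size (p_ k))%N.
Proof.
have [c Ev] := orb_span v.
exists (fun k => \sum_(x | fib_rank x == k) c x *: 'X^(lev_rank x)).
  have rkl x : (fib_rank x < l)%N.
    apply: leq_trans ((class_rankP exp12).2 x) _.
    by rewrite card_fibre.
  rewrite Ev (partition_big (fun x => Ordinal (rkl x)) predT) //=.
  apply: eq_bigr => k _; rewrite pact_suml.
  apply: eq_big => [x|x /eqP <-]; first by rewrite -val_eqE.
  by rewrite -mul_polyC pactM pactC.
move=> k; rewrite (size_cyclo_prod zetaP (@LN k)) ltnS -size_level.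
apply: (leq_trans (size_sum _ _ _)); apply/bigmax_leqP => x /eqP xk.
apply: (leq_trans (size_scale_leq _ _)); rewrite size_polyXn.
by rewrite -xk; exact: (class_rankP fib_rank).2.
Qed.

Lemma dvd_small (q r p : {poly int}) : p \is monic -> (size q < size p)%N ->
  q = r * p -> q = 0.
Proof.
move=> mp lt E; apply/eqP; apply: contraTT lt => q0; rewrite -leqNgt E.
have r0 : r != 0 by apply: contraNneq q0 => r0; rewrite E r0 mul0r.
by rewrite size_Mmonic // (polySpred r0) addSn /= leq_addl.
Qed.

(** p_K(t) x^K is a combination of the lower powers of x, with coefficients
    divisible by p_K; subtracting them yields a generator killed by p_K. *)
Lemma annihilated K : (K < l)%N -> exists g : nat -> {poly int},
  pact (p_ K) (x_ K - \sum_(k < K) pact (g k) (x_ k)) = 0.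
Proof.
move=> Kl; have [q Eq sq] := lev_span (pact (p_ K) (x_ K)).
pose q' k := q k - (if k == K then p_ K else 0).
have q'0 : \sum_(k < l) pact (q' k) (x_ k) = 0.
  under eq_bigr => k _ do rewrite /q' pactBl.
  rewrite sumrB -Eq (bigD1 (Ordinal Kl)) //= eqxx big1 ?addr0 ?subrr //.
  move=> k; rewrite -val_eqE /= => /negbTE ->.
  by rewrite pact0l.
(* From the top power downwards, the coefficients vanish by their degree. *)
have down i : (i <= l - K.+1)%N -> \sum_(k < l - i) pact (q' k) (x_ k) = 0.
  elim: i => [|i IHi] il; first by rewrite subn0.
  have {IHi} := IHi (ltnW il).
  have -> : (l - i = (l - i.+1).+1)%N by lia.
  set j := (l - i.+1)%N => E.
  have [r Er] := fibre_vanish0 E (leqnn j).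
  have jK : (j == K) = false by lia.
  have qj : q j = 0.
    apply: (dvd_small (cyclo_prod_monic (L j)) (sq j) (r := r)).
    by rewrite -Er /q' jK subr0.
  by move: E; rewrite big_ord_recr /= /q' jK qj subr0 pact0l addr0.
have := down _ (leqnn _); rewrite subKn // => E.
have dv := fibre_vanish0 E.
have qK : q K = 0.
  have [r Er] := dv K (leqnn K).
  apply: (dvd_small (cyclo_prod_monic (L K)) (sq K) (r := r + 1)).
  by rewrite mulrDl mul1r -Er /q' eqxx subrK.
have [g gE] : exists g : nat -> {poly int},
    forall k, (k < K)%N -> q k = g k * p_ K.
  have /choice[g gE] : forall k, exists r, (k < K)%N -> q k = r * p_ K.
    move=> k; have [lt|_] := ltnP k K; last by exists 0.
    have [r Er] := dv k (ltnW lt); exists r => _.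
    by rewrite -Er /q' (ltn_eqF lt) subr0.
  by exists g.
exists g; move: E; rewrite big_ord_recr /= /q' eqxx qK sub0r pactNl.
move/eqP; rewrite subr_eq0 => /eqP E.
rewrite raddfB /= -E [X in _ - X]raddf_sum -sumrB big1 // => k _.
by rewrite /= (ltn_eqF (ltn_ord k)) subr0 gE // -pactM mulrC subrr.
Qed.

Lemma presented_tensor : presented H [seq p_ k | k <- iota 0 l].
Proof.
have [g gE] : exists g : nat -> nat -> {poly int}, forall K, (K < l)%N ->
    pact (p_ K) (x_ K - \sum_(k < K) pact (g K k) (x_ k)) = 0.
  have /choice[g gE] : forall K, exists g : nat -> {poly int}, (K < l)%N ->
      pact (p_ K) (x_ K - \sum_(k < K) pact (g k) (x_ k)) = 0.
    move=> K; have [lt|_] := ltnP K l; last by exists (fun=> 0).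
    by have [g gE] := annihilated lt; exists g.
  by exists g.
pose a K := x_ K - \sum_(k < K) pact (g K k) (x_ k).
have aE r i : pact r (a i)
    = pact r (x_ i) - \sum_(k < i) pact (r * g i k) (x_ k).
  rewrite /a raddfB /= [X in _ - X]raddf_sum; congr (_ - _).
  by apply: eq_bigr => k _; rewrite pactM.
have szps : size [seq p_ k | k <- iota 0 l] = l by rewrite size_map size_iota.
have nthps k : (k < l)%N -> [seq p_ k | k <- iota 0 l]`_k = p_ k.
  by move=> kl; rewrite (nth_map 0%N) ?size_iota // nth_iota.
exists a; rewrite /presents szps; split.
- pose S v := exists q : nat -> {poly int}, v = \sum_(k < l) pact (q k) (a k).
  have SD v w : S v -> S w -> S (v + w).
    move=> [q ->] [r ->]; exists (fun k => q k + r k); rewrite -big_split.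
    by apply: eq_bigr => k _; rewrite pactDl.
  have SM r v : S v -> S (pact r v).
    move=> [q ->]; exists (fun k => r * q k); rewrite raddf_sum.
    by apply: eq_bigr => k _; rewrite pactM.
  have S0 : S 0.
    by exists (fun=> 0); rewrite big1 // => k _; rewrite pact0l.
  have Sx k : (k < l)%N -> S (x_ k).
    elim/ltn_ind: k => k IHk kl.
    have -> : x_ k = a k + \sum_(i < k) pact (g k i) (x_ i) by rewrite subrK.
    apply: (SD).
      exists (fun i => if i == k then 1 else 0).
      rewrite (bigD1 (Ordinal kl)) //= eqxx pact1 big1 ?addr0 //.
      by move=> i; rewrite -val_eqE /= => /negbTE ->; rewrite pact0l.
    apply: (big_ind S S0 SD) => i _; apply: (SM); apply: IHk => //.
    exact: ltn_trans (ltn_ord i) kl.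
  move=> v; have [q Ev _] := lev_span v; rewrite Ev.
  by apply: (big_ind S S0 SD) => k _; apply: (SM); exact: Sx.
move=> q; split=> [E|E].
(* The relation among the corrected generators is read in terms of the powers of
   x, where fibre_vanish0 applies to the top coefficient. *)
- have expand i : exists Q : nat -> {poly int},
      \sum_(k < i) pact (q k) (a k) = \sum_(k < i) pact (Q k) (x_ k).
    elim: i => [|i [Q EQ]]; first by exists (fun=> 0); rewrite !big_ord0.
    exists (fun k => if k == i then q i else Q k - q i * g i k).
    rewrite !big_ord_recr /= EQ eqxx aE addrCA [RHS]addrC; congr (_ + _).
    rewrite -sumrB; apply: eq_bigr => k _.
    by rewrite (ltn_eqF (ltn_ord k)) pactBl.
  have main i : (i <= l)%N -> \sum_(k < i) pact (q k) (a k) = 0 ->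
      forall k, (k < i)%N -> exists r, q k = r * p_ k.
    elim: i => [//|i IHi] il; rewrite big_ord_recr /= => E0.
    have [r Er] : exists r, q i = r * p_ i.
      have [Q EQ] := expand i.
      pose Q' k := if k == i then q i else Q k - q i * g i k.
      have := @fibre_vanish0 Q' i; rewrite /Q' big_ord_recr /= eqxx.
      case/(_ _ i (leqnn i)); last by rewrite eqxx => r; exists r.
      rewrite -[RHS]E0 EQ aE [RHS]addrCA [LHS]addrC; congr (_ + _).
      rewrite -sumrB; apply: eq_bigr => k _.
      by rewrite (ltn_eqF (ltn_ord k)) pactBl.
    have ai0 : pact (q i) (a i) = 0 by rewrite Er pactM gE // raddf0.
    move=> k; rewrite ltnS leq_eqVlt => /orP[/eqP ->|ki]; first by exists r.
    by apply: IHi => //; [exact: ltnW | rewrite -[LHS]addr0 -{2}ai0].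
  move=> k kl; rewrite nthps //; exact: main E k kl.
rewrite big1 // => k _; have [r] := E k (ltn_ord k).
by rewrite nthps // => ->; rewrite pactM gE // raddf0.
Qed.

End WithEval.

(** Or(A) (x) Or(B) is the sum of the cyclic modules with annihilators p_(L_k):
    the powers of x generate it in triangular form over Z[t]. *)
Lemma tensor_presented : presented H [seq cyclo_prod (L k) | k <- iota 0 l].
Proof. by have [ev [E1 E2]] := eval_fun; exact: presented_tensor E1 E2. Qed.

End TensorBlocks.

(** * Sorting a sum of Orlik blocks into a nested one *)

(** b abstracts from a tuple of excellent orders: b p r says whether r lies in the
    set S attached to p. *)
Definition aligned (b : nat -> nat -> bool) (A : {fset nat}) : Prop :=
  0%N \notin A /\
  forall p r, prime p -> (0 < r)%N ->
    exponent_mono (fun l => nat_of_bool (l \in A)) p r (b p r).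

Lemma alignedU b (A B : {fset nat}) :
  aligned b A -> aligned b B -> aligned b (A `|` B)%fset.
Proof.
move=> [A0 mA] [B0 mB]; split; first by rewrite !inE negb_or A0.
move=> p r pp r0 u l u0 pu lr; have := mA p r pp r0 u l u0 pu lr.
have := mB p r pp r0 u l u0 pu lr; rewrite !inE.
by case: (b p r); do !case: (_ \in _).
Qed.

Lemma alignedI b (A B : {fset nat}) :
  aligned b A -> aligned b B -> aligned b (A `&` B)%fset.
Proof.
move=> [A0 mA] [B0 mB]; split; first by rewrite !inE (negbTE A0).
move=> p r pp r0 u l u0 pu lr; have := mA p r pp r0 u l u0 pu lr.
have := mB p r pp r0 u l u0 pu lr; rewrite !inE.
by case: (b p r); do !case: (_ \in _).
Qed.

(** If m = n p^k, then m and n are comparable for the order attached to p, so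
    they cannot lie one in A but not B and the other in B but not A. *)
Lemma aligned_ratio b (A B : {fset nat}) m n p k : aligned b A -> aligned b B ->
  m \in A -> m \notin B -> n \in B -> n \notin A -> prime p ->
  m != (n * p ^ k)%N /\ n != (m * p ^ k)%N.
Proof.
have half (C D : {fset nat}) x y : aligned b C -> aligned b D ->
    x \in C -> x \notin D -> y \in D -> y \notin C -> prime p ->
    x != (y * p ^ k)%N.
  move=> [C0 mC] [D0 mD] xC xD yD yC pp; apply/eqP => Ex.
  have y0 : (0 < y)%N by rewrite lt0n; apply: contraNneq D0 => <-.
  have [u pu Eu] := pfactor_coprime pp y0; set l := logn p y in Eu.
  have u0 : (0 < u)%N by move: y0; rewrite Eu muln_gt0 => /andP[].
  rewrite prime_coprime // in pu.
  case: (posnP k) => [k0|k0].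
    by move: xD; rewrite Ex k0 muln1 yD.
  have Ex' : x = (u * p ^ (l + k))%N by rewrite Ex {1}Eu -mulnA -expnD.
  have r0 : (0 < l + k)%N by rewrite addn_gt0 k0 orbT.
  have lr : (l < l + k)%N by rewrite -addn1 leq_add2l.
  have := mC p _ pp r0 u l u0 pu lr; have := mD p _ pp r0 u l u0 pu lr.
  rewrite -Eu -Ex' xC yD (negbTE xD) (negbTE yC).
  by case: (b _ _).
move=> aA aB mA mB nB nA pp; split; first exact: half aA aB mA mB nB nA pp.
exact: half aB aA nB nA mA mB pp.
Qed.

Lemma aligned_comax b (A B : {fset nat}) : aligned b A -> aligned b B ->
  comax (cyclo_prod (A `\` B)%fset) (cyclo_prod (B `\` A)%fset).
Proof.
move=> aA aB; apply: comax_prod => m; rewrite inE => /andP[mB mA].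
apply/comax_sym/comax_prod => n; rewrite inE => /andP[nA nB].
apply/comax_sym; have pos (C : {fset nat}) x : aligned b C -> x \in C ->
  (0 < x)%N.
  by move=> [C0 _] xC; rewrite lt0n; apply: contraNneq C0 => <-.
apply: Cyclotomic_comax; rewrite ?(pos _ _ aA mA) ?(pos _ _ aB nB) // => p k pp.
  exact: (aligned_ratio k aA aB mA mB nB nA pp).1.
exact: (aligned_ratio k aA aB mA mB nB nA pp).2.
Qed.

(** Insertion sort for inclusion, where a comparison replaces A and B by their
    union and their intersection. *)
Fixpoint insert_block (A : {fset nat}) (s : seq {fset nat}) : seq {fset nat} :=
  if s is B :: s' then (A `|` B)%fset :: insert_block (A `&` B)%fset s'
  else [:: A].

Definition sort_blocks (s : seq {fset nat}) := foldr insert_block [::] s.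

Definition all_aligned b (s : seq {fset nat}) := forall A, A \in s ->
  aligned b A.

Lemma insert_block_aligned b A s : aligned b A -> all_aligned b s ->
  all_aligned b (insert_block A s).
Proof.
elim: s A => [|B s IHs] A aA as_ C /=; first by rewrite inE => /eqP ->.
have aB := as_ B (mem_head _ _); rewrite inE => /orP[/eqP ->|].
  exact: alignedU.
apply: IHs; first exact: alignedI.
by move=> D Ds; apply: as_; rewrite inE Ds orbT.
Qed.

Lemma insert_block_iso b A s : aligned b A -> all_aligned b s ->
  zmodEnd_iso (zsum (block A) (zbigsum (map block s)))
    (zbigsum (map block (insert_block A s))).
Proof.
elim: s A => [|B s IHs] A aA as_ /=; first exact: zmodEnd_iso_refl.
have aB := as_ B (mem_head _ _).
apply: zmodEnd_iso_trans (zmodEnd_iso_sym (zsum_assoc _ _ _)) _.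
apply: zmodEnd_iso_trans (zsum_iso (block_merge aA.1 aB.1 (aligned_comax aA aB))
  (zmodEnd_iso_refl _)) _.
apply: zmodEnd_iso_trans (zsum_assoc _ _ _) _.
apply: zsum_iso; first exact: zmodEnd_iso_refl.
apply: IHs; first exact: alignedI.
by move=> D Ds; apply: as_; rewrite inE Ds orbT.
Qed.

Lemma sort_blocks_iso b s : all_aligned b s ->
  zmodEnd_iso (zbigsum (map block s)) (zbigsum (map block (sort_blocks s))).
Proof.
move=> as_; suff [] : all_aligned b (sort_blocks s) /\
  zmodEnd_iso (zbigsum (map block s)) (zbigsum (map block (sort_blocks s))) by
    [].
elim: s as_ => [|A s IHs] as_; first by split=> //; exact: zmodEnd_iso_refl.
have aA := as_ A (mem_head _ _).
have [|a' iso'] := IHs; first by move=> D Ds; apply: as_; rewrite inE Ds orbT.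
split; first exact: insert_block_aligned.
apply: zmodEnd_iso_trans (insert_block_iso aA a').
by apply: zsum_iso => //; exact: zmodEnd_iso_refl.
Qed.

Notation cover_count m s := (count (fun A : {fset nat} => m \in A) s).

Lemma insert_block_count A s m :
  cover_count m (insert_block A s) = ((m \in A) + cover_count m s)%N.
Proof.
elim: s A => //= B s IHs A; rewrite IHs !inE addnA addnA; congr (_ + _)%N.
by case: (m \in A); case: (m \in B).
Qed.

Lemma sort_blocks_count s m : cover_count m (sort_blocks s) = cover_count m s.
Proof. by elim: s => //= A s IHs; rewrite insert_block_count IHs. Qed.

Notation nested := (sorted (fun A B : {fset nat} => (B `<=` A)%fset)).

Lemma insert_block_nested A s : nested s -> nested (insert_block A s).
Proof.
elim: s A => //= B [|C s] IHs A.
  by move=> _ /=; rewrite andbT fsubIset // fsubsetUl.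
move=> /= /andP[CB Cs]; have /= := IHs (A `&` B)%fset Cs.
move=> ->; rewrite andbT fsubUset (fsubset_trans CB) ?fsubsetUr //.
by rewrite fsubIset // fsubsetUl.
Qed.

Lemma sort_blocks_nested s : nested (sort_blocks s).
Proof. by elim: s => //= A s IHs; exact: insert_block_nested. Qed.

Lemma nested_nth s k m : nested s ->
  (m \in nth fset0 s k) = (k < cover_count m s)%N.
Proof.
elim: s k => [|B s IHs] k /=; first by rewrite nth_nil in_fset0.
move=> Bs; have subB : all (fun A => (A `<=` B)%fset) s.
  apply: (order_path_min (leT := fun A B : {fset nat} => (B `<=` A)%fset)) =>
    //.
  by move=> x y z yx zy; exact: fsubset_trans zy yx.
have ns := path_sorted Bs.
have [mB|mB] := boolP (m \in B); first by case: k => [|k] //=; rewrite IHs.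
have c0 : cover_count m s = 0%N.
  apply/eqP; rewrite -leqn0 leqNgt -has_count; apply/hasPn => C Cs.
  by apply: contra mB; apply/fsubsetP; exact: (allP subB).
rewrite c0 /= ltn0; case: k => [|k] /=; first exact: negbTE.
by rewrite IHs // c0 ltn0.
Qed.

Lemma zbigsum_zzero (s : seq {fset nat}) k :
  zmodEnd_iso (zbigsum (map block (s ++ nseq k fset0))) (zbigsum (map block s)).
Proof.
have E : block fset0 = zzero by rewrite /block eqxx.
elim: s => [|A s IHs] /=.
  elim: k => [|k IHk] /=; first exact: zmodEnd_iso_refl.
  by rewrite E; apply: zmodEnd_iso_trans (zsum0 _) IHk.
by apply: zsum_iso => //; exact: zmodEnd_iso_refl.
Qed.

Lemma mult_max_ge (chi : mult_fun) m : (chi m <= mult_max chi)%N.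
Proof.
rewrite /mult_max; have [ms|/fsfun_dflt -> //] := boolP (m \in finsupp chi).
by rewrite (big_rem m) //= leq_maxl.
Qed.

Lemma in_std_cover_set (chi : mult_fun) j m : (0 < j)%N ->
  (m \in std_cover_set chi j) = (j <= chi m)%N.
Proof.
move=> j0; rewrite !inE /= andb_idl // => le; rewrite mem_finsupp.
by rewrite -lt0n (leq_trans j0).
Qed.

Lemma std_cover_set_neq0 (chi : mult_fun) j :
  (0 < j <= mult_max chi)%N -> std_cover_set chi j != fset0.
Proof.
move=> /andP[j0 jmax]; apply/fset0Pn.
suff [m mj] : exists m, (j <= chi m)%N by exists m; rewrite in_std_cover_set.
apply: contrapT => H; have {}H m : (chi m < j)%N.
  by rewrite ltnNge; apply/negP => le; apply: H; exists m.
have : (mult_max chi < j)%N.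
  rewrite /mult_max; apply: (big_ind (fun x => (x < j)%N)) => // x y xj yj.
  by rewrite gtn_max xj.
by rewrite ltnNge jmax.
Qed.

Lemma std_cover_block (chi : mult_fun) :
  [seq Or M | M <- std_cover chi] = [seq block M | M <- std_cover chi].
Proof.
apply/eq_in_map => M /mapP[j]; rewrite mem_iota add1n ltnS => jP ->.
by rewrite /block (negbTE (std_cover_set_neq0 jP)).
Qed.

(** Sorting preserves the multiplicities, and a nested family is determined by
    them, up to empty sets at the end. *)
Lemma blocks_std_cover b s (chi : mult_fun) : all_aligned b s ->
  (forall m, cover_count m s = chi m) ->
  zmodEnd_iso (zbigsum (map block s)) (zbigsum [seq Or M | M <- std_cover chi]).
Proof.
move=> as_ cs; apply: zmodEnd_iso_trans (sort_blocks_iso as_) _.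
rewrite std_cover_block; set s' := sort_blocks s.
have cs' m : cover_count m s' = chi m by rewrite sort_blocks_count.
have le : (mult_max chi <= size s')%N.
  have [-> //|max0] := posnP (mult_max chi).
  have /fset0Pn[m] : std_cover_set chi (mult_max chi) != fset0.
    by rewrite std_cover_set_neq0 // max0 leqnn.
  rewrite in_std_cover_set // => /leq_trans; apply.
  by rewrite -cs' count_size.
suff -> : s' = std_cover chi ++ nseq (size s' - mult_max chi) fset0.
  exact: zbigsum_zzero.
have sz : size (std_cover chi) = mult_max chi by rewrite size_map size_iota.
apply: (@eq_from_nth _ fset0).
  by rewrite size_cat size_nseq sz subnKC.
move=> k ks; apply/fsetP => m; rewrite nested_nth ?sort_blocks_nested // cs'.
rewrite nth_cat sz; case: (ltnP k (mult_max chi)) => [km|km].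
  by rewrite (nth_map 0%N) ?size_iota // nth_iota // in_std_cover_set.
rewrite nth_nseq if_same in_fset0; apply/negbTE; rewrite -leqNgt.
exact: leq_trans (mult_max_ge _ _) km.
Qed.

(** * The tensor product of sums of Orlik blocks *)

Lemma presented_blocks (s : seq {fset nat}) :
  (forall M, M \in s -> 0%N \notin M) ->
  presented (zbigsum (map block s)) [seq cyclo_prod M | M <- s].
Proof.
elim: s => [|M s IHs] s0 /=; first exact: presented_zzero.
apply: presented_zsum; first by apply: presented_block; exact/s0/mem_head.
by apply: IHs => M' Ms; apply: s0; rewrite inE Ms orbT.
Qed.

Lemma zbigsum_flatten_blocks (I : eqType) (s : seq I) (F : I -> zmodEnd)
    (g : I -> seq {fset nat}) :
  (forall i, i \in s -> zmodEnd_iso (F i) (zbigsum (map block (g i)))) ->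
  zmodEnd_iso (zbigsum (map F s)) (zbigsum (map block (flatten (map g s)))).
Proof.
elim: s => [|i s IHs] H /=; first exact: zmodEnd_iso_refl.
rewrite map_cat; apply: zmodEnd_iso_trans (zbigsum_cat _ _).
apply: zsum_iso; first exact/H/mem_head.
by apply: IHs => j js; apply: H; rewrite inE js orbT.
Qed.

Lemma std_cover_count (chi : mult_fun) m :
  (\sum_(M <- std_cover chi) nat_of_bool (m \in M))%N = chi m.
Proof.
rewrite big_map.
have -> : (\sum_(j <- iota 1 (mult_max chi))
    nat_of_bool (m \in std_cover_set chi j)
  = \sum_(j <- iota 1 (mult_max chi)) nat_of_bool (j <= chi m))%N.
  apply: eq_big_seq => j; rewrite mem_iota => /andP[j0 _].
  by rewrite in_std_cover_set.
have := mult_max_ge chi m; move: (chi m) (mult_max chi) => x n xn.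
rewrite -(subnKC xn) iotaD big_cat /= [X in (X + _)%N]big_seq.
rewrite [X in (_ + X)%N]big_seq [X in (_ + X)%N]big1 => [|j].
  rewrite addn0 (eq_bigr (fun=> 1%N)) => [|j]; last first.
    by rewrite mem_iota => /andP[_]; rewrite add1n ltnS => ->.
  by rewrite -big_seq sum1_size size_iota.
by rewrite mem_iota add1n => /andP[]; rewrite ltnNge => /negbTE ->.
Qed.

Section SumsOfBlocks.
Variables (N0 : nat) (zeta : algC).
Notation N := N0.+1.
Notation G := 'I_N0.+1.
Hypothesis zetaP : N.-primitive_root zeta.
Variables (b1 b2 : nat -> nat -> bool).

(** Where the multiplicity may grow with the exponent of p, the group Z / N must
    be large enough to see the growth. *)
Hypothesis NP : forall p r, prime p -> (0 < r)%N -> b1 p r (+) b2 p r ->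
  (p ^ r %| N)%N.

Let b p r := b1 p r (+) b2 p r.

Lemma tensor_blocks (A B : {fset nat}) :
  A != fset0 -> B != fset0 ->
  (forall l, l \in A -> (l %| N)%N) -> (forall l, l \in B -> (l %| N)%N) ->
  aligned b1 A -> aligned b2 B ->
  exists s : seq {fset nat},
  [/\ zmodEnd_iso (ztens (Or A) (Or B)) (zbigsum (map block s)),
      all_aligned b s,
      forall c : G, cover_count (zord c) s = pconv A B c
    & forall m, ~~ (m %| N)%N -> cover_count m s = 0%N].
Proof.
move=> A0 B0 AN BN [_ mA] [_ mB].
have [chi chiE] := conv_class_fun zetaP (fun l => nat_of_bool (l \in A))
  (fun l => nat_of_bool (l \in B)).
have {}chiE (c : G) : pconv A B c = chi (zord c) by exact: chiE.
pose L k : {fset nat} := [fset l in divisors N | (k < chi l)%N]%fset.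
have inL k l : (l \in L k) = (l %| N)%N && (k < chi l)%N.
  by rewrite !inE /= dvdn_divisors.
have lE (c : G) : (pconv A B c <= N)%N.
  apply: (@leq_trans (\sum_(i : G) 1)%N); last by rewrite sum1_card card_ord.
  apply: leq_sum => i _.
  by do 2 case: (_ \in _).
have cE s m : cover_count m (map L s)
    = if (m %| N)%N then (\sum_(j <- s) nat_of_bool (j < chi m)%N)%N else 0%N.
  rewrite count_map -sum1_count big_mkcond /=.
  case: ifP => mN; [apply: eq_bigr => j _ | apply: big1 => j _];
    by rewrite inL mN //=; case: ifP.
exists [seq L k | k <- iota 0 N]; split.
- apply: (@presented_iso _ _ [seq cyclo_prod (L k) | k <- iota 0 N]).
    apply: (tensor_presented zetaP AN BN A0 B0 mA mB) => //.
      by move=> k m; rewrite inL => /andP[].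
    by move=> k c; rewrite inL zord_dvd chiE.
  rewrite (map_comp cyclo_prod L); apply: presented_blocks => M /mapP[k _ ->].
  by rewrite inL dvd0n.
- move=> M /mapP[k _ ->]; split; first by rewrite inL dvd0n.
  move=> p r pp r0 u l u0 pu lr; rewrite !inL.
  have [urN|urN] := boolP (u * p ^ r %| N)%N; last first.
    rewrite /=; case: ifP => // brp.
    have [ulN|ulN] := boolP (u * p ^ l %| N)%N => //=.
    case/negP: urN; rewrite Gauss_dvd ?NP // ?andbT.
      exact: dvdn_trans (dvdn_mulr _ _) ulN.
    by rewrite coprimeXr // coprime_sym prime_coprime.
  have ulN : (u * p ^ l %| N)%N.
    by apply: dvdn_trans urN; rewrite dvdn_mul // dvdn_exp2l // ltnW.
  have [c Ec] := zord_surj ulN.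
  have [d Ed] := zord_surj (dvdn_trans (dvdn_mull _ (dvdnn _)) urN).
  have [Ecd] := mono_conv_le pp r0 Ed (mA p r pp r0) (mB p r pp r0) u0 pu lr Ec.
  rewrite -[conv _ _ c]/(pconv A B c) -[conv _ _ (c + d)]/(pconv A B (c + d)).
  rewrite !chiE Ec Ecd ulN /= /b.
  by case: (_ (+) _) => le; case: ltnP => // lt; rewrite (leq_trans lt le).
- move=> c; rewrite cE zord_dvd chiE; have := lE c; rewrite chiE.
  move: (chi (zord c)) (N) => x n xn.
  rewrite -(subnKC xn) iotaD big_cat /= [X in (X + _)%N]big_seq.
  rewrite [X in (_ + X)%N]big_seq [X in (_ + X)%N]big1 => [|j].
    rewrite addn0 (eq_bigr (fun=> 1%N)) => [|j]; last first.
      by rewrite mem_iota => /andP[_]; rewrite add0n => ->.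
    by rewrite -big_seq sum1_size size_iota.
  by rewrite mem_iota add0n => /andP[]; rewrite leqNgt => /negbTE ->.
by move=> m mN; rewrite cE (negbTE mN).
Qed.

Variables (chi1 chi2 chi3 : mult_fun).
Hypotheses (N1 : forall m, m \in finsupp chi1 -> (m %| N)%N)
           (N2 : forall m, m \in finsupp chi2 -> (m %| N)%N)
           (N3 : forall m, m \in finsupp chi3 -> (m %| N)%N).
Hypothesis m1 : forall p r, prime p -> (0 < r)%N ->
  exponent_mono chi1 p r (b1 p r).
Hypothesis m2 : forall p r, prime p -> (0 < r)%N ->
  exponent_mono chi2 p r (b2 p r).
Hypothesis chi3E : forall c : G,
  conv (fun i : G => chi1 (zord i)) (fun i : G => chi2 (zord i)) c
  = chi3 (zord c).

Lemma std_cover_props (chi : mult_fun) bb (M : {fset nat}) :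
  (forall m, m \in finsupp chi -> (m %| N)%N) ->
  (forall p r, prime p -> (0 < r)%N -> exponent_mono chi p r (bb p r)) ->
  M \in std_cover chi ->
  [/\ M != fset0, forall l, l \in M -> (l %| N)%N & aligned bb M].
Proof.
move=> chiN mchi /mapP[j]; rewrite mem_iota add1n ltnS => jP ->.
have j0 : (0 < j)%N by case/andP: jP.
have MN l : l \in std_cover_set chi j -> (l %| N)%N.
  by rewrite !inE /= => /andP[ls _]; exact: chiN.
split=> //; first exact: std_cover_set_neq0.
split; first by apply/negP => /MN; rewrite dvd0n.
move=> p r pp r0 u l u0 pu lr; have := mchi p r pp r0 u l u0 pu lr.
rewrite !in_std_cover_set //.
have imp (x y : bool) : (x -> y) -> (x <= y)%N.
  by case: x; case: y => // /(_ isT).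
by case: (bb p r) => le; apply: imp => /leq_trans; apply.
Qed.

(** All blocks of all products of pairs are aligned with the same orders, and
    their multiplicities add up to chi3, as the indicator functions of the
    standard coverings add up to chi1 and chi2. *)
Lemma tensor_std_cover :
  zmodEnd_iso
    (ztens (zbigsum [seq Or M | M <- std_cover chi1])
           (zbigsum [seq Or M | M <- std_cover chi2]))
    (zbigsum [seq Or M | M <- std_cover chi3]).
Proof.
apply: zmodEnd_iso_trans (ztens_zbigsum _ _) _.
rewrite allpairs_mapl allpairs_mapr.
pose F (u : {fset nat} * {fset nat}) := ztens (Or u.1) (Or u.2).
pose S := [seq (M, M') | M <- std_cover chi1, M' <- std_cover chi2].
have -> : [seq ztens (Or M) (Or M') | M <- std_cover chi1, M' <- std_cover chi2]
    = map F S by rewrite /S map_allpairs.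
have /choice[g gP] : forall u, exists s, u \in S ->
    [/\ zmodEnd_iso (F u) (zbigsum (map block s)),
        all_aligned b s,
        forall c : G, cover_count (zord c) s = pconv u.1 u.2 c
      & forall m, ~~ (m %| N)%N -> cover_count m s = 0%N].
  move=> u.
  have [uS|uS] := boolP (u \in S); last by exists [::] => /negP.
  case/allpairsP: (uS) => -[M M'] /= [MS MS' Eu].
  have [M0 MN aM] := std_cover_props N1 m1 MS.
  have [M'0 M'N aM'] := std_cover_props N2 m2 MS'.
  have [s sP] := tensor_blocks M0 M'0 MN M'N aM aM'.
  by exists s => _; rewrite Eu.
apply: zmodEnd_iso_trans (zbigsum_flatten_blocks (fun u uS => let:
  And4 h _ _ _ := gP u uS in h)) _.
have countE m : cover_count m (flatten (map g S))
    = (\sum_(u <- S) cover_count m (g u))%N.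
  by rewrite count_flatten -map_comp sumnE big_map.
apply: (@blocks_std_cover b).
  move=> A /flattenP[s /mapP[u uS ->] As].
  by have [_ + _ _] := gP u uS; apply.
move=> m; rewrite countE; have [mN|mN] := boolP (m %| N)%N; last first.
  rewrite big_seq big1 => [|u uS]; last by have [_ _ _ ->] := gP u uS.
  by apply/esym/fsfun_dflt; apply: contra mN; exact: N3.
have [c <-] := zord_surj mN; rewrite -chi3E.
rewrite (eq_big_seq (fun u => pconv u.1 u.2 c)) => [|u uS]; last first.
  by have [_ _ -> _] := gP u uS.
rewrite /S big_allpairs /= /pconv /conv.
under eq_bigr => M _ do rewrite exchange_big /=.
rewrite exchange_big /=; apply: eq_bigr => i _.
under eq_bigr => M _ do rewrite -big_distrr /=.
by rewrite -big_distrl /= !std_cover_count.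
Qed.

End SumsOfBlocks.

(** * The multiplicities of the tensor product *)

Lemma common_multiple (s : seq nat) : (forall m, m \in s -> (0 < m)%N) ->
  exists N0, forall m, m \in s -> (m %| N0.+1)%N.
Proof.
move=> s0; have P0 : (0 < \prod_(m <- s) m)%N.
  by rewrite big_seq; apply: prodn_cond_gt0 => m; exact: s0.
exists (\prod_(m <- s) m)%N.-1 => m ms.
by rewrite prednK // (big_rem m) //= dvdn_mulr.
Qed.

Lemma pos_supp_gt0 (chi : mult_fun) m :
  pos_supp chi -> m \in finsupp chi -> (0 < m)%N.
Proof. by case: m => // c0 mc; case/negP: c0. Qed.

Section Otimes.
Variables (N0 : nat) (zeta : algC).
Notation N := N0.+1.
Notation G := 'I_N0.+1.
Hypothesis zetaP : N.-primitive_root zeta.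
Notation zr := (@zr N0 zeta).
Notation pZtoC := (map_poly (intr : int -> algC)).

Definition mpol (f : G -> nat) : {poly algC} := \prod_i ('X - (zr i)%:P) ^+ f i.

Lemma mult_poly_mpol (chi : mult_fun) :
  (forall m, m \in finsupp chi -> (m %| N)%N) ->
  pZtoC (mult_poly chi) = mpol (fun i => chi (zord i)).
Proof.
move=> chiN; rewrite /mult_poly.
rewrite (prod_Cyclotomic_roots zetaP chi (fset_uniq _) chiN) big_mkcond /=.
apply: eq_bigr => i _; case: ifP => // /negbT/fsfun_dflt ->.
by rewrite expr0.
Qed.

Definition mroots (f : G -> nat) : seq algC :=
  flatten [seq nseq (f i) (zr i) | i <- index_enum G].

Lemma prod_mroots (f : G -> nat) (R : comNzRingType) (F : algC -> R) :
  \prod_(x <- mroots f) F x = \prod_i F (zr i) ^+ f i.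
Proof.
rewrite /mroots big_flatten /= big_map; apply: eq_bigr => i _.
by rewrite big_nseq -Monoid.iteropE.
Qed.

Lemma prod_mroots_XsubC (f : G -> nat) :
  \prod_(x <- mroots f) ('X - x%:P) = mpol f.
Proof. exact: prod_mroots. Qed.

Lemma count_mroots (f : G -> nat) c : count_mem (zr c) (mroots f) = f c.
Proof.
rewrite /mroots count_flatten -map_comp sumnE big_map (bigD1 c) //= big1.
  by rewrite count_nseq /= eqxx mul1n addn0.
move=> i ic; rewrite count_nseq /=; case: eqP => [/(zr_inj zetaP) E|//].
by rewrite E eqxx in ic.
Qed.

Lemma mpol_inj (f g : G -> nat) : mpol f = mpol g -> f =1 g.
Proof.
rewrite -!prod_mroots_XsubC => /prod_XsubC_eq E c.
by rewrite -!count_mroots; exact: (seq.permP E).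
Qed.

Lemma croots_mpol (f : G -> nat) : perm_eq (croots (mpol f)) (mroots f).
Proof.
rewrite /croots; case: (closed_field_poly_normal _) => r /= E.
apply: prod_XsubC_eq; rewrite prod_mroots_XsubC [RHS]E.
have /monicP -> : mpol f \is monic.
  by apply: monic_prod => i _; apply: monic_exp; exact: monicXsubC.
by rewrite scale1r.
Qed.

Lemma poly_otimes_mpol (f g : G -> nat) :
  poly_otimes (mpol f) (mpol g) = mpol (conv f g).
Proof.
rewrite /poly_otimes (perm_big _ (croots_mpol f)) /=.
rewrite (prod_mroots f (fun x => \prod_(y <- croots (mpol g)) ('X - (x *
  y)%:P))).
transitivity (\prod_i \prod_j ('X - (zr (i + j))%:P) ^+ (f i * g j)%N).
  apply: eq_bigr => i _; rewrite (perm_big _ (croots_mpol g)) /=.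
  rewrite (prod_mroots g (fun y => 'X - (zr i * y)%:P)) -prodrXl.
  by apply: eq_bigr => j _; rewrite -exprM mulnC (zrD zetaP).
transitivity (\prod_i \prod_c ('X - (zr c)%:P) ^+ (f i * g (c - i)%R)%N).
  apply: eq_bigr => i _; rewrite [RHS](reindex_inj (addrI i)) /=.
  by apply: eq_bigr => j _; rewrite (addrC i) addrK.
rewrite exchange_big /=; apply: eq_bigr => c _.
by rewrite prodrXr.
Qed.

Lemma mult_otimesP (chi1 chi2 chi3 : mult_fun) :
  (forall m, m \in finsupp chi1 -> (m %| N)%N) ->
  (forall m, m \in finsupp chi2 -> (m %| N)%N) ->
  (forall m, m \in finsupp chi3 -> (m %| N)%N) ->
  mult_otimes chi1 chi2 chi3 <->
  forall c, conv (fun i : G => chi1 (zord i)) (fun i : G => chi2 (zord i)) c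
    = chi3 (zord c).
Proof.
move=> N1 N2 N3; rewrite /mult_otimes !mult_poly_mpol // poly_otimes_mpol.
by split=> [/mpol_inj|E] //; apply: eq_bigr => c _; rewrite E.
Qed.

End Otimes.

(** The convolution is constant on elements of equal order, so it comes from a
    function on the divisors of N. *)
Lemma mult_otimes_ex (chi1 chi2 : mult_fun) : pos_supp chi1 -> pos_supp chi2 ->
  exists chi3 : mult_fun, pos_supp chi3 /\ mult_otimes chi1 chi2 chi3.
Proof.
move=> p1 p2; have [|N0 NP] := @common_multiple (finsupp chi1 ++ finsupp chi2).
  by move=> m; rewrite mem_cat => /orP[]; exact: pos_supp_gt0.
have [zeta zetaP] := C_prim_root_exists (ltn0Sn N0).
have [chi chiE] := conv_class_fun zetaP chi1 chi2.
pose S : {fset nat} := [fset l in divisors N0.+1]%fset.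
have inS l : (l \in S) = (l %| N0.+1)%N by rewrite !inE /= dvdn_divisors.
pose chi3 : mult_fun := [fsfun l in S => chi l | 0%N].
have chi3N m : m \in finsupp chi3 -> (m %| N0.+1)%N.
  rewrite mem_finsupp fsfunE; case: ifP => [+ _|_]; last by rewrite eqxx.
  by rewrite inS.
exists chi3; split; first by apply/negP => /chi3N; rewrite dvd0n.
apply/(mult_otimesP zetaP) => //.
- by move=> m m1; apply: NP; rewrite mem_cat m1.
- by move=> m m2; apply: NP; rewrite mem_cat m2 orbT.
by move=> c; rewrite chiE /chi3 fsfunE inS zord_dvd.
Qed.

(** Both candidates are the convolution, on a group Z / N large enough for the
    supports of both. *)
Lemma mult_otimes_uniq (chi1 chi2 chi3 chi3' : mult_fun) :
  pos_supp chi1 -> pos_supp chi2 -> pos_supp chi3 -> pos_supp chi3' ->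
  mult_otimes chi1 chi2 chi3 -> mult_otimes chi1 chi2 chi3' -> chi3 = chi3'.
Proof.
move=> p1 p2 p3 p3' E E'.
have [|N0 NP] := @common_multiple
    (finsupp chi1 ++ finsupp chi2 ++ finsupp chi3 ++ finsupp chi3').
  by move=> m; rewrite !mem_cat => /or4P[]; exact: pos_supp_gt0.
have [zeta zetaP] := C_prim_root_exists (ltn0Sn N0).
have N1 m : m \in finsupp chi1 -> (m %| N0.+1)%N.
  by move=> mi; apply: NP; rewrite !mem_cat mi.
have N2 m : m \in finsupp chi2 -> (m %| N0.+1)%N.
  by move=> mi; apply: NP; rewrite !mem_cat mi orbT.
have N3 m : m \in finsupp chi3 -> (m %| N0.+1)%N.
  by move=> mi; apply: NP; rewrite !mem_cat mi !orbT.
have N3' m : m \in finsupp chi3' -> (m %| N0.+1)%N.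
  by move=> mi; apply: NP; rewrite !mem_cat mi !orbT.
have {}E := proj1 (mult_otimesP zetaP N1 N2 N3) E.
have {}E' := proj1 (mult_otimesP zetaP N1 N2 N3') E'.
apply/fsfunP => l; have [lN|lN] := boolP (l %| N0.+1)%N.
  by have [c <-] := zord_surj lN; rewrite -E -E'.
rewrite !fsfun_dflt //; first by apply: contra lN; exact: N3'.
by apply: contra lN; exact: N3.
Qed.

(** * Excellent orders and compatibility *)

(** If l is not in S, then r and l are compared by way of 0. *)
Lemma exc_gt_S (o : excOrder) r l : (l < r)%N -> exc_S o r -> exc_gt o r l.
Proof.
move=> lr Sr; have /andP[rs _] := exc_dom Sr.
have ls : (l <= exc_s o)%N := leq_trans (ltnW lr) rs.
have [l0|l0] := eqVneq l 0%N; first by rewrite l0.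
have [Sl|Sl] := boolP (exc_gt o l 0).
  by rewrite exc_up //; apply/orP; right.
have := exc_total ls (leq0n _) l0; rewrite (negbTE Sl) /=.
by apply: exc_trans.
Qed.

Lemma exc_gt_notS (o : excOrder) r l : (r <= exc_s o)%N -> (l < r)%N ->
  ~~ exc_S o r -> exc_gt o l r.
Proof.
move=> rs lr Sr; have ls : (l <= exc_s o)%N := leq_trans (ltnW lr) rs.
have r0 : r != 0%N by rewrite -lt0n (leq_ltn_trans (leq0n l)).
have g0r : exc_gt o 0 r.
  by have := exc_total rs (leq0n _) r0; rewrite -/(exc_S o r) (negbTE Sr).
have [Sl|Sl] := boolP (exc_gt o l 0); first exact: exc_trans Sl g0r.
by rewrite exc_down.
Qed.

Section Compat.
Variables (P : {fset nat}) (o : nat -> excOrder).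
Hypothesis Pp : forall p, p \in P -> prime p.

Lemma inV_gt0 m : inV P o m -> (0 < m)%N.
Proof.
move=> [k _ ->]; rewrite big_seq prodn_cond_gt0 // => p pP.
by rewrite expn_gt0 prime_gt0 ?Pp.
Qed.

(** V is a product: the exponent of one prime can be changed at will. *)
Lemma inV_change p u l : p \in P -> (0 < u)%N -> ~~ (p %| u)%N ->
  inV P o (u * p ^ l)%N -> (l <= exc_s (o p))%N /\
  forall r, (r <= exc_s (o p))%N -> inV P o (u * p ^ r)%N.
Proof.
move=> pP u0 pu [k ks E]; have pp := Pp pP.
pose W := (\prod_(q <- P | q != p) q ^ k q)%N.
have EW (k' : nat -> nat) : (forall q, q != p -> k' q = k q) ->
    (\prod_(q <- P) q ^ k' q = W * p ^ k' p)%N.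
  move=> kk; rewrite (bigD1_seq p) ?fset_uniq //= mulnC; congr (_ * _)%N.
  by apply: eq_bigr => q /kk ->.
have W0 : (0 < W)%N.
  by rewrite /W big_seq_cond prodn_cond_gt0 // => q /andP[/Pp/prime_gt0 q0 _];
    rewrite expn_gt0 q0.
have pW : ~~ (p %| W)%N.
  rewrite /W big_seq_cond; apply: (big_ind (fun x => ~~ (p %| x)%N)).
  - by rewrite dvdn1 neq_ltn prime_gt1 // orbT.
  - by move=> x y px py; rewrite Euclid_dvdM // negb_or px.
  move=> q /andP[qP qp]; apply: contra qp; rewrite Euclid_dvdX // => /andP[].
  by rewrite dvdn_prime2 ?Pp // eq_sym.
rewrite (EW k) // in E.
have El : l = k p by rewrite -(logn_coprime_pow l pp u0 pu) E logn_coprime_pow.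
have Eu : u = W.
  apply/eqP; move/eqP: E; rewrite El eqn_pmul2r //.
  by rewrite expn_gt0 prime_gt0.
split=> [|r rs]; first by rewrite El ks.
exists (fun q => if q == p then r else k q).
  by move=> q qP; case: eqP => [->//|_]; exact: ks.
by rewrite EW ?eqxx ?Eu // => q /negbTE ->.
Qed.

Lemma pi_part_coprime p u l : prime p -> (0 < u)%N -> ~~ (p %| u)%N ->
  pi_part p (u * p ^ l)%N = u.
Proof.
move=> pp u0 pu; rewrite /pi_part logn_coprime_pow // mulnK //.
by rewrite expn_gt0 prime_gt0.
Qed.

(** Compatibility with an excellent order only compares an exponent r with the
    smaller ones, according to whether r lies in S. *)
Lemma compatible_mono (chi : mult_fun) : compatible P o chi ->
  forall p r, prime p -> (0 < r)%N ->
  exponent_mono chi p r ((p \in P) && exc_S (o p) r).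
Proof.
move=> [cov sV mE] p r pp r0 u l u0 pu lr.
have inP m : (p %| m)%N -> p \notin P -> chi m = 0%N.
  by move=> pm; have [ms|/fsfun_dflt //] := boolP (m \in finsupp chi);
    rewrite (cov m p ms pp pm).
have edge k k' : p \in P -> exc_gt (o p) k k' ->
    inV P o (u * p ^ k) -> inV P o (u * p ^ k') ->
    (chi (u * p ^ k')%N <= chi (u * p ^ k)%N)%N.
  move=> pP gk Vk Vk'; apply: mE; split=> //; exists p => //.
  by rewrite !pi_part_coprime ?logn_coprime_pow.
have [pP|pP] /= := boolP (p \in P); last first.
  by rewrite (inP (u * p ^ r)%N) // dvdn_mull // dvdn_exp.
case: ifP => [Sr|/negbT Sr].
  have [ms|/fsfun_dflt ->//] := boolP ((u * p ^ l)%N \in finsupp chi).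
  have [ls V] := inV_change pP u0 pu (sV _ ms).
  have /andP[rs _] := exc_dom Sr.
  by apply: edge => //; [exact: exc_gt_S | exact: V | exact: V].
have [ms|/fsfun_dflt ->//] := boolP ((u * p ^ r)%N \in finsupp chi).
have [rs V] := inV_change pP u0 pu (sV _ ms).
apply: edge => //; [exact: exc_gt_notS | apply: V | exact: V].
exact: leq_trans (ltnW lr) rs.
Qed.

Lemma inV_logn m p : p \in P -> inV P o m -> (logn p m <= exc_s (o p))%N.
Proof.
move=> pP V; have pp := Pp pP; have m0 := inV_gt0 V.
have [u pu Eu] := pfactor_coprime pp m0.
have u0 : (0 < u)%N by move: m0; rewrite {1}Eu muln_gt0 => /andP[].
rewrite prime_coprime // in pu.
by rewrite Eu in V; have [] := inV_change pP u0 pu V.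
Qed.

Lemma inV_of_logn m : (0 < m)%N ->
  (forall p, prime p -> (p %| m)%N -> p \in P) ->
  (forall p, p \in P -> (logn p m <= exc_s (o p))%N) -> inV P o m.
Proof.
move=> m0 mP mlog; exists (fun p => logn p m) => //.
have prod0 : (0 < \prod_(p <- P) p ^ logn p m)%N.
  by rewrite big_seq prodn_cond_gt0 // => p pP; rewrite expn_gt0 prime_gt0 ?Pp.
apply: (eqn_from_log m0 prod0) => p.
have [pp|npp] := boolP (prime p); last by rewrite [LHS]lognE [RHS]lognE (negbTE
  npp).
have lprod : logn p (\prod_(q <- P) q ^ logn q m)
    = (\sum_(q <- P) logn p (q ^ logn q m))%N.
  rewrite big_seq [RHS]big_seq.
  apply: (@proj2 (0 < \prod_(q <- P | q \in P) q ^ logn q m)%N).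
  apply: (big_ind2 (fun x y => (0 < x)%N /\ logn p x = y)).
  - by rewrite logn1.
  - move=> x1 y1 x2 y2 [x10 <-] [x20 <-].
    by rewrite muln_gt0 x10 x20 lognM.
  by move=> q qP; rewrite expn_gt0 prime_gt0 ?Pp.
rewrite lprod; have other q : q \in P -> q != p -> logn p (q ^ logn q m) = 0%N.
  by move=> qP qp; rewrite lognX (logn_prime _ (Pp qP)) eq_sym (negbTE qp)
    muln0.
have [pP|pP] := boolP (p \in P).
  rewrite (bigD1_seq p) ?fset_uniq //= pfactorK // big_seq_cond big1 ?addn0 //.
  by move=> q /andP[]; exact: other.
rewrite big_seq big1 => [|q qP].
  rewrite lognE pp m0 /=; case: ifP => // pm.
  by rewrite (mP p pp pm) in pP.
by apply: other => //; apply: contraNneq pP => <-.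
Qed.

End Compat.

(** * Compatibility of the tensor product *)

Section TensorCompat.
Variables (P : {fset nat}) (oM oN : nat -> excOrder).
Hypothesis Pp : forall p, p \in P -> prime p.
Variables (chi1 chi2 chi3 : mult_fun).
Hypotheses (p1 : pos_supp chi1) (p2 : pos_supp chi2) (p3 : pos_supp chi3).
Hypotheses (c1 : compatible P oM chi1) (c2 : compatible P oN chi2).
Hypothesis chi3E : mult_otimes chi1 chi2 chi3.

Let b1 p r := (p \in P) && exc_S (oM p) r.
Let b2 p r := (p \in P) && exc_S (oN p) r.
Let m1 : forall p r, prime p -> (0 < r)%N -> exponent_mono chi1 p r (b1 p r).
Proof. exact: compatible_mono. Qed.
Let m2 : forall p r, prime p -> (0 < r)%N -> exponent_mono chi2 p r (b2 p r).
Proof. exact: compatible_mono. Qed.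

Notation oL := (fun p => exc_tens (oM p) (oN p)).

Lemma common_level (s : seq nat) : (forall m, m \in s -> (0 < m)%N) ->
  exists N0, exists2 zeta : algC, N0.+1.-primitive_root zeta &
  [/\ forall m, m \in s -> (m %| N0.+1)%N,
      forall m, m \in finsupp chi1 -> (m %| N0.+1)%N,
      forall m, m \in finsupp chi2 -> (m %| N0.+1)%N,
      forall m, m \in finsupp chi3 -> (m %| N0.+1)%N
    & forall c : 'I_N0.+1, conv (fun i : 'I_N0.+1 => chi1 (zord i))
        (fun i : 'I_N0.+1 => chi2 (zord i)) c = chi3 (zord c)].
Proof.
move=> s0; have [|N0 NP] := @common_multiple
    (s ++ finsupp chi1 ++ finsupp chi2 ++ finsupp chi3).
  by move=> m; rewrite !mem_cat => /or4P[/s0//|||]; exact: pos_supp_gt0.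
have [zeta zetaP] := C_prim_root_exists (ltn0Sn N0).
have N1 m : m \in finsupp chi1 -> (m %| N0.+1)%N.
  by move=> mi; apply: NP; rewrite !mem_cat mi !orbT.
have N2 m : m \in finsupp chi2 -> (m %| N0.+1)%N.
  by move=> mi; apply: NP; rewrite !mem_cat mi !orbT.
have N3 m : m \in finsupp chi3 -> (m %| N0.+1)%N.
  by move=> mi; apply: NP; rewrite !mem_cat mi !orbT.
exists N0, zeta => //; split=> //; last exact/(mult_otimesP zetaP N1 N2 N3).
by move=> m ms; apply: NP; rewrite mem_cat ms.
Qed.

(** The order of a product of roots of unity divides the least common multiple of
    their orders. *)
Lemma tensor_supp m : m \in finsupp chi3 -> exists a b,
  [/\ a \in finsupp chi1, b \in finsupp chi2 & (m %| lcmn a b)%N].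
Proof.
have [|N0 [zeta zetaP [_ N1 N2 N3 E]]] := @common_level [::] => // ms.
have [c Ec] := zord_surj (N3 m ms).
have : chi3 m != 0%N by rewrite -mem_finsupp.
rewrite -Ec -E /conv sum_nat_eq0 negb_forall => /existsP[i].
rewrite muln_eq0 negb_or => /andP[i1 i2].
exists (zord i), (zord (c - i)); rewrite !mem_finsupp i1 i2; split=> //.
by have := zordD i (c - i); rewrite addrC subrK Ec.
Qed.

(** The larger of the two exponents lies in S if it is also the larger one for the
    excellent order, and does not lie in S otherwise. *)
Lemma tensor_edge p u k k' : p \in P -> (0 < u)%N -> ~~ (p %| u)%N ->
  exc_gt (oL p) k k' -> (chi3 (u * p ^ k') <= chi3 (u * p ^ k))%N.
Proof.
move=> pP u0 pu gk; have pp := Pp pP.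
have pos e : (0 < u * p ^ e)%N by rewrite muln_gt0 u0 expn_gt0 prime_gt0.
have [|N0 [zeta zetaP [NP _ _ _ E]]] :=
    @common_level [:: (u * p ^ k)%N; (u * p ^ k')%N].
  by move=> m; rewrite !inE => /orP[] /eqP ->.
have Sb r : b1 p r (+) b2 p r = exc_S (oL p) r by rewrite exc_tens_SE /b1 /b2
  pP.
have key l r : (l < r)%N -> (u * p ^ l)%N \in [:: (u * p ^ k)%N;
  (u * p ^ k')%N] ->
    (u * p ^ r)%N \in [:: (u * p ^ k)%N; (u * p ^ k')%N] ->
    if exc_S (oL p) r then (chi3 (u * p ^ l) <= chi3 (u * p ^ r))%N
    else (chi3 (u * p ^ r) <= chi3 (u * p ^ l))%N.
  move=> lr /NP lN /NP rN; have r0 : (0 < r)%N by exact: leq_ltn_trans lr.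
  have [c Ec] := zord_surj lN.
  have [d Ed] := zord_surj (dvdn_trans (dvdn_mull _ (dvdnn _)) rN).
  have [Ecd] := mono_conv_le pp r0 Ed (m1 pp r0) (m2 pp r0) u0 pu lr Ec.
  by rewrite Sb !E Ec Ecd.
have : [&& (k <= exc_s (oL p))%N, (k' <= exc_s (oL p))%N
  & if exc_S (oL p) k then ~~ exc_S (oL p) k' || (k > k')%N
    else ~~ exc_S (oL p) k' && (k < k')%N].
  by rewrite !exc_tens_SE.
case/and3P => _ _; case: (ltngtP k k') => [lt|gt|E'].
- rewrite orbF andbT if_same => /negbTE nS.
  by have := key k k' lt; rewrite nS !inE !eqxx orbT; apply.
- rewrite orbT andbF => Sk.
  have := key k' k gt; rewrite !inE !eqxx orbT.
  by case: (exc_S _ k) Sk => // _; apply.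
by move: gk; rewrite E' exc_irr.
Qed.

Lemma tensor_compatible : compatible P oL chi3.
Proof.
have [cov1 V1 _] := c1; have [cov2 V2 _] := c2.
have primesP m p : m \in finsupp chi3 -> prime p -> (p %| m)%N -> p \in P.
  move=> /tensor_supp[a [b [a1 b2' mab]]] pp pm.
  have : (p %| a * b)%N.
    apply: dvdn_trans (dvdn_trans pm mab) _.
    by rewrite dvdn_lcm dvdn_mulr // dvdn_mull.
  by rewrite Euclid_dvdM // => /orP[]; [exact: cov1 | exact: cov2].
split=> [|m ms|ma mb [Va Vb [p pP [Epi gk]]]]; first by move=> m p; exact:
  primesP.
  apply: inV_of_logn => //; first exact: pos_supp_gt0 ms.
    by move=> p; exact: primesP.
  move=> p pP; have [a [b [a1 b2' mab]]] := tensor_supp ms.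
  have a0 := pos_supp_gt0 p1 a1; have b0 := pos_supp_gt0 p2 b2'.
  apply: leq_trans (dvdn_leq_log p _ mab) _; first by rewrite lcmn_gt0 a0.
  rewrite exc_tens_sE logn_lcm // geq_max !leq_max.
  by rewrite (inV_logn Pp pP (V1 _ a1)) (inV_logn Pp pP (V2 _ b2')) orbT.
have pp := Pp pP; have a0 := inV_gt0 Pp Va; have b0 := inV_gt0 Pp Vb.
have decomp m : (0 < m)%N ->
    [/\ m = (pi_part p m * p ^ logn p m)%N, (0 < pi_part p m)%N
      & ~~ (p %| pi_part p m)%N].
  move=> m0; have [u pu Eu] := pfactor_coprime pp m0.
  have u0 : (0 < u)%N by move: m0; rewrite {1}Eu muln_gt0 => /andP[].
  have -> : pi_part p m = u.
    by rewrite /pi_part {1}Eu mulnK // expn_gt0 prime_gt0.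
  by rewrite -prime_coprime.
have [Ea u0 pu] := decomp ma a0; have [Eb _ _] := decomp mb b0.
by rewrite Ea Eb -Epi; apply: tensor_edge.
Qed.

Lemma tensor_iso :
  zmodEnd_iso
    (ztens (zbigsum [seq Or M | M <- std_cover chi1])
           (zbigsum [seq Or M | M <- std_cover chi2]))
    (zbigsum [seq Or M | M <- std_cover chi3]).
Proof.
pose mx p := maxn (exc_s (oM p)) (exc_s (oN p)).
have [|N0 [zeta zetaP [NP N1 N2 N3 E]]] :=
    @common_level [seq (p ^ mx p)%N | p <- P].
  by move=> m /mapP[p pP ->]; rewrite expn_gt0 prime_gt0 ?Pp.
apply: (tensor_std_cover zetaP _ N1 N2 N3 m1 m2 E) => p r pp r0.
rewrite /b1 /b2; case: (boolP (p \in P)) => //= pP S.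
apply: (@dvdn_trans (p ^ mx p)%N); last by apply: NP; exact: map_f.
apply: dvdn_exp2l; exact: (@exc_tens_Ss (oM p) (oN p)).
Qed.

End TensorCompat.

(** * Standard decompositions *)

Definition cyclic_by (Z : zmodEnd) (v : Z) (p : {poly int}) : Prop :=
  (forall x, exists q, x = pact q v) /\
  (forall q, pact q v = 0 <-> exists r, q = r * p).

Section Cyclic.
Variables (Z : zmodEnd) (v : Z) (p : {poly int}).
Hypotheses (mp : p \is monic) (p1 : (1 < size p)%N) (vP : cyclic_by v p).

Notation n := (size p).-1.

(** Division with remainder by the monic p. *)
Lemma cyclic_basis : zbasis (fun j : 'I_n => iter j (zact Z) v).
Proof.
pose pc (c : {ffun 'I_n -> int}) : {poly int} := \sum_(i < n) c i *: 'X^i.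
have E (c : {ffun 'I_n -> int}) : \sum_(i < n) iter i (zact Z) v *~ c i
    = pact (pc c) v.
  by rewrite /pc pact_suml; apply: eq_bigr => i _;
    rewrite -mul_polyC pactM pactXn pactC.
have S (c : {ffun 'I_n -> int}) : (size (pc c) < size p)%N.
  rewrite -[X in (_ < X)%N](prednK (ltnW p1)) ltnS.
  apply: (leq_trans (size_sum _ _ _)); apply/bigmax_leqP => i _.
  by apply: (leq_trans (size_scale_leq _ _)); rewrite size_polyXn.
have C (c : {ffun 'I_n -> int}) (i : 'I_n) : (pc c)`_i = c i.
  rewrite /pc coef_sum (bigD1 i) //= coefZ coefXn eqxx mulr1 big1 ?addr0 // =>
    j ji.
  by rewrite coefZ coefXn eq_sym; move: ji; rewrite -val_eqE /= => /negbTE ->;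
    rewrite mulr0.
move=> x; have [q Eq] := vP.1 x.
pose r := Pdiv.CommonRing.rmodp q p.
have sr : (size r < size p)%N by rewrite Pdiv.CommonRing.ltn_rmodpN0 //
  monic_neq0.
have Er : x = pact r v.
  rewrite Eq [in LHS](Pdiv.RingMonic.rdivp_eq mp q) pactDl -[RHS]add0r.
  by congr (_ + _); apply/vP.2; eexists.
exists [ffun i : 'I_n => r`_i]; split=> [|c].
  rewrite E Er; congr (pact _ _); apply/polyP => i.
  have [lt|ge] := ltnP i n.
    by rewrite (C _ (Ordinal lt)) ffunE.
  have le (f : {poly int}) : (size f < size p)%N -> (size f <= i)%N.
    by move=> lt; apply: leq_trans ge; rewrite -ltnS prednK // ltnW.
  by rewrite !nth_default ?le.
rewrite E Er => /eqP; rewrite -subr_eq0 -pactBl => /eqP/vP.2[s Es].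
have /eqP : r - pc c = 0.
  by apply: (dvd_small mp _ Es); rewrite (leq_ltn_trans (size_polyD _ _)) //
    size_polyN gtn_max sr S.
by rewrite subr_eq0 => /eqP Erc; apply/ffunP => i; rewrite ffunE Erc C.
Qed.

Lemma cyclic_orlik N s : (0 < N)%N -> 'X^N - 1 = s * p -> orlik_block Z.
Proof.
move=> N0 Es; have ord x : iter N (zact Z) x = x.
  apply/eqP; rewrite -subr_eq0 -pactXn; have [q ->] := vP.1 x.
  rewrite -[X in _ - X]pact1 -pactBl -pactM mulrC pactM.
  by apply/eqP; rewrite (_ : pact ('X^N - 1) v = 0) ?raddf0 //; apply/vP.2;
    exists s.
split; last first.
- exists n; first by rewrite -ltnS prednK // ltnW.
  by exists v; exact: cyclic_basis.
- by exists N.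
exists (iter N.-1 (zact Z)) => x; first by rewrite -iterSr prednK.
by rewrite -iterS prednK.
Qed.

End Cyclic.

(** The base change matrices between two Z-bases are inverse to each other. *)
Lemma zbasis_size (Z : zmodEnd) m n (e : 'I_m -> Z) (f : 'I_n -> Z) :
  zbasis e -> zbasis f -> m = n.
Proof.
have half m' n' (e' : 'I_m' -> Z) (f' : 'I_n' -> Z) :
    zbasis e' -> zbasis f' -> (m' <= n')%N.
  move=> be bf; have /choice[C CE] : forall i, exists c : {ffun 'I_n' -> int},
      e' i = \sum_j f' j *~ c j by move=> i; have [c []] := bf (e' i); exists c.
  have /choice[D DE] : forall j, exists c : {ffun 'I_m' -> int},
      f' j = \sum_i e' i *~ c i by move=> j; have [c []] := be (f' j); exists c.
  pose CM : 'M[int]_(m', n') := \matrix_(i, j) C i j.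
  pose DM : 'M[int]_(n', m') := \matrix_(j, i) D j i.
  suff CD : CM *m DM = 1%:M by exact: (mulmx1_min CD).
  apply/matrixP => i k; rewrite !mxE.
  have [c [_ cU]] := be (e' i).
  have c1 : c = [ffun k => (i == k)%:R].
    apply: cU; rewrite (bigD1 i) //= ffunE eqxx big1 ?addr0 // => j ji.
    by rewrite ffunE eq_sym (negbTE ji) mulr0z.
  have c2 : c = [ffun k => \sum_j C i j * D j k].
    apply: cU; rewrite {1}(CE i).
    under eq_bigr => j _ do rewrite DE mulrz_suml.
    rewrite exchange_big /=; apply: eq_bigr => k' _.
    rewrite ffunE mulrz_sumr; apply: eq_bigr => j _.
    by rewrite mulrC mulrzA.
  have := congr1 (fun c : {ffun 'I_m' -> int} => c k) (etrans (esym c2) c1).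
  rewrite !ffunE => E; transitivity ((i == k)%:R : int); last by case: (i == k).
  by rewrite -E; apply: eq_bigr => j _; rewrite !mxE.
by move=> be bf; apply/eqP; rewrite eqn_leq (half _ _ _ _ be bf) (half _ _ _ _
  bf be).
Qed.

Lemma pact_matrix (Z : zmodEnd) n (e : 'I_n.+1 -> Z) (A : 'M[int]_n.+1) :
  (forall j, zact Z (e j) = \sum_i e i *~ A i j) ->
  forall q j, pact q (e j) = \sum_i e i *~ (horner_mx A q) i j.
Proof.
move=> AE; elim/poly_ind => [|q c IHq] j.
  by rewrite pact0l rmorph0 big1 // => i _; rewrite mxE mulr0z.
rewrite pactDl pactMX IHq pactC raddf_sum mulrC rmorphD rmorphM /=.
rewrite horner_mx_X horner_mx_C.
transitivity (\sum_i e i *~ (A *m horner_mx A q) i j + e j *~ c).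
  congr (_ + _).
  under eq_bigr => i _ do rewrite raddfMz AE mulrz_suml.
  rewrite exchange_big /=; apply: eq_bigr => i _; rewrite mxE mulrz_sumr.
  by apply: eq_bigr => k _; rewrite mulrzA.
rewrite [X in _ + X](_ : _ = \sum_i e i *~ (c%:M : 'M_n.+1) i j).
  by rewrite -big_split; apply: eq_bigr => i _; rewrite [in RHS]mxE mulrzDr.
rewrite (bigD1 j) //= mxE eqxx big1 ?addr0 // => i ij.
by rewrite mxE (negbTE ij) mulr0z.
Qed.

(** By Cayley and Hamilton the characteristic polynomial is a multiple of p; it
    is monic of the same degree. *)
Lemma cyclic_char_poly (Z : zmodEnd) (v : Z) (p q : {poly int}) :
  p \is monic -> (1 < size p)%N -> cyclic_by v p -> is_char_poly Z q -> q = p.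
Proof.
move=> mp p1 vP [n [e [A [be AE ->]]]].
have := zbasis_size be (cyclic_basis mp p1 vP).
case: n e A be AE => [|n] e A be AE En.
  by have := p1; rewrite -(prednK (ltnW p1)) -En.
have [r Er] : exists r, char_poly A = r * p.
  apply/vP.2; have [c [-> _]] := be v; rewrite raddf_sum big1 // => j _.
  rewrite raddfMz /= (pact_matrix AE) Cayley_Hamilton.
  by rewrite big1 ?mul0rz // => i _; rewrite mxE mulr0z.
have mA := char_poly_monic A.
have r0 : r != 0.
  by apply: contraTneq (monic_neq0 mA) => r0; rewrite Er r0 mul0r eqxx.
have sr : size r = 1%N.
  have r1 : (0 < size r)%N by rewrite size_poly_gt0.
  have := size_char_poly A; rewrite Er size_Mmonic //.
  move: (size r) (size p) r1 p1 En {r0 Er}.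
  by move=> x y; lia.
have mr : lead_coef r = 1.
  by have := monicP mA; rewrite Er lead_coef_Mmonic.
rewrite Er (size1_polyC (eq_leq sr)).
by move: mr; rewrite lead_coefE sr /= => ->; rewrite mul1r.
Qed.

Section CyclicSub.
Variables (X : zmodEnd) (v : X).

Definition cyc_pred : {pred X} := fun x => `[< exists q, x = pact q v >].

Fact cyc_pred_zmod_closed : zmod_closed cyc_pred.
Proof.
split=> [|x y /asboolP[q ->] /asboolP[r ->]]; apply/asboolP.
  by exists 0; rewrite pact0l.
by exists (q - r); rewrite pactBl.
Qed.

HB.instance Definition _ :=
  GRing.isZmodClosed.Build X cyc_pred cyc_pred_zmod_closed.

Lemma cyc_pred_zact x : x \in cyc_pred -> zact X x \in cyc_pred.
Proof. by move=> /asboolP[q ->]; apply/asboolP; exists (q * 'X);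
  rewrite pactMX. Qed.

Lemma cyc_pred_gen : v \in cyc_pred.
Proof. by apply/asboolP; exists 1; rewrite pact1. Qed.

(** The summand generated by v, as a module in its own right. *)
Lemma cyc_restr_cyclic (hS : forall x, x \in cyc_pred ->
  zact X x \in cyc_pred) p :
  (forall q, pact q v = 0 <-> exists r, q = r * p) ->
  exists w : zrestr hS, cyclic_by w p.
Proof.
move=> vP; exists (SubZ cyc_pred_gen).
have valp q (u : zrestr hS) : subz_val (pact q u) = pact q (subz_val u).
  exact: (@pact_morph (zrestr hS) X (val : {additive _ -> _})).
split=> [u|q].
  have /asboolP[q Eq] := valP u; exists q; apply: val_inj.
  by rewrite /= valp.
rewrite -vP; split=> [E|E].
  by rewrite -[v]/(subz_val (SubZ cyc_pred_gen)) -valp E.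
by apply: val_inj; rewrite /= valp.
Qed.

End CyclicSub.

Lemma cyclo_prod_dvd_Xn (M : {fset nat}) : 0%N \notin M ->
  exists N s, (0 < N)%N /\ 'X^N - 1 = s * cyclo_prod M.
Proof.
move=> M0; have [|N0 NP] := @common_multiple M.
  by move=> m mM; rewrite lt0n; apply: contraNneq M0 => <-.
have [zeta zetaP] := C_prim_root_exists (ltn0Sn N0).
have [|s Es] := cyclo_prod_dvd (q := 'X^(N0.+1) - 1) zetaP NP.
  move=> i _; rewrite rmorphB rmorph1 /= map_polyXn !hornerE.
  by rewrite /zr exprAC (prim_expr_order zetaP) expr1n subrr.
by exists N0.+1, s.
Qed.

Lemma cyclo_prod_subset (A B : {fset nat}) : (B `<=` A)%fset ->
  exists r, cyclo_prod A = r * cyclo_prod B.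
Proof.
move=> BA; exists (cyclo_prod (A `\` B)%fset).
rewrite /cyclo_prod -big_cat; apply: perm_big; apply: uniq_perm => //.
  rewrite cat_uniq !fset_uniq andbT /=.
  by apply/hasPn => m mB; rewrite inE mB.
move=> m; rewrite mem_cat inE; have := fsubsetP BA m.
by case: (m \in B); case: (m \in A) => // /(_ isT).
Qed.

(** The summands are generated by the elements of the presentation; their
    characteristic polynomials are the moduli, which divide one another because
    the sets are nested. *)
Lemma presented_standard (X : zmodEnd) (Ms : seq {fset nat}) :
  (forall M, M \in Ms -> M != fset0 /\ 0%N \notin M) ->
  (forall i, (i.+1 < size Ms)%N -> (nth fset0 Ms i.+1 `<=` nth fset0 Ms
    i)%fset) ->
  presented X [seq cyclo_prod M | M <- Ms] -> has_standard_decomposition X.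
Proof.
move=> MsP nest [a]; rewrite /presents size_map => -[gen rel].
set k := size Ms in gen rel *; pose M i := nth fset0 Ms i.
have ME i : (i < k)%N -> [seq cyclo_prod M | M <- Ms]`_i = cyclo_prod (M i).
  by move=> ik; rewrite (nth_map fset0).
have Mi i : (i < k)%N -> M i != fset0 /\ 0%N \notin M i.
  by move=> ik; apply: MsP; exact: mem_nth.
have relk i q : (i < k)%N -> pact q (a i) = 0 <-> exists r,
  q = r * cyclo_prod (M i).
  move=> ik; rewrite -ME //.
  have := rel (fun j => if j == i then q else 0).
  rewrite (bigD1 (Ordinal ik)) //= eqxx big1 ?addr0 => [->|j]; last first.
    by rewrite -val_eqE /= => /negbTE ->; rewrite pact0l.
  split=> [/(_ i ik)|H j jk]; first by rewrite eqxx.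
  by case: eqP => [->|_] //; exists 0; rewrite mul0r.
pose S (i : 'I_k) : zmodClosed X := cyc_pred (a i).
exists k, S, (fun i => @cyc_pred_zact X (a i)); split.
- move=> x; have [q Eq] := gen x.
  exists [ffun i : 'I_k => pact (q i) (a i)]; split.
    split; first by move=> i; rewrite ffunE; apply/asboolP; exists (q i).
    by rewrite Eq; apply: eq_bigr => i _; rewrite ffunE.
  move=> y [yS Ey].
  have /choice[r rE] : forall i : 'I_k, exists r, y i = pact r (a i).
    by move=> i; have /asboolP := yS i.
  pose r' j := if insub j is Some i then r i else 0.
  have r'E (i : 'I_k) : r' i = r i by rewrite /r' valK.
  have E0 : \sum_(i < k) pact (q i - r' i) (a i) = 0.
    apply/eqP; under eq_bigr => i _ do rewrite pactBl.
    rewrite sumrB -Eq Ey subr_eq0; apply/eqP; apply: eq_bigr => i _.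
    by rewrite rE r'E.
  apply/ffunP => i; rewrite ffunE rE; apply/eqP.
  rewrite -subr_eq0 -pactBl -r'E; apply/eqP/(relk i _ (ltn_ord i)).
  rewrite -ME //; exact: (proj1 (rel (fun i => q i - r' i)) E0).
- move=> i; have [M0 M1] := Mi i (ltn_ord i).
  have [w wP] := cyc_restr_cyclic (@cyc_pred_zact X (a i)) (fun q =>
    relk i q (ltn_ord i)).
  have [N [s [N0 Es]]] := cyclo_prod_dvd_Xn M1.
  exact: (cyclic_orlik (cyclo_prod_monic _) (size_cyclo_prod_gt1 M0 M1) wP N0
    Es).
move=> i j p q Ej.
have charE (l : 'I_k) p' : is_char_poly (zrestr (@cyc_pred_zact X (a l))) p' ->
    p' = cyclo_prod (M l).
  have [M0 M1] := Mi l (ltn_ord l).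
  have [w wP] := cyc_restr_cyclic (@cyc_pred_zact X (a l)) (fun q =>
    relk l q (ltn_ord l)).
  exact: (cyclic_char_poly (cyclo_prod_monic _) (size_cyclo_prod_gt1 M0 M1) wP).
move=> /charE -> /charE ->; apply: cyclo_prod_subset.
by rewrite Ej; apply: nest; rewrite -Ej.
Qed.

Lemma std_cover_standard (X : zmodEnd) (chi : mult_fun) : pos_supp chi ->
  zmodEnd_iso X (zbigsum [seq Or M | M <- std_cover chi]) ->
  has_standard_decomposition X.
Proof.
move=> chi0 iso.
have MP M : M \in std_cover chi -> M != fset0 /\ 0%N \notin M.
  move=> /mapP[j]; rewrite mem_iota add1n ltnS => jP ->.
  split; first exact: std_cover_set_neq0.
  by apply: contra chi0; rewrite !inE => /andP[].
apply: (@presented_standard _ (std_cover chi)) => //; last first.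
  apply: presented_of_iso (zmodEnd_iso_sym iso) _; rewrite std_cover_block.
  by apply: presented_blocks => M /MP[].
rewrite size_map size_iota => i ilt.
rewrite !(nth_map 0%N) ?size_iota ?(ltnW ilt) // !nth_iota ?(ltnW ilt) //.
apply/fsubsetP => m; rewrite !in_std_cover_set //; exact: ltnW.
Qed.

(** * Tensor products of sums of Orlik blocks with compatible multiplicities *)

Theorem theorem9p10 (chi1 chi2 : mult_fun)
    (chi1_pos : pos_supp chi1) (chi2_pos : pos_supp chi2) :
  (exists! chi3 : mult_fun, pos_supp chi3 /\ mult_otimes chi1 chi2 chi3) /\
  forall chi3 : mult_fun, pos_supp chi3 -> mult_otimes chi1 chi2 chi3 ->
  forall (P : {fset nat}) (oM oN : nat -> excOrder),
    (forall p, p \in P -> prime p) ->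
    covers_primes P chi1 -> covers_primes P chi2 ->
    compatible P oM chi1 -> compatible P oN chi2 ->
    [/\ compatible P (fun p => exc_tens (oM p) (oN p)) chi3,
        zmodEnd_iso
          (ztens (zbigsum [seq Or M | M <- std_cover chi1])
                 (zbigsum [seq Or N | N <- std_cover chi2]))
          (zbigsum [seq Or L | L <- std_cover chi3])
      & has_standard_decomposition
          (ztens (zbigsum [seq Or M | M <- std_cover chi1])
                 (zbigsum [seq Or N | N <- std_cover chi2]))].
Proof.
split.
  have [chi3 [chi3_pos chi3E]] := mult_otimes_ex chi1_pos chi2_pos.
  exists chi3; split=> // chi3' [chi3'_pos chi3'E].
  exact: mult_otimes_uniq chi3E chi3'E.
move=> chi3 chi3_pos chi3E P oM oN Pp _ _ c1 c2.
have iso := tensor_iso Pp chi1_pos chi2_pos chi3_pos c1 c2 chi3E.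
split=> //; first exact: tensor_compatible c1 c2 chi3E.
exact: std_cover_standard iso.
Qed.
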